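(* There is an absolute constant $c>0$, and for every $A \ge 1$ there is $\varepsilon_0 > 0$ depending only on $A$, such that the following holds. Let $\mu \in \mathrm{Sz}(\mathbb{T})$, let $n$ be an integer with $n \ge 10A$, and let $\zeta \in \mathbb{T}$. If $z_1, z_2 \in B(\zeta, A/n)$ and $\mathcal{K}_{\mu}(\rho\zeta) \le \varepsilon_0$ for all $\rho \in [1-A/n, 1)$, then $$ \left|\frac{k_{\mu, n}(z_1, z_2)}{k_{\mu, n}(\zeta, \zeta)} - \frac{1 - \overline{z_2}^{\,n} z_1^n}{n(1 - \overline{z_2} z_1)}\right| \le c\, e^{4A}\sup_{\rho \in [1-\delta, 1)}\sqrt{\mathcal{K}_{\mu}(\rho\zeta)}, $$ where $\delta = \max_{k=1,2}|z_{k} - \zeta|$.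
   Context: $\mathbb{T}=\{z\in\mathbb{C}: |z|=1\}$, $\mathbb{D}=\{z\in\mathbb{C}: |z|<1\}$, $B(\zeta,r)=\{z\in\mathbb{C}: |z-\zeta|\le r\}$, and $m$ is Lebesgue measure on $\mathbb{T}$ normalized by $m(\mathbb{T})=1$. The Szegő class $\mathrm{Sz}(\mathbb{T})$ is the set of Borel probability measures $\mu$ on $\mathbb{T}$ such that, if $\mu = w\,dm+\mu_s$ is the decomposition into absolutely continuous and singular parts with respect to $m$, then $\int_{\mathbb{T}}\log w\,dm>-\infty$ (equivalently $\log w\in L^1(m)$). For $\mu\in \mathrm{Sz}(\mathbb{T})$ the entropy function is $$\mathcal{K}_{\mu}(z)=\log\left(\int_{\mathbb{T}}\frac{1-|z|^2}{|1-\bar\xi z|^2}\,d\mu(\xi)\right)-\int_{\mathbb{T}}\log w(\xi)\,\frac{1-|z|^2}{|1-\bar\xi z|^2}\,dm(\xi),\qquad z\in\mathbb{D};$$ it is nonnegative. For $n\ge 1$, $k_{\mu,n}(\cdot,z_2)$ is the reproducing kernel at $z_2\in\mathbb{C}$ of the $n$-dimensional Hilbert space $\mathcal{P}_n=\mathrm{span}\{z^k: 0\le k\le n-1\}$ with the $L^2(\mu)$ inner product: $k_{\mu,n}(\cdot,z_2)\in\mathcal{P}_n$ and $(p,k_{\mu,n}(\cdot,z_2))_{L^2(\mu)}=p(z_2)$ for all $p\in\mathcal{P}_n$. The fraction $\frac{1 - \overline{z_2}^{\,n} z_1^n}{1 - \overline{z_2} z_1}$ denotes the polynomial $\sum_{k=0}^{n-1}\overline{z_2}^{\,k}z_1^k$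 (so it equals $n$ when $\overline{z_2}z_1=1$), and the supremum over the empty set (the case $\delta=0$) is $0$. *)

(* Defs.v *)
(* MathComp-Analysis over an arbitrary R : realType; the complex numbers are
   R[i] of mathcomp-real-closed, with real-valued modulus [normc]. *)
From HB Require Import structures.
From mathcomp Require Import all_boot all_order all_algebra.
From mathcomp Require Import complex.
From mathcomp Require Import all_classical all_reals all_analysis.

Set Implicit Arguments.
Unset Strict Implicit.
Unset Printing Implicit Defensive.

Import Order.TTheory GRing.Theory Num.Theory.
Import numFieldNormedType.Exports.
Import Normc.

Local Open Scope classical_set_scope.
Local Open Scope ring_scope.
Local Open Scope complex_scope.

(* [R[i]^o] carries the topology of the modulus, [set_type] the subspace
   topology. *)
Definition unit_circle (R : realType) : set R[i]^o := [set z | normc z = 1].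

(* the circle with its Borel sigma-algebra *)
Definition circle (R : realType) : Type :=
  g_sigma_algebraType (@open (set_type (@unit_circle R))).

Definition cval (R : realType) (xi : circle R) : R[i] := set_val xi.

Section normalized_lebesgue.
Context (R : realType).

Lemma unit_circle_expi (t : R) :
  (cos t +i* sin t : R[i]^o) \in @unit_circle R.
Proof. by rewrite inE /unit_circle /= cos2Dsin2 sqrtr1. Qed.

Definition expi (t : R) : set_type (@unit_circle R) :=
  SigSub (unit_circle_expi t).

HB.instance Definition _ :=
  isPointed.Build (set_type (@unit_circle R)) (expi 0).

HB.instance Definition _ := Measurable.copy (circle R)
  (g_sigma_algebraType (@open (set_type (@unit_circle R)))).

Lemma continuous_expi : continuous expi.
Proof.
apply: continuous_comp_initial => t.
apply/cvgrPdist_lt => e e0.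
case: e e0 => a b; rewrite ltcE => /andP[/eqP /= -> a0].
have a20 : 0 < a / 2 by rewrite divr_gt0.
near=> s.
have hc : `|cos t - cos s| < a / 2.
  by near: s; move: a20; move/cvgrPdist_lt: (@continuous_cos R t); apply.
have hs : `|sin t - sin s| < a / 2.
  by near: s; move: a20; move/cvgrPdist_lt: (@continuous_sin R t); apply.
rewrite /= -[_ - _]/((cos t - cos s) +i* (sin t - sin s)).
rewrite normc_def ltcE /= eqxx /=.
apply: (@le_lt_trans _ _ (`|cos t - cos s| + `|sin t - sin s|)); last first.
  by rewrite [ltRHS](splitr a) ltrD.
rewrite -[leRHS]ger0_norm ?addr_ge0// -sqrtr_sqr ler_wsqrtr//.
set x := cos t - cos s; set y := sin t - sin s.
rewrite -(real_normK (num_real x)) -(real_normK (num_real y)) sqrrD -addrA.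
by rewrite lerD2l [leRHS]addrC lerDl mulrn_wge0 ?mulr_ge0.
Unshelve. all: by end_near. Qed.

Lemma measurable_expi :
  measurable_fun [set: measurableTypeR R] (expi : measurableTypeR R -> circle R).
Proof.
pose G := @open (set_type (@unit_circle R)).
apply: (@measurability _ _ (measurableTypeR R) (circle R) setT expi G) => //.
move=> _ [U oU <-]; rewrite setTI; apply: measurable_realfun.open_measurable.
by move/continuousP: continuous_expi; exact.
Qed.

HB.instance Definition _ :=
  isMeasurableFun.Build _ _ _ _
  (expi : measurableTypeR R -> circle R) measurable_expi.

Lemma twopi_gt0 : 0 < 2 * pi :> R.
Proof. by rewrite mulr_gt0 ?pi_gt0. Qed.

(* normalized Lebesgue measure on the circle: the law of [expi t] for [t]
   uniform on [0, 2 pi] *)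
Definition circle_lebesgue : probability (circle R) R :=
  distribution (uniform_prob twopi_gt0)
    (expi : {mfun measurableTypeR R >-> circle R}).

End normalized_lebesgue.

Section szego_class.
Context (R : realType).
Local Notation m := (@circle_lebesgue R).
Implicit Types (mu : probability (circle R) R) (w : circle R -> R) (z : R[i]).

Definition singular_lebesgue (nu : {measure set (circle R) -> \bar R}) : Prop :=
  exists N, [/\ measurable N, m N = 0%E & nu (~` N) = 0%E].

(* [w] is (a version of) the density of the absolutely continuous part of [mu];
   it is unique up to an [m]-null set. *)
Definition ac_density mu w : Prop :=
  [/\ measurable_fun setT w, forall xi, 0 <= w xi &
    exists2 mu_s : {measure set (circle R) -> \bar R}, singular_lebesgue mu_s &
      forall E, measurable E ->
        (mu E = \int[m]_(xi in E) (w xi)%:E + mu_s E)%E].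

(* [lne 0 = -oo], whereas [ln 0 = 0] *)
Definition szego mu : Prop :=
  forall w, ac_density mu w -> (-oo < \int[m]_xi lne (w xi)%:E)%E.

Definition poisson z (xi : circle R) : R :=
  (1 - normc z ^+ 2) / normc (1 - (cval xi)^* * z) ^+ 2.

(* The entropy function at [z] with [normc z < 1]; its value does not depend on
   the version [w] of the density. The second integral is finite when [mu] is
   in the Szego class. *)
Definition entropy mu w z : R :=
  ln (\int[mu]_xi poisson z xi)
  - fine (\int[m]_xi (lne (w xi)%:E * (poisson z xi)%:E))%E.

End szego_class.

Section reproducing_kernel.
Context (R : realType).
Implicit Types (mu : probability (circle R) R) (p q : {poly R[i]}).

Definition cintegral mu (f : circle R -> R[i]) : R[i] :=
  (\int[mu]_xi complex.Re (f xi)) +i* (\int[mu]_xi complex.Im (f xi)).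

Definition inner_prod mu p q : R[i] :=
  cintegral mu (fun xi => p.[cval xi] * (q.[cval xi])^*).

(* [k] is the function of the first variable [k_{mu, n}(., z2)]; recall that
   [size p <= n] means that [p] has degree at most [n - 1]. *)
Definition reproducing_kernel mu (n : nat) (z2 : R[i]) (k : {poly R[i]}) : Prop :=
  (size k <= n)%N /\
  forall p, (size p <= n)%N -> inner_prod mu p k = p.[z2].

End reproducing_kernel.

(* Main.v *)
(* Let z0 = (1 - A/n) zeta, let a be the integral of the Poisson kernel P of z0 against mu, let k0 be the
   kernel of Lebesgue measure m, i.e. the Szego sum, and put E = a k_mu - k0. If K_mu(z0) <= s^2, the
   tangent-line inequality for exp shows that mu/a and m differ by at most 6 B s on functions dominated by
   B P. A polynomial substitute for an outer function, built from Fejer means of log w, bounds |p(z)|^2 by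
   almost exp(-P_z[log w]) k0(z, z) times the L^2(mu)-norm of p squared; so k_mu(z, z) is almost at most
   k0(z, z) / a for |z| = |z0| and, by reflection, for |z| = 1/|z0|. In L^2(mu/a) one has
   E(x, z) = <E_z, E_x> - (<k0_z, k0_x> - <k0_z, k0_x>_m), hence E = O(n s) on these two circles, up to a
   factor that grows slower than a Gaussian in n |z - zeta| / A. The maximum principle on the annulus
   between them, applied to E times a power of 1 + z conj(zeta) in each variable, transports the bound to
   B(zeta, A/n), and dividing by E(zeta, zeta) + n bounds the difference of the two ratios by O(s e^{4A}).
   That difference vanishes at (zeta, zeta), so Schwarz' lemma in each variable gains a factor
   n delta / A, whereas Harnack's inequality only loses K_mu(z0) <= 8 A / (n delta) K_mu((1 - delta) zeta). *)

(* Integrability of [log w] says nothing at a single point of the unit circle; only its Poisson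
   means at depth comparable with A/n are controlled. Hence the detour over the circles of radii 1 -
   u and 1/(1 - u), u = A/n, on both sides of the points of interest. An upper bound for k_mu(x, x)
   is all that point evaluation yields. It suffices because on the diagonal the identity for E reads
   E(x, x) = |E_x|^2 - defect: the upper bound controls the norm of E_x, and Cauchy-Schwarz then
   controls E(x, z) off the diagonal from both sides. Origin of the exponent: reflection costs (1 -
   u)^(-N) on the outer circle (N = n - 1), and the maximum principle pays about half of this in
   each variable. With u <= 1/10 this gives e^{1.2 A}, the excursions of |x| and |z| above 1 give
   another e^{A}, and at the centre only e^{1.2 A} is left. In the ratio the centre error is
   multiplied by a Szego sum of size n e^{2 A}, so the worst exponent is 3.2 A. The functions
   integrated against Cauchy kernels are polynomials, so that Cauchy integrals and exchanges of
   integrals are finite algebra. *)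
Require Import Defs.
From mathcomp Require Import all_boot all_order all_algebra.
From mathcomp Require Import complex.
From mathcomp Require Import all_classical all_reals all_analysis.
From mathcomp Require Import measurable_realfun.
From mathcomp Require Import ring lra.

Set Implicit Arguments.
Unset Strict Implicit.
Unset Printing Implicit Defensive.

Import Order.TTheory GRing.Theory Num.Theory.
Import numFieldNormedType.Exports.
Import Normc.

Local Open Scope classical_set_scope.
Local Open Scope ring_scope.
Local Open Scope complex_scope.

(** * Complex numbers *)

Section complex_lemmas.
Variable R : realType.
(* Without this, [z ^*] may be read as [Num.conj z], which the lemmas on [conjc] do not match. *)
Local Notation "z ^*" := (conjc z) : ring_scope.
Implicit Types x y z : R[i].
Local Notation Re := (@complex.Re R).
Local Notation Im := (@complex.Im R).

Lemma RecD x y : Re (x + y) = Re x + Re y.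
Proof. by case: x y => [a b] [c d]. Qed.
Lemma ImcD x y : Im (x + y) = Im x + Im y.
Proof. by case: x y => [a b] [c d]. Qed.
Lemma RecN x : Re (- x) = - Re x. Proof. by case: x. Qed.
Lemma ImcN x : Im (- x) = - Im x. Proof. by case: x. Qed.
Lemma RecM x y : Re (x * y) = Re x * Re y - Im x * Im y.
Proof. by case: x y => [a b] [c d]. Qed.
Lemma ImcM x y : Im (x * y) = Re x * Im y + Im x * Re y.
Proof. by case: x y => [a b] [c d]. Qed.
Lemma RecJ x : Re x^* = Re x. Proof. by case: x. Qed.
Lemma ImcJ x : Im x^* = - Im x. Proof. by case: x. Qed.
Lemma complex_eq x y : Re x = Re y -> Im x = Im y -> x = y.
Proof. by case: x y => [a b] [c d] /= -> ->. Qed.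
Lemma Rec1 : Re 1 = 1. Proof. by []. Qed.
Lemma Rec0 : Re 0 = 0. Proof. by []. Qed.
Lemma natC n : (n%:R : R[i]) = (n%:R : R)%:C. Proof. by rewrite rmorph_nat. Qed.
Lemma Rec_nat n : Re n%:R = n%:R. Proof. by rewrite natC. Qed.

Lemma conjcD x y : (x + y)^* = x^* + y^*. Proof. exact: raddfD. Qed.
Lemma conjcB x y : (x - y)^* = x^* - y^*. Proof. exact: raddfB. Qed.
Lemma conjcM x y : (x * y)^* = x^* * y^*. Proof. exact: rmorphM. Qed.
Lemma conjcX x n : (x ^+ n)^* = x^* ^+ n. Proof. exact: rmorphXn. Qed.

Lemma conjc_sum (I : Type) (s : seq I) (F : I -> R[i]) :
  (\sum_(i <- s) F i)^* = \sum_(i <- s) (F i)^*.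
Proof. by elim/big_rec2: _ => [|i x y _ <-]; [exact: conjc0|exact: conjcD]. Qed.
Lemma conjc_one : (1 : R[i])^* = 1. Proof. exact: conjc1. Qed.

Lemma normc_ge0 z : 0 <= normc z.
Proof. by case: z => a b; exact: sqrtr_ge0. Qed.
Lemma normc_sq z : normc z ^+ 2 = Re z ^+ 2 + Im z ^+ 2.
Proof. by case: z => a b /=; rewrite sqr_sqrtr// addr_ge0// sqr_ge0. Qed.
Lemma mulcJ z : z * z^* = (normc z ^+ 2)%:C.
Proof.
rewrite normc_sq; case: z => a b; apply: complex_eq => /=; ring.
Qed.
Lemma normcJr z : normc z^* = normc z.
Proof. by case: z => a b /=; rewrite sqrrN. Qed.
Lemma normc_real (a : R) : normc a%:C = `|a|.
Proof. by rewrite /= expr0n addr0 sqrtr_sqr. Qed.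
Lemma normcX z n : normc (z ^+ n) = normc z ^+ n.
Proof.
elim: n => [|n IH]; first by rewrite !expr0 normc1.
by rewrite !exprS normcM IH.
Qed.
Lemma normcD_le x y : normc (x + y) <= normc x + normc y.
Proof. exact: le_normcD. Qed.
Lemma normcNr x : normc (- x) = normc x. Proof. exact: normcN. Qed.
Lemma normcBC x y : normc (x - y) = normc (y - x).
Proof. by rewrite -normcNr opprB. Qed.
Lemma normcB_le x y : normc (x - y) <= normc x + normc y.
Proof. by rewrite -(normcNr y); exact: normcD_le. Qed.
Lemma normc_triangle y x z : normc (x - z) <= normc (x - y) + normc (y - z).
Proof. by rewrite -[x - z](subrKA y); exact: normcD_le. Qed.
Lemma normcB_ge x y : normc x - normc y <= normc (x - y).
Proof. by rewrite lerBlDr -{1}(subrK y x); exact: normcD_le. Qed.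
Lemma normc_zero : normc (0 : R[i]) = 0.
Proof. by rewrite /= expr0n addr0 sqrtr0. Qed.
Lemma normc_eq0 z : (normc z == 0) = (z == 0).
Proof. by apply/eqP/eqP => [/eq0_normc//|->]; exact: normc_zero. Qed.
Lemma normc_gt0 z : (0 < normc z) = (z != 0).
Proof. by rewrite lt_neqAle normc_ge0 andbT eq_sym normc_eq0. Qed.
Lemma normc_sum (I : Type) (s : seq I) (P : pred I) (F : I -> R[i]) :
  normc (\sum_(i <- s | P i) F i) <= \sum_(i <- s | P i) normc (F i).
Proof.
elim/big_ind2: _ => [|x a y b xa yb|//]; first by rewrite normc_zero.
by apply: le_trans (normcD_le _ _) _; exact: lerD.
Qed.
Lemma Re_le_normc z : Re z <= normc z.
Proof.
apply: le_trans (ler_norm _) _.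
rewrite -(@ler_pXn2r _ 2) ?nnegrE ?normc_ge0// real_normK ?num_real// normc_sq.
by rewrite lerDl sqr_ge0.
Qed.
Lemma normRe_le z : `|Re z| <= normc z.
Proof.
by rewrite ler_norml Re_le_normc lerNl -RecN -(normcNr z) Re_le_normc.
Qed.
Lemma normIm_le z : `|Im z| <= normc z.
Proof.
rewrite -(@ler_pXn2r _ 2) ?nnegrE ?normc_ge0// real_normK ?num_real// normc_sq.
by rewrite lerDr sqr_ge0.
Qed.
Lemma normc_le_ReIm z : normc z <= `|Re z| + `|Im z|.
Proof.
rewrite -(@ler_pXn2r _ 2) ?nnegrE ?normc_ge0 ?addr_ge0// normc_sq sqrrD.
rewrite !real_normK ?num_real// -addrA lerD2l lerDr.
by rewrite mulrn_wge0// mulr_ge0.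
Qed.
Lemma RecZ (a : R) z : Re (a%:C * z) = a * Re z.
Proof. by rewrite RecM /= mul0r subr0. Qed.
Lemma ImcZ (a : R) z : Im (a%:C * z) = a * Im z.
Proof. by rewrite ImcM /= mul0r addr0. Qed.
Lemma normcZ (a : R) z : 0 <= a -> normc (a%:C * z) = a * normc z.
Proof. by move=> a0; rewrite normcM normc_real ger0_norm. Qed.
Lemma normc_sqB x y :
  normc (x - y) ^+ 2 = normc x ^+ 2 + normc y ^+ 2 - 2 * Re (x^* * y).
Proof. rewrite !normc_sq RecD ImcD RecN ImcN RecM RecJ ImcJ; ring. Qed.
Lemma RecMJ_normc z : Re (z * z^*) = normc z ^+ 2.
Proof. by rewrite mulcJ. Qed.
Lemma normc_nat n : normc (n%:R : R[i]) = n%:R.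
Proof.
have -> : (n%:R : R[i]) = (n%:R : R)%:C by rewrite rmorph_nat.
by rewrite normc_real normr_nat.
Qed.
End complex_lemmas.

(** * Integration of bounded measurable functions *)

Section bounded_measurable.
Context d (T : measurableType d) (R : realType).
Implicit Types f g : T -> R.

(** Boundedness gives integrability against every probability measure and is stable under products,
    which integrability alone is not. The density and its logarithm are only integrable ([intg]),
    and [intgM] lets them meet bounded factors. *)
Definition bmf f := measurable_fun setT f /\ exists C, forall x, `|f x| <= C.

Lemma bmf_cst a : bmf (fun=> a).
Proof. by split; [exact: measurable_cst | exists `|a|]. Qed.
Lemma bmfD f g : bmf f -> bmf g -> bmf (fun x => f x + g x).
Proof.
move=> [mf [C fC]] [mg [D gD]]; split; first exact: measurable_funD.
by exists (C + D) => x; apply: le_trans (ler_normD _ _) _; exact: lerD.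
Qed.
Lemma bmfM f g : bmf f -> bmf g -> bmf (fun x => f x * g x).
Proof.
move=> [mf [C fC]] [mg [D gD]]; split; first exact: measurable_funM.
by exists (C * D) => x; rewrite normrM ler_pM.
Qed.
Lemma bmfZ a f : bmf f -> bmf (fun x => a * f x).
Proof. by move=> bf; apply: bmfM => //; exact: bmf_cst. Qed.
Lemma bmfN f : bmf f -> bmf (fun x => - f x).
Proof.
move=> [mf [C fC]]; split; first exact: measurable_funN.
by exists C => x; rewrite normrN.
Qed.
Lemma bmfB f g : bmf f -> bmf g -> bmf (fun x => f x - g x).
Proof. by move=> bf /bmfN; exact: bmfD. Qed.
Lemma bmfX f n : bmf f -> bmf (fun x => f x ^+ n).
Proof.
move=> bf; elim: n => [|n IH]; first exact: bmf_cst.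
by under eq_fun do rewrite exprS; exact: bmfM.
Qed.
Lemma bmf_inv f c : 0 < c -> (forall x, c <= f x) -> bmf f ->
  bmf (fun x => (f x)^-1).
Proof.
move=> c0 cf [mf _]; have f0 x : 0 < f x by exact: lt_le_trans (cf x).
split.
  have -> : (fun x => (f x)^-1) = expR \o (-%R \o (@ln R \o f)).
    by apply/funext => x /=; rewrite expRN lnK ?posrE.
  by repeat (apply: measurableT_comp => //).
by exists c^-1 => x; rewrite normfV ger0_norm ?lef_pV2 ?posrE// ltW.
Qed.
Lemma bmf_sqrt f : bmf f -> bmf (fun x => Num.sqrt (f x)).
Proof.
move=> [mf [C fC]]; split.
  apply: (@measurableT_comp _ _ _ _ _ _ (@Num.sqrt R)) => //.
  by apply: continuous_measurable_fun; exact: sqrt_continuous.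
exists (Num.sqrt C) => x; rewrite ger0_norm ?sqrtr_ge0// ler_wsqrtr//.
exact: le_trans (ler_norm _) (fC x).
Qed.
Lemma bmf_sum (I : Type) (s : seq I) (F : I -> T -> R) :
  (forall i, bmf (F i)) -> bmf (fun x => \sum_(i <- s) F i x).
Proof.
move=> bF; elim: s => [|i s IH].
  by under eq_fun do rewrite big_nil; exact: bmf_cst.
by under eq_fun do rewrite big_cons; exact: bmfD.
Qed.

Variable mu : probability T R.
Definition intg f := mu.-integrable setT (EFin \o f).

Lemma intg_cst a : intg (fun=> a).
Proof. exact: finite_measure_integrable_cst. Qed.
Lemma intg_bmf f : bmf f -> intg f.
Proof.
move=> [mf [C fC]]; apply: (@le_integrable _ _ _ _ _ _ _ (EFin \o (fun=> C))).
- exact: measurableT.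
- exact/measurable_EFinP.
- move=> x _; rewrite /= lee_fin (le_trans (fC x))// ler_norm//.
- exact: intg_cst.
Qed.
Lemma intgD f g : intg f -> intg g -> intg (fun x => f x + g x).
Proof. exact: integrableD. Qed.
Lemma intgB f g : intg f -> intg g -> intg (fun x => f x - g x).
Proof. exact: integrableB. Qed.
Lemma intgZ a f : intg f -> intg (fun x => a * f x).
Proof. exact: integrableZl. Qed.
Lemma intg_norm f : intg f -> intg (fun x => `|f x|).
Proof. exact: integrable_norm. Qed.
Lemma intg_meas f : intg f -> measurable_fun setT f.
Proof. by move=> /integrableP[/measurable_EFinP]. Qed.
Lemma intg_dom f g : measurable_fun setT f -> intg g ->
  (forall x, `|f x| <= g x) -> intg f.
Proof.
move=> mf ig fg; apply: (@le_integrable _ _ _ _ _ _ _ (EFin \o g)) => //.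
  exact/measurable_EFinP.
by move=> x _; rewrite /= lee_fin (le_trans (fg x))// ler_norm.
Qed.
Lemma intgM f g : bmf f -> intg g -> intg (fun x => f x * g x).
Proof.
move=> [mf [C fC]] ig; apply: (@intg_dom _ (fun x => C * `|g x|)).
- by apply: measurable_funM => //; exact: intg_meas.
- by apply: intgZ; exact: intg_norm.
- by move=> x; rewrite normrM ler_wpM2r.
Qed.

Lemma RID f g : intg f -> intg g ->
  \int[mu]_x (f x + g x) = \int[mu]_x f x + \int[mu]_x g x.
Proof. exact: RintegralD. Qed.
Lemma RIB f g : intg f -> intg g ->
  \int[mu]_x (f x - g x) = \int[mu]_x f x - \int[mu]_x g x.
Proof. exact: RintegralB. Qed.
Lemma RIZ a f : intg f -> \int[mu]_x (a * f x) = a * \int[mu]_x f x.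
Proof. exact: RintegralZl. Qed.
Lemma RI_cst a : \int[mu]_x a = a.
Proof.
rewrite Rintegral_cst// -[RHS]mulr1; congr (_ * _).
exact: (congr1 fine (probability_setT mu)).
Qed.
Lemma RI_le f g : intg f -> intg g -> (forall x, f x <= g x) ->
  \int[mu]_x f x <= \int[mu]_x g x.
Proof. by move=> intf intG fg; apply: le_Rintegral. Qed.
Lemma RI_ge0 f : (forall x, 0 <= f x) -> 0 <= \int[mu]_x f x.
Proof. by move=> f0; apply: Rintegral_ge0. Qed.
Lemma RI_norm f : intg f -> `|\int[mu]_x f x| <= \int[mu]_x `|f x|.
Proof. by move=> intf; apply: le_normr_Rintegral. Qed.
Lemma eq_RI f g : f =1 g -> \int[mu]_x f x = \int[mu]_x g x.
Proof. by move=> fg; apply: eq_Rintegral => x _. Qed.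
Lemma RI_EFin f : intg f -> (\int[mu]_x (f x)%:E)%E = (\int[mu]_x f x)%:E.
Proof. by move=> intf; rewrite fineK// integrable_fin_num. Qed.
Lemma RI_sum (I : Type) (s : seq I) (F : I -> T -> R) :
  (forall i, intg (F i)) ->
  intg (fun x => \sum_(i <- s) F i x) /\
  \int[mu]_x (\sum_(i <- s) F i x) = \sum_(i <- s) \int[mu]_x F i x.
Proof.
move=> intF; elim: s => [|i s [IH1 IH2]].
  under eq_fun do rewrite big_nil; split; first exact: intg_cst.
  by rewrite RI_cst big_nil.
under eq_fun do rewrite big_cons; split; first exact: intgD.
by rewrite RID// IH2 big_cons.
Qed.

Lemma RI_cauchy_schwarz f g : bmf f -> bmf g ->
  (\int[mu]_x (f x * g x)) ^+ 2 <=
  (\int[mu]_x (f x ^+ 2)) * \int[mu]_x (g x ^+ 2).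
Proof.
move=> bf bg.
have if2 : intg (fun x => f x ^+ 2) by apply: intg_bmf; exact: bmfX.
have ig2 : intg (fun x => g x ^+ 2) by apply: intg_bmf; exact: bmfX.
have ifg : intg (fun x => f x * g x) by apply: intg_bmf; exact: bmfM.
set a := \int[mu]_x (f x ^+ 2); set b := \int[mu]_x (f x * g x).
set c := \int[mu]_x (g x ^+ 2).
have a0 : 0 <= a by apply: RI_ge0 => x; exact: sqr_ge0.
have c0 : 0 <= c by apply: RI_ge0 => x; exact: sqr_ge0.
have H t : 0 <= t ^+ 2 * a - 2 * t * b + c.
  have : 0 <= \int[mu]_x (t * f x - g x) ^+ 2 by apply: RI_ge0 => x; exact: sqr_ge0.
  rewrite (@eq_RI _ (fun x => (t ^+ 2 * f x ^+ 2 - 2 * t * (f x * g x)) + g x ^+ 2)).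
    rewrite RID ?RIB ?RIZ//; try exact: intgZ.
    by apply: intgB; exact: intgZ.
  by move=> x; ring.
have [a_gt0|] := ltP 0 a.
  have := H (b / a).
  rewrite -(pmulr_rge0 _ a_gt0).
  have -> : a * ((b / a) ^+ 2 * a - 2 * (b / a) * b + c) = a * c - b ^+ 2.
    by field; exact: lt0r_neq0.
  by rewrite subr_ge0.
move=> a_le0; have a00 : a = 0 by apply/eqP; rewrite eq_le a_le0 a0.
rewrite a00 mul0r.
have [b0|b0] := eqVneq b 0; first by rewrite b0 expr0n.
(* With [a = 0] the quadratic in [t] degenerates to the line c - 2 t b, and this [t] gives it the
   value -1. *)
have := H ((c + 1) / (2 * b)); rewrite a00 mulr0 add0r.
have -> : - (2 * ((c + 1) / (2 * b)) * b) + c = -1.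
  by field; rewrite b0.
by rewrite ler0N1.
Qed.
End bounded_measurable.

(** * Bounded complex functions on the circle and their integrals *)

Section circle_functions.
Variable R : realType.
Local Notation "z ^*" := (conjc z) : ring_scope.
Local Notation T := (circle R).
Implicit Types (f g : T -> R[i]) (p : {poly R[i]}).
Local Notation Re := (@complex.Re R).
Local Notation Im := (@complex.Im R).

Lemma normc_cval (xi : T) : normc (cval xi) = 1.
Proof. by have := set_valP xi. Qed.
Lemma cvalJ (xi : T) : cval xi * (cval xi)^* = 1.
Proof. by rewrite mulcJ normc_cval expr1n. Qed.
Lemma cval_neq0 (xi : T) : cval xi != 0.
Proof. by rewrite -normc_gt0 normc_cval. Qed.
Lemma cvalV (xi : T) : (cval xi)^-1 = (cval xi)^*.
Proof. by rewrite -[LHS]mulr1 -(cvalJ xi) mulKf// cval_neq0. Qed.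

(** A Lipschitz function is continuous for the subspace topology, whose open sets generate the
    sigma-algebra of [circle R]. Applied to the real and imaginary parts. *)
Lemma measurable_circle (h : R[i] -> R) :
  (forall x y, `|h x - h y| <= normc (x - y)) ->
  measurable_fun setT (fun xi : T => h (cval xi)).
Proof.
move=> hlip.
have hc : continuous (h : R[i]^o -> R).
  move=> x; apply/(@cvgrPdist_lt _ R _ _ (@nbhs_filter (R[i]^o) x)) => e e0.
  have e0' : 0 < e%:C :> R[i] by rewrite ltcR.
  have /cvgrPdist_lt /(_ _ e0') hx : (y @[y --> (x : R[i]^o)] --> (x : R[i]^o)).
    exact: cvg_id.
  apply: (@filterS _ _ (@nbhs_filter (R[i]^o) x) _ _ _ hx) => y.
  rewrite normc_def ltcR => xy.
  apply: le_lt_trans (hlip x y) _; move: xy.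
  by case: (x - y).
have hc' : continuous (h \o (set_val : set_type (@unit_circle R) -> R[i]^o)).
  move=> x; apply: continuous_comp; [exact: initial_continuous | exact: hc].
apply: (@measurability _ _ T R setT _ _ (RGenOpens.measurableE R)).
move=> _ [_ [a [b ->] <-]]; rewrite setTI; apply: sub_sigma_algebra.
by move/continuousP : hc'; apply; exact: interval_open.
Qed.

Lemma bmf_Re_cval : bmf (fun xi : T => Re (cval xi)).
Proof.
split; last by exists 1 => x; rewrite -(normc_cval x) normRe_le.
by apply: measurable_circle => x y; rewrite -RecN -RecD normRe_le.
Qed.
Lemma bmf_Im_cval : bmf (fun xi : T => Im (cval xi)).
Proof.
split; last by exists 1 => x; rewrite -(normc_cval x) normIm_le.
by apply: measurable_circle => x y; rewrite -ImcN -ImcD normIm_le.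
Qed.

Definition bmc f := bmf (fun x => Re (f x)) /\ bmf (fun x => Im (f x)).

Lemma bmc_cval : bmc (@cval R).
Proof. by split; [exact: bmf_Re_cval | exact: bmf_Im_cval]. Qed.
Lemma bmc_cst a : bmc (fun=> a).
Proof. by split; exact: bmf_cst. Qed.
Lemma bmcD f g : bmc f -> bmc g -> bmc (fun x => f x + g x).
Proof.
move=> [f1 f2] [g1 g2]; split.
  by under eq_fun do rewrite RecD; exact: bmfD.
by under eq_fun do rewrite ImcD; exact: bmfD.
Qed.
Lemma bmcN f : bmc f -> bmc (fun x => - f x).
Proof.
move=> [f1 f2]; split.
  by under eq_fun do rewrite RecN; exact: bmfN.
by under eq_fun do rewrite ImcN; exact: bmfN.
Qed.
Lemma bmcB f g : bmc f -> bmc g -> bmc (fun x => f x - g x).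
Proof. by move=> bf /bmcN; exact: bmcD. Qed.
Lemma bmcM f g : bmc f -> bmc g -> bmc (fun x => f x * g x).
Proof.
move=> [f1 f2] [g1 g2]; split.
  by under eq_fun do rewrite RecM; apply: bmfB; exact: bmfM.
by under eq_fun do rewrite ImcM; apply: bmfD; exact: bmfM.
Qed.
Lemma bmcJ f : bmc f -> bmc (fun x => (f x)^*).
Proof.
move=> [f1 f2]; split.
  by under eq_fun do rewrite RecJ.
by under eq_fun do rewrite ImcJ; exact: bmfN.
Qed.
Lemma bmcX f n : bmc f -> bmc (fun x => f x ^+ n).
Proof.
move=> bf; elim: n => [|n IH]; first exact: bmc_cst.
by under eq_fun do rewrite exprS; exact: bmcM.
Qed.
Lemma bmc_real (h : T -> R) : bmf h -> bmc (fun x => (h x)%:C).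
Proof. by move=> bh; split => //=; exact: bmf_cst. Qed.
Lemma bmf_normc f : bmc f -> bmf (fun x => normc (f x)).
Proof.
move=> [f1 f2].
have -> : (fun x => normc (f x)) = (fun x => Num.sqrt (Re (f x) ^+ 2 + Im (f x) ^+ 2)).
  by apply/funext => x; case: (f x).
by apply: bmf_sqrt; apply: bmfD; exact: bmfX.
Qed.
Lemma bmc_inv f c : 0 < c -> (forall x, c <= normc (f x)) -> bmc f ->
  bmc (fun x => (f x)^-1).
Proof.
move=> c0 cf bf.
have -> : (fun x => (f x)^-1) = (fun x => ((normc (f x) ^+ 2)^-1)%:C * (f x)^*).
  apply/funext => x; have fx0 : f x != 0.
    by rewrite -normc_gt0; exact: lt_le_trans (cf x).
  apply: (mulfI fx0); rewrite mulfV// mulrCA mulcJ -rmorphM mulVf//.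
  by rewrite expf_neq0// normc_eq0.
apply: bmcM; last exact: bmcJ.
apply: bmc_real; apply: (@bmf_inv _ _ _ _ (c ^+ 2)).
- by rewrite exprn_gt0.
- by move=> x; rewrite lerXn2r ?nnegrE ?normc_ge0// ltW.
- by apply: bmfX; exact: bmf_normc.
Qed.
Lemma bmc_sum (I : Type) (s : seq I) (F : I -> T -> R[i]) :
  (forall i, bmc (F i)) -> bmc (fun x => \sum_(i <- s) F i x).
Proof.
move=> bF; elim: s => [|i s IH].
  by under eq_fun do rewrite big_nil; exact: bmc_cst.
by under eq_fun do rewrite big_cons; exact: bmcD.
Qed.
Lemma bmc_horner p f : bmc f -> bmc (fun x => p.[f x]).
Proof.
move=> bf; under eq_fun do rewrite horner_coef.
by apply: bmc_sum => i; apply: bmcM; [exact: bmc_cst | exact: bmcX].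
Qed.
Lemma bmc_poly p : bmc (fun x => p.[cval x]).
Proof. exact: bmc_horner bmc_cval. Qed.
Lemma bmf_poly p : bmf (fun x => normc p.[cval x]).
Proof. exact: bmf_normc (bmc_poly p). Qed.

Variable mu : probability T R.
Local Notation CI := (cintegral mu).

Lemma eq_CI f g : f =1 g -> CI f = CI g.
Proof. by move=> /funext ->. Qed.
Lemma CI_cst a : CI (fun=> a) = a.
Proof. by rewrite /cintegral !RI_cst; case: a. Qed.
Lemma CID f g : bmc f -> bmc g -> CI (fun x => f x + g x) = CI f + CI g.
Proof.
move=> [f1 f2] [g1 g2]; apply: complex_eq; rewrite /cintegral /=.
  by under eq_RI do rewrite RecD; rewrite RID//; exact: intg_bmf.
by under eq_RI do rewrite ImcD; rewrite RID//; exact: intg_bmf.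
Qed.
Lemma CIZ a f : bmc f -> CI (fun x => a * f x) = a * CI f.
Proof.
move=> [f1 f2]; apply: complex_eq; rewrite ?RecM ?ImcM /cintegral /=.
  under eq_RI do rewrite RecM; rewrite RIB ?RIZ//; try exact: intg_bmf.
  - by apply: intgZ; exact: intg_bmf.
  - by apply: intgZ; exact: intg_bmf.
under eq_RI do rewrite ImcM; rewrite RID ?RIZ//; try exact: intg_bmf.
- by apply: intgZ; exact: intg_bmf.
- by apply: intgZ; exact: intg_bmf.
Qed.
Lemma CIN f : bmc f -> CI (fun x => - f x) = - CI f.
Proof. by move=> bf; rewrite -mulN1r -CIZ//; apply: eq_CI => x; rewrite mulN1r. Qed.
Lemma CIB f g : bmc f -> bmc g -> CI (fun x => f x - g x) = CI f - CI g.
Proof. by move=> bf bg; rewrite CID ?CIN//; exact: bmcN. Qed.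
Lemma CIJ f : bmc f -> CI (fun x => (f x)^*) = (CI f)^*.
Proof.
move=> [f1 f2]; apply: complex_eq; rewrite ?RecJ ?ImcJ /cintegral /=.
  by under eq_RI do rewrite RecJ.
under eq_RI do rewrite ImcJ -mulN1r.
by rewrite RIZ ?mulN1r//; exact: intg_bmf.
Qed.
Lemma CI_real (h : T -> R) : CI (fun x => (h x)%:C) = (\int[mu]_x h x)%:C.
Proof. by rewrite /cintegral /= RI_cst. Qed.
Lemma CI_sum (I : Type) (s : seq I) (F : I -> T -> R[i]) :
  (forall i, bmc (F i)) ->
  CI (fun x => \sum_(i <- s) F i x) = \sum_(i <- s) CI (F i).
Proof.
move=> bF; elim: s => [|i s IH].
  by under eq_CI do rewrite big_nil; rewrite CI_cst big_nil.
under eq_CI do rewrite big_cons; rewrite CID//; last exact: bmc_sum.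
by rewrite big_cons IH.
Qed.
Lemma Re_CI f : Re (CI f) = \int[mu]_x Re (f x). Proof. by []. Qed.
(** A rotation by the unimodular [u] makes the integral real and nonnegative, so that monotonicity
    of real integrals applies to Re (u f) <= |f|. *)
Lemma CI_norm_le f : bmc f -> normc (CI f) <= \int[mu]_x normc (f x).
Proof.
move=> bf; have [->|c0] := eqVneq (CI f) 0.
  by rewrite normc_zero; apply: RI_ge0 => x; exact: normc_ge0.
have n0 : normc (CI f) != 0 by rewrite normc_eq0.
set u := ((normc (CI f))^-1)%:C * (CI f)^*.
have nu : normc u = 1.
  by rewrite normcZ ?invr_ge0 ?normc_ge0// normcJr mulVf.
have -> : normc (CI f) = Re (CI (fun x => u * f x)).
  by rewrite CIZ// -mulrA RecZ [_^* * _]mulrC mulcJ /= expr2 mulKf.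
rewrite Re_CI; apply: RI_le => [||x].
- by apply: intg_bmf; case: (bmcM (bmc_cst u) bf).
- by apply: intg_bmf; exact: bmf_normc.
- by apply: le_trans (Re_le_normc _) _; rewrite normcM nu mul1r.
Qed.
Lemma CI_norm_dom f (g : T -> R) : bmc f -> intg mu g ->
  (forall x, normc (f x) <= g x) -> normc (CI f) <= \int[mu]_x g x.
Proof.
move=> bf ig fg; apply: le_trans (CI_norm_le bf) _.
by apply: RI_le => //; apply: intg_bmf; exact: bmf_normc.
Qed.
End circle_functions.

(** * Cauchy and Poisson integrals of polynomials *)

Section circle_lebesgue_integrals.
Variable R : realType.
Local Notation T := (circle R).
Local Notation m := (@circle_lebesgue R).
Local Notation CI := (cintegral m).
Implicit Types (z : R[i]) (p q F : {poly R[i]}) (xi : T).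

Lemma RI_circle_lebesgue (h : T -> R) : bmf h -> (forall x, 0 <= h x) ->
  (\int[m]_x h x)%:E =
  ((2 * pi)^-1%:E * \int[lebesgue_measure]_(t in `[0%R, (2 * pi)%R]) (h (expi t))%:E)%E.
Proof.
move=> bh h0; rewrite -RI_EFin; last exact: intg_bmf.
have mh : measurable_fun setT (EFin \o h) by apply/measurable_EFinP; case: bh.
rewrite ge0_integral_distribution//.
rewrite integral_uniform//.
- by rewrite subr0.
- by apply: measurableT_comp => //; exact: measurable_expi.
- by move=> x; rewrite lee_fin.
Qed.

Lemma cval_expiX (t : R) n :
  cval (expi t : T) ^+ n = cos (t *+ n) +i* sin (t *+ n).
Proof.
elim: n => [|n IH]; first by rewrite expr0 mulr0n cos0 sin0.
rewrite exprS IH mulrS cosD sinD; apply: complex_eq => /=.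
  by [].
by rewrite addrC.
Qed.

Lemma cos_int_2pi n : cos ((2 * pi) *+ n) = 1 :> R.
Proof.
elim: n => [|n IH]; first by rewrite mulr0n cos0.
by rewrite mulrS cosD IH mulr_natl cos2pi sin2pi mul0r subr0 mulr1.
Qed.
Lemma sin_int_2pi n : sin ((2 * pi) *+ n) = 0 :> R.
Proof.
elim: n => [|n IH]; first by rewrite mulr0n sin0.
by rewrite mulrS sinD IH mulr_natl cos2pi sin2pi mulr0 mul0r addr0.
Qed.

Lemma CI_expr n : CI (fun x => cval x ^+ n.+1) = 0.
Proof.
have pi2 : 0 < 2 * pi :> R by exact: twopi_gt0.
have [bre bim] := bmcX n.+1 (@bmc_cval R).
have n0 : n.+1%:R != 0 :> R by rewrite pnatr_eq0.
have bnd (x : T) : normc (cval x ^+ n.+1) = 1 by rewrite normcX normc_cval expr1n.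
have dln (t : R) : is_derive t 1 (fun s : R => s *+ n.+1) (n.+1%:R).
  have -> : (fun s : R => s *+ n.+1) = n.+1%:R \*: (@id R).
    by apply/funext => s; rewrite /= /GRing.scale/= mulr_natl.
  by apply: is_derive_eq; rewrite /GRing.scale/= mulr1.
have ctsn : continuous (fun s : R => s *+ n.+1).
  by move=> t; apply: differentiable_continuous; apply/derivable1_diffP; exact: ex_derive.
have key (f : R -> R) (F : R -> R) : (forall t : R, is_derive t (1 : R) F (1 + f t)) ->
    continuous f -> F (2 * pi) - F 0 = 2 * pi ->
    (\int[lebesgue_measure]_(t in `[0%R, (2 * pi)%R]) (1 + f t)%:E)%E = (2 * pi)%:E.
  move=> dF cf F2; rewrite (@continuous_FTC2 _ _ F)//.
  - by rewrite -EFinB F2.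
  - apply: continuous_subspaceT => t; apply: continuousD; first exact: cst_continuous.
    exact: cf.
  - have cF : continuous F.
      by move=> t; apply: differentiable_continuous; apply/derivable1_diffP; exact: ex_derive.
    split.
    + by move=> t _; exact: ex_derive.
    + by apply: cvg_at_right_filter; exact: cF.
    + by apply: cvg_at_left_filter; exact: cF.
  - by move=> t _; rewrite derive1E derive_val.
have concl (h : T -> R) (f : R -> R) : bmf h -> (forall x, `|h x| <= 1) ->
    (forall t, h (expi t) = f t) ->
    (\int[lebesgue_measure]_(t in `[0%R, (2 * pi)%R]) (1 + f t)%:E)%E = (2 * pi)%:E ->
    \int[m]_x h x = 0.
  move=> bh h1 hf If.
  (* [RI_circle_lebesgue] transfers nonnegative functions only, so 1 + h is integrated in place of
     h; this is the origin of the summand 1 in [key]. *)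
  have b1h : bmf (fun x => 1 + h x) by apply: bmfD => //; exact: bmf_cst.
  have := RI_circle_lebesgue b1h; under eq_integral do rewrite hf.
  rewrite If -EFinM mulVf ?lt0r_neq0// => H.
  have : \int[m]_x (1 + h x) = 1.
    apply: EFin_inj; apply: H => x; move: (h1 x); rewrite ler_norml => /andP[].
    by rewrite -subr_ge0 opprK addrC.
  rewrite RID ?RI_cst; [|exact: intg_cst|exact: intg_bmf].
  by move=> /eqP; rewrite -subr_eq0 addrAC subrr add0r => /eqP.
apply: complex_eq; rewrite /cintegral /=.
- apply: (concl _ (fun t => cos (t *+ n.+1))) => //.
  + by move=> x; rewrite -(bnd x) normRe_le.
  + by move=> t; rewrite cval_expiX.
  apply: (key _ (fun t => t + n.+1%:R^-1 * sin (t *+ n.+1))).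
  + move=> t.
    have d1 : is_derive t 1 (fun s : R => sin (s *+ n.+1)) (cos (t *+ n.+1) * n.+1%:R).
      have -> : (fun s : R => sin (s *+ n.+1)) = sin \o (fun s : R => s *+ n.+1) by [].
      exact: (@is_derive1_comp _ _ _ _ _ _ _ (dln t)).
    have -> : (fun t0 : R => t0 + n.+1%:R^-1 * sin (t0 *+ n.+1)) =
       (@id R) + n.+1%:R^-1 \*: (fun s : R => sin (s *+ n.+1)) by [].
    by apply: is_derive_eq; rewrite /GRing.scale/= mulrC mulfK.
  + by move=> t; apply: continuous_comp; [exact: ctsn|exact: continuous_cos].
  + by rewrite sin_int_2pi mul0rn sin0 !mulr0 !addr0 subr0.
- apply: (concl _ (fun t => sin (t *+ n.+1))) => //.
  + by move=> x; rewrite -(bnd x) normIm_le.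
  + by move=> t; rewrite cval_expiX.
  apply: (key _ (fun t => t - n.+1%:R^-1 * cos (t *+ n.+1))).
  + move=> t.
    have d1 : is_derive t 1 (fun s : R => cos (s *+ n.+1)) (- sin (t *+ n.+1) * n.+1%:R).
      have -> : (fun s : R => cos (s *+ n.+1)) = cos \o (fun s : R => s *+ n.+1) by [].
      exact: (@is_derive1_comp _ _ _ _ _ _ _ (dln t)).
    have -> : (fun t0 : R => t0 - n.+1%:R^-1 * cos (t0 *+ n.+1)) =
       (@id R) - n.+1%:R^-1 \*: (fun s : R => cos (s *+ n.+1)) by [].
    by apply: is_derive_eq; rewrite /GRing.scale/= mulrC mulfK// opprK.
  + by move=> t; apply: continuous_comp; [exact: ctsn|exact: continuous_sin].
  + by rewrite cos_int_2pi mul0rn cos0 mulr1 sub0r opprK subrK.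
Qed.
End circle_lebesgue_integrals.

Section poisson_cauchy.
Variable R : realType.
Local Notation "z ^*" := (conjc z) : ring_scope.
Local Notation T := (circle R).
Local Notation m := (@circle_lebesgue R).
Local Notation CI := (cintegral m).
Implicit Types (z : R[i]) (p q F : {poly R[i]}) (xi : T).
Local Notation Re := (@complex.Re R).

Lemma CI_polyX F : CI (fun x => cval x * F.[cval x]) = 0.
Proof.
rewrite (@eq_CI _ _ _ (fun x => \sum_(i < size F) F`_i * cval x ^+ i.+1)).
  rewrite CI_sum => [|i].
    by apply: big1 => i _; rewrite CIZ ?CI_expr ?mulr0//; exact: bmcX (@bmc_cval R).
  by apply: bmcM; [exact: bmc_cst | exact: bmcX (@bmc_cval R)].
move=> x; rewrite horner_coef mulr_sumr; apply: eq_bigr => i _.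
by rewrite exprS mulrCA.
Qed.

Lemma horner_sub_root F z : exists H : {poly R[i]},
  forall x, F.[x] = F.[z] + (x - z) * H.[x].
Proof.
have /factor_theorem[H FH] : root (F - F.[z]%:P) z.
  by rewrite /root hornerD hornerN hornerC subrr.
exists H => x; move/(congr1 (fun q => q.[x])): FH.
rewrite hornerD hornerN hornerC hornerM hornerXsubC => /(canRL (subrK _)) ->.
by rewrite addrC mulrC.
Qed.

Lemma CI_poly F : CI (fun x => F.[cval x]) = F.[0].
Proof.
have [H FH] := horner_sub_root F 0.
under eq_CI do rewrite FH subr0.
rewrite CID ?CI_cst ?CI_polyX ?addr0//; first exact: bmc_cst.
by apply: bmcM; [exact: bmc_cval | exact: bmc_poly].
Qed.

Definition cauchy_kernel z xi := (1 - z * (cval xi)^*)^-1.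

Lemma cauchy_den_ge z xi : 1 - normc z <= normc (1 - z * (cval xi)^*).
Proof.
apply: le_trans (normcB_ge _ _).
by rewrite normcM normcJr normc_cval mulr1 normc1.
Qed.

Lemma cauchy_den_neq0 z xi : normc z < 1 -> 1 - z * (cval xi)^* != 0.
Proof.
move=> z1; rewrite -normc_gt0; apply: lt_le_trans (cauchy_den_ge _ _).
by rewrite subr_gt0.
Qed.

Lemma bmc_cauchy z : normc z < 1 -> bmc (cauchy_kernel z).
Proof.
move=> z1; apply: (@bmc_inv _ _ (1 - normc z)).
- by rewrite subr_gt0.
- exact: cauchy_den_ge.
- apply: bmcB; first exact: bmc_cst.
  by apply: bmcM; [exact: bmc_cst | apply: bmcJ; exact: bmc_cval].
Qed.

Lemma geometric_small_eq0 (a r C : R) : 0 <= r -> r < 1 ->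
  (forall k, a <= r ^+ k * C) -> a <= 0.
Proof.
move=> r0 r1 H.
have h : (fun k => r ^+ k * C) @ \oo --> 0 * C.
  by apply: cvgM; [apply: cvg_expr; rewrite ger0_norm|exact: cvg_cst].
rewrite -(mul0r C) -(cvg_lim _ h)//; apply: limr_ge; first by apply/cvg_ex; exists (0 * C).
by near=> k; exact: H.
Unshelve. all: by end_near. Qed.

(** Since 1/(1 - y) = 1 + y/(1 - y) with y = conj(z) xi, the integrals satisfy I(j) = conj(z) I(j +
    1) + [j = 0]. They are bounded and |z| < 1, so iterating the recursion forces I(j + 1) = 0,
    without expanding the kernel in a series. *)
Lemma CI_cauchyJ_expr z : normc z < 1 -> forall j,
  CI (fun x => cval x ^+ j * (cauchy_kernel z x)^*) = (j == 0%N)%:R.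
Proof.
move=> z1.
have bC := bmcJ (bmc_cauchy z1).
have bX j : bmc (fun x : T => cval x ^+ j) by exact: bmcX (@bmc_cval R).
pose I j := CI (fun x => cval x ^+ j * (cauchy_kernel z x)^*).
have rec j : I j = z^* * I j.+1 + CI (fun x => cval x ^+ j).
  rewrite /I -CIZ; last exact: bmcM.
  rewrite -CID//; last by apply: bmcM; [exact: bmc_cst|exact: bmcM].
  apply: eq_CI => x.
  have d0 : 1 - z^* * cval x != 0.
    have := cauchy_den_neq0 x z1; rewrite -conjc_eq0.
    by rewrite conjcB conjc_one conjcM conjcK.
  rewrite /cauchy_kernel conjc_inv conjcB conjc_one conjcM conjcK exprS.
  by field.
have [C IC] : exists C, forall j, normc (I j) <= C.
  exists ((1 - normc z)^-1) => j.
  rewrite -[leRHS](RI_cst m); apply: CI_norm_dom; [exact: bmcM|exact: intg_cst|] => x.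
  rewrite normcM normcX normc_cval expr1n mul1r normcJr /cauchy_kernel normcV.
  rewrite lef_pV2 ?posrE ?subr_gt0 ?cauchy_den_ge//.
  by rewrite normc_gt0; exact: cauchy_den_neq0.
have Ipos j : I j.+1 = 0.
  apply/eqP; rewrite -normc_eq0 eq_le normc_ge0 andbT.
  apply: (@geometric_small_eq0 _ (normc z) C) => //; first exact: normc_ge0.
  suff H k : I j.+1 = z^* ^+ k * I (j.+1 + k)%N.
    by move=> k; rewrite (H k) normcM normcX normcJr ler_wpM2l ?exprn_ge0 ?normc_ge0.
  elim: k => [|k IH]; first by rewrite expr0 mul1r addn0.
  by rewrite IH addSn rec CI_expr addr0 mulrA exprSr addnS addSn.
case=> [|j]; last exact: Ipos.
rewrite -/(I 0%N) rec Ipos mulr0 add0r eqxx.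
by under eq_CI do rewrite expr0; rewrite CI_cst.
Qed.

Lemma CI_cauchyJ z F : normc z < 1 ->
  CI (fun x => F.[cval x] * (cauchy_kernel z x)^*) = F.[0].
Proof.
move=> z1; have bC := bmcJ (bmc_cauchy z1).
have bX j : bmc (fun x : T => cval x ^+ j) by exact: bmcX (@bmc_cval R).
rewrite (@eq_CI _ _ _ (fun x => \sum_(i < size F) F`_i * (cval x ^+ i * (cauchy_kernel z x)^*))).
  rewrite CI_sum; last by move=> i; apply: bmcM; [exact: bmc_cst|exact: bmcM].
  rewrite horner_coef; apply: eq_bigr => i _.
  by rewrite CIZ ?CI_cauchyJ_expr ?expr0n//; exact: bmcM.
by move=> x; rewrite horner_coef mulr_suml; apply: eq_bigr => i _; rewrite mulrA.
Qed.

Lemma CI_cauchy_anti z F : normc z < 1 ->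
  CI (fun x => (cval x * F.[cval x])^* * cauchy_kernel z x) = 0.
Proof.
move=> z1; have bC := bmc_cauchy z1.
rewrite (@eq_CI _ _ _ (fun x => ((F * 'X).[cval x] * (cauchy_kernel z x)^*)^*)).
  rewrite CIJ; last by apply: bmcM; [exact: bmc_poly|exact: bmcJ].
  by rewrite CI_cauchyJ// hornerMX mulr0 conjc0.
by move=> x; rewrite hornerMX [RHS]conjcM conjcK [F.[_] * _]mulrC.
Qed.

Lemma CI_cauchy z F : normc z < 1 ->
  CI (fun x => F.[cval x] * cauchy_kernel z x) = F.[z].
Proof.
move=> z1; have bC := bmc_cauchy z1.
(* Once F(z) is split off, the factor xi - z cancels the denominator: (xi - z)/(1 - z conj(xi)) = xi
   on the circle, and xi H(xi) has mean 0. *)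
have [H FH] := horner_sub_root F z.
rewrite (@eq_CI _ _ _ (fun x => F.[z] * cauchy_kernel z x + cval x * H.[cval x])).
  rewrite CID; first last.
  - by apply: bmcM; [exact: bmc_cval|exact: bmc_poly].
  - by apply: bmcM => //; exact: bmc_cst.
  rewrite CI_polyX addr0 CIZ//.
  have -> : CI (cauchy_kernel z) = 1; last by rewrite mulr1.
  rewrite -[LHS]conjcK -CIJ// (@eq_CI _ _ _ (fun x => (1 : {poly R[i]}).[cval x] * (cauchy_kernel z x)^*)).
    by rewrite CI_cauchyJ// hornerE conjc_one.
  by move=> x; rewrite hornerE mul1r.
move=> x; rewrite FH mulrDl; congr (_ + _).
have d0 := cauchy_den_neq0 x z1.
rewrite mulrAC; congr (_ * _).
apply: (mulIf d0); rewrite /cauchy_kernel mulfVK// mulrBr mulr1.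
by rewrite mulrCA cvalJ mulr1.
Qed.

Lemma poissonE z xi : poisson z xi = (1 - normc z ^+ 2) * normc (cauchy_kernel z xi) ^+ 2.
Proof.
rewrite /poisson /cauchy_kernel normcV exprVn; congr (_ * (_ ^+ 2)^-1).
by rewrite mulrC.
Qed.

Lemma poisson_cauchy z xi : normc z < 1 ->
  (poisson z xi)%:C = cauchy_kernel z xi + (cauchy_kernel z xi)^* - 1.
Proof.
move=> z1; have d0 := cauchy_den_neq0 xi z1.
have d0' : 1 - z^* * cval xi != 0.
  by have := d0; rewrite -conjc_eq0 conjcB conjc_one conjcM conjcK.
rewrite poissonE rmorphM rmorphB rmorph1 /= -!mulcJ /cauchy_kernel.
rewrite conjc_inv conjcB conjc_one conjcM conjcK.
apply: (mulIf d0); apply: (mulIf d0').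
have -> : (1 - z * z^*) * ((1 - z * (cval xi)^*)^-1 / (1 - z^* * cval xi)) *
   (1 - z * (cval xi)^*) * (1 - z^* * cval xi) = 1 - z * z^* by field; rewrite d0 d0'.
have -> : ((1 - z * (cval xi)^*)^-1 + (1 - z^* * cval xi)^-1 - 1) *
   (1 - z * (cval xi)^*) * (1 - z^* * cval xi) =
   1 - z * z^* * (cval xi * (cval xi)^*) by field; rewrite d0 d0'.
by rewrite cvalJ mulr1.
Qed.

Lemma bmf_poisson z : normc z < 1 -> bmf (@poisson R z).
Proof.
move=> z1; rewrite (funext (poissonE z)).
by apply: bmfZ; apply: bmfX; apply: bmf_normc; exact: bmc_cauchy.
Qed.

Lemma normc_sq_lt1 z : normc z < 1 -> 0 < 1 - normc z ^+ 2.
Proof. by move=> z1; rewrite subr_gt0 expr_lt1 ?normc_ge0. Qed.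

Lemma poisson_gt0 z xi : normc z < 1 -> 0 < poisson z xi.
Proof.
move=> z1; rewrite poissonE mulr_gt0 ?normc_sq_lt1// exprn_gt0// normc_gt0.
by rewrite invr_eq0 cauchy_den_neq0.
Qed.

Lemma CI_poisson z F : normc z < 1 ->
  CI (fun x => F.[cval x] * (poisson z x)%:C) = F.[z].
Proof.
move=> z1; have bC := bmc_cauchy z1; have bF := bmc_poly F.
rewrite (@eq_CI _ _ _ (fun x => F.[cval x] * cauchy_kernel z x +
   F.[cval x] * (cauchy_kernel z x)^* - F.[cval x])).
  rewrite CIB//; last by apply: bmcD; apply: bmcM => //; exact: bmcJ.
  rewrite CID; [|exact: bmcM|by apply: bmcM => //; exact: bmcJ].
  by rewrite CI_cauchy// CI_cauchyJ// CI_poly addrK.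
by move=> x; rewrite poisson_cauchy// !mulrDr mulrN1.
Qed.

Lemma RI_poisson_Re z F : normc z < 1 ->
  \int[m]_x (Re F.[cval x] * poisson z x) = Re F.[z].
Proof.
move=> z1; rewrite -(CI_poisson F z1) Re_CI; apply: eq_RI => x.
by rewrite mulrC -RecZ mulrC.
Qed.

Lemma RI_poisson z : normc z < 1 -> \int[m]_x poisson z x = 1.
Proof.
move=> z1; rewrite (@eq_RI _ _ _ _ _ (fun x => Re (1 : {poly R[i]}).[cval x] * poisson z x)).
  by rewrite RI_poisson_Re// hornerE.
move=> x; have -> : Re (1 : {poly R[i]}).[cval x] = 1 by rewrite hornerE.
by rewrite mul1r.
Qed.

Lemma CI_polyJ p j : CI (fun x => p.[cval x] * (cval x ^+ j)^*) = p`_j.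
Proof.
have bX k : bmc (fun x : T => cval x ^+ k) by exact: bmcX (@bmc_cval R).
have H (i k : nat) : CI (fun x => cval x ^+ i * (cval x ^+ k)^*) = (i == k)%:R.
  have [ki|ik] := leqP k i.
    rewrite (@eq_CI _ _ _ (fun x => cval x ^+ (i - k))).
      case: (eqVneq i k) => [->|neq].
        by under eq_CI do rewrite subnn expr0; rewrite CI_cst.
      have : (0 < i - k)%N by rewrite subn_gt0 ltn_neqAle eq_sym neq ki.
      by case: (i - k)%N => // l _; rewrite CI_expr.
    move=> x; rewrite -{1}(subnK ki) exprD -mulrA conjcX -exprMn cvalJ expr1n mulr1//.
  rewrite (@eq_CI _ _ _ (fun x => (cval x ^+ (k - i))^*)).
    rewrite CIJ// (ltn_eqF ik).
    have : (0 < k - i)%N by rewrite subn_gt0.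
    by case: (k - i)%N => // l _; rewrite CI_expr conjc0.
  move=> x; rewrite -{1}(subnK (ltnW ik)) exprD conjcM mulrCA.
  by rewrite [(cval x ^+ i)^*]conjcX -exprMn cvalJ expr1n mulr1.
rewrite (@eq_CI _ _ _ (fun x => \sum_(i < size p) p`_i * (cval x ^+ i * (cval x ^+ j)^*))).
  rewrite CI_sum; last by move=> i; apply: bmcM; [exact: bmc_cst|apply: bmcM => //; exact: bmcJ].
  rewrite (eq_bigr (fun i : 'I_(size p) => p`_i * ((i : nat) == j)%:R)); last first.
    by move=> i _; rewrite CIZ ?H//; apply: bmcM => //; exact: bmcJ.
  have [jp|pj] := ltnP j (size p).
    rewrite (bigD1 (Ordinal jp))//= eqxx mulr1 big1 ?addr0// => i ij.
    by rewrite (_ : (i : nat) == j = false) ?mulr0//; apply/negbTE.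
  rewrite nth_default// big1// => i _; rewrite (_ : (i : nat) == j = false) ?mulr0//.
  by rewrite ltn_eqF// (leq_trans (ltn_ord i)).
by move=> x; rewrite horner_coef mulr_suml; apply: eq_bigr => i _; rewrite mulrA.
Qed.
End poisson_cauchy.

(** * Fejer means *)

Section fejer.
Variable R : realType.
Local Notation "z ^*" := (conjc z) : ring_scope.
Local Notation T := (circle R).
Local Notation m := (@circle_lebesgue R).
Local Notation CI := (cintegral m).
Implicit Types (z u : R[i]) (p q F : {poly R[i]}) (xi eta : T).
Local Notation Re := (@complex.Re R).

Definition geom N : {poly R[i]} := \sum_(j < N) 'X^j.
(** This is 1 + 2 (x + ... + x^l): an analytic polynomial whose real part on the unit circle is the
    Dirichlet kernel. Likewise only the real part of [fejer] is the Fejer kernel; analyticity allows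
    its evaluation inside the disc. *)
Definition dirichlet l : {poly R[i]} := 2%:R *: geom l.+1 - 1.
Definition fejer N : {poly R[i]} := (N%:R)^-1 *: \sum_(l < N) dirichlet l.

Lemma horner_geom N u : (geom N).[u] = \sum_(j < N) u ^+ j.
Proof. by rewrite /geom horner_sum; apply: eq_bigr => j _; rewrite hornerXn. Qed.
Lemma horner_dirichlet l u : (dirichlet l).[u] = 2%:R * (geom l.+1).[u] - 1.
Proof. by rewrite /dirichlet !hornerE. Qed.
Lemma horner_fejer N u : (fejer N).[u] = (N%:R)^-1 * \sum_(l < N) (dirichlet l).[u].
Proof. by rewrite /fejer hornerZ horner_sum. Qed.

Lemma natVC n : ((n%:R : R[i])^-1) = ((n%:R : R)^-1)%:C.
Proof. by rewrite natC fmorphV. Qed.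

Lemma Re_sum (I : Type) (s : seq I) (h : I -> R[i]) :
  Re (\sum_(i <- s) h i) = \sum_(i <- s) Re (h i).
Proof. by elim/big_rec2: _ => // i x y _ <-; rewrite RecD. Qed.

(** Going from N to N + 1 adds 1 + 2 Re (conj(geom N) u^N) to the square, and conj(u^j) u^N = u^(N -
    j) turns this into the next Dirichlet kernel. It is the source of the positivity of the Fejer
    kernel. *)
Lemma sum_dirichlet N u : normc u = 1 ->
  \sum_(l < N) Re (dirichlet l).[u] = normc (geom N).[u] ^+ 2.
Proof.
move=> u1; have uu : u * u^* = 1 by rewrite mulcJ u1 expr1n.
elim: N => [|N IH].
  by rewrite big_ord0 horner_geom big_ord0 normc_zero expr0n.
have geomS : (geom N.+1).[u] = (geom N).[u] + u ^+ N.
  by rewrite !horner_geom big_ord_recr.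
rewrite big_ord_recr /= IH geomS.
have -> : normc ((geom N).[u] + u ^+ N) ^+ 2 =
    normc (geom N).[u] ^+ 2 + 1 + 2 * Re ((geom N).[u]^* * u ^+ N).
  rewrite -{1}[u ^+ N]opprK normc_sqB normcNr normcX u1 expr1n.
  by rewrite mulrN RecN mulrN opprK expr1n.
rewrite -addrA; congr (_ + _).
have -> : (geom N).[u]^* * u ^+ N = \sum_(j < N) u ^+ j.+1.
  rewrite horner_geom conjc_sum mulr_suml (reindex_inj rev_ord_inj) /=.
  apply: eq_bigr => j _; rewrite conjcX.
  have -> : (u ^+ N) = u ^+ (N - j.+1) * u ^+ j.+1.
    by rewrite -exprD subnK ?ltn_ord.
  by rewrite mulrA -exprMn [_ * u]mulrC uu expr1n mul1r.
rewrite horner_dirichlet geomS horner_geom.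
case: N {IH geomS} => [|N].
  by rewrite !big_ord0 add0r expr0 mulr1 RecD RecN Rec_nat Rec1 Rec0; ring.
have -> : \sum_(j < N.+1) u ^+ j = 1 + \sum_(i < N) u ^+ i.+1.
  by rewrite big_ord_recl expr0.
rewrite big_ord_recr /=.
set S := \sum_(i < N) _.
rewrite natC !RecD RecN RecZ !RecD.
by rewrite Rec1; ring.
Qed.

Lemma fejer_ge0 N u : normc u = 1 -> 0 <= Re (fejer N).[u].
Proof.
move=> u1; rewrite horner_fejer natVC RecZ Re_sum sum_dirichlet//.
by rewrite mulr_ge0 ?invr_ge0 ?ler0n ?sqr_ge0.
Qed.

Lemma fejer0 N : (fejer N.+1).[0] = 1.
Proof.
rewrite horner_fejer (eq_bigr (fun=> 1)).
  by rewrite sumr_const card_ord mulVf// pnatr_eq0.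
move=> l _; rewrite horner_dirichlet horner_geom big_ord_recl expr0 big1.
  by rewrite addr0; ring.
by move=> i _; rewrite expr0n.
Qed.

Lemma geom_sum_le (r : R) N : 0 <= r -> r < 1 -> \sum_(j < N) r ^+ j <= (1 - r)^-1.
Proof.
move=> r0 r1; have r1' : 0 < 1 - r by rewrite subr_gt0.
rewrite -[leRHS]mul1r ler_pdivlMr//.
have -> : (\sum_(j < N) r ^+ j) * (1 - r) = 1 - r ^+ N.
  elim: N => [|N IH]; first by rewrite big_ord0 mul0r expr0 subrr.
  by rewrite big_ord_recr /= mulrDl IH exprS; ring.
by rewrite gerBl exprn_ge0.
Qed.

(** With C = 1/(1 - u), each Dirichlet polynomial is 2C - 1 - 2 u^(l+1) C, and Re (2C - 1) is the
    Poisson kernel. Averaging over l turns the geometric remainders into O(1/N), uniformly in xi. *)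
Lemma fejer_poisson N z xi : normc z < 1 ->
  `|Re (fejer N.+1).[z * (cval xi)^*] - poisson z xi| <=
  (2 / (1 - normc z) ^+ 2) / N.+1%:R.
Proof.
move=> z1; set u := z * (cval xi)^*.
have r1 : 0 < 1 - normc z by rewrite subr_gt0.
have nu : normc u = normc z by rewrite normcM normcJr normc_cval mulr1.
have d0 := cauchy_den_neq0 xi z1.
set C := cauchy_kernel z xi.
have dl l : (dirichlet l).[u] = 2%:R * C - 1 - 2%:R * (u ^+ l.+1 * C).
  have -> : (dirichlet l).[u] = 2%:R * ((1 - u ^+ l.+1) * C) - 1; last by ring.
  rewrite horner_dirichlet horner_geom; congr (_ * _ - _).
  have h : (\sum_(j < l.+1) u ^+ j) * (1 - u) = 1 - u ^+ l.+1.
    elim: l.+1 => [|k IH]; first by rewrite big_ord0 mul0r expr0 subrr.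
    by rewrite big_ord_recr /= mulrDl IH exprS; ring.
  by apply: (mulIf d0); rewrite /C /cauchy_kernel -mulrA mulVf// mulr1 -h.
have N0 : N.+1%:R != 0 :> R[i] by rewrite pnatr_eq0.
have fE : (fejer N.+1).[u] = 2%:R * C - 1 -
    N.+1%:R^-1 * (2%:R * C * \sum_(l < N.+1) u ^+ l.+1).
  rewrite horner_fejer.
  under eq_bigr do rewrite dl.
  rewrite sumrB sumr_const card_ord.
  have -> : \sum_(i < N.+1) 2 * (u ^+ i.+1 * C) = 2 * C * \sum_(i < N.+1) u ^+ i.+1.
    by rewrite mulr_sumr; apply: eq_bigr => l _; ring.
  rewrite -[_ *+ N.+1]mulr_natr; move: N0; set k := N.+1%:R => k0.
  by field.
have pE : poisson z xi = Re (2%:R * C - 1).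
  rewrite -[LHS]/(Re (poisson z xi)%:C) poisson_cauchy// -/C.
  by rewrite natC !RecD RecZ RecJ; ring.
rewrite fE pE -RecN -RecD addrAC subrr add0r.
apply: le_trans (normRe_le _) _.
rewrite normcNr normcM natVC normc_real ger0_norm ?invr_ge0// mulrC ler_wpM2r ?invr_ge0//.
rewrite !normcM normc_nat -!mulrA ler_wpM2l// expr2 invfM.
have nC : normc C <= (1 - normc z)^-1.
  by rewrite /C normcV lef_pV2 ?posrE ?cauchy_den_ge// normc_gt0.
apply: ler_pM => //; try exact: normc_ge0.
apply: le_trans (geom_sum_le N.+1 (normc_ge0 z) z1).
apply: le_trans (normc_sum _ _ _) _; apply: ler_sum => l _.
rewrite normcX nu exprS ler_piMl ?exprn_ge0 ?normc_ge0//; exact: ltW.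
Qed.

Lemma RI_fejer N (x : T) : \int[m]_xi Re (fejer N.+1).[cval xi * (cval x)^*] = 1.
Proof.
have := CI_poly (fejer N.+1 \Po ((cval x)^* *: 'X)).
rewrite horner_comp [(_ *: 'X).[_]]hornerZ hornerX mulr0 fejer0 => /(congr1 Re) /= H.
rewrite -[RHS]H; apply: eq_RI => xi.
by rewrite horner_comp [(_ *: 'X).[_]]hornerZ hornerX mulrC.
Qed.

Lemma coef_fejer1 N : (fejer N.+1)`_1 = (2%:R * N%:R) / N.+1%:R.
Proof.
rewrite /fejer coefZ coef_sum mulrC; congr (_ / _).
rewrite big_ord_recl.
rewrite (eq_bigr (fun=> 2%:R)).
  rewrite sumr_const card_ord /dirichlet coefB coefZ coef1 /geom coef_sum.
  by rewrite big_ord_recl big_ord0 coefXn /= addr0 mulr0 subr0 add0r mulr_natr.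
move=> l _; rewrite /dirichlet coefB coefZ coef1 /geom coef_sum.
rewrite !big_ord_recl !coefXn /= /bump /= big1; last first.
  by move=> i _; rewrite coefXn.
by rewrite add0r addr0 mulr1 subr0.
Qed.

Lemma fejerJ N u : (fejer N).[u^*] = ((fejer N).[u])^*.
Proof.
rewrite !horner_fejer conjcM natVC conjc_real; congr (_ * _).
rewrite conjc_sum; apply: eq_bigr => l _.
rewrite !horner_dirichlet conjcB conjcM conjc_one natC conjc_real !horner_geom.
rewrite conjc_sum; congr (_ * _ - _).
by apply: eq_bigr => j _; rewrite conjcX.
Qed.

(** As |xi - x|^2 = 2 - 2 Re (xi conj(x)), only the first Fourier coefficient N/(N + 1) of the Fejer
    kernel enters. This is the variance that drives [fejer_mean_le]. *)
Lemma RI_fejer_dist N (x : T) :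
  \int[m]_xi (normc (cval xi - cval x) ^+ 2 * Re (fejer N.+1).[cval xi * (cval x)^*])
  = 2 / N.+1%:R.
Proof.
pose F := fejer N.+1 \Po ((cval x)^* *: 'X).
have FE xi : F.[cval xi] = (fejer N.+1).[cval xi * (cval x)^*].
  by rewrite horner_comp [(_ *: 'X).[_]]hornerZ hornerX mulrC.
have bF := bmc_poly F.
have bX := bmcJ (@bmc_cval R).
have F1 : F`_1 = (fejer N.+1)`_1 * (cval x)^*.
  rewrite /F comp_polyE coef_sum.
  rewrite (eq_bigr (fun i : 'I_(size (fejer N.+1)) => (fejer N.+1)`_i * ((cval x)^* ^+ i * (i == 1%N :> nat)%:R))); last first.
    by move=> i _; rewrite coefZ exprZn [(_ *: 'X^_)`_1]coefZ coefXn eq_sym.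
  have [s1|s1] := ltnP 1 (size (fejer N.+1)).
    rewrite (bigD1 (Ordinal s1))//= big1 ?addr0 ?mulr1 ?expr1// => i i1.
    by rewrite (_ : (i : nat) == 1%N = false) ?mulr0//; apply/negbTE.
  rewrite nth_default// mul0r big1// => i _.
  by rewrite (_ : (i : nat) == 1%N = false) ?mulr0// ltn_eqF// (leq_trans (ltn_ord i)).
have e1 : CI (fun xi => cval xi * F.[cval xi]) = 0 by exact: CI_polyX.
have e2 : CI (fun xi => F.[cval xi] * (cval xi)^*) = F`_1.
  by rewrite -(CI_polyJ F 1); apply: eq_CI => xi; rewrite expr1.
have e3 : CI (fun xi => F.[cval xi]) = 1.
  by rewrite CI_poly /F horner_comp [(_ *: 'X).[_]]hornerZ hornerX mulr0 fejer0.
rewrite (@eq_RI _ _ _ _ _ (fun xi => 2 * Re F.[cval xi] -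
   Re ((cval x)^* * (cval xi * F.[cval xi]) + cval x * (F.[cval xi] * (cval xi)^*)))).
  rewrite RIB; first last.
  - apply: intg_bmf; suff [] : bmc (fun xi => (cval x)^* * (cval xi * F.[cval xi]) + cval x * (F.[cval xi] * (cval xi)^*)) by [].
    by apply: bmcD; (apply: bmcM; first exact: bmc_cst); apply: bmcM => //; exact: bmc_cval.
  - by apply: intgZ; apply: intg_bmf; case: bF.
  rewrite RIZ; last by apply: intg_bmf; case: bF.
  rewrite -Re_CI e3 -Re_CI CID; first last.
  - by apply: bmcM; [exact: bmc_cst|exact: bmcM].
  - by apply: bmcM; [exact: bmc_cst|apply: bmcM => //; exact: bmc_cval].
  rewrite CIZ; last by apply: bmcM => //; exact: bmc_cval.
  rewrite e1 mulr0 add0r CIZ; last exact: bmcM.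
  rewrite e2 F1 mulrCA cvalJ mulr1 coef_fejer1 !natC -fmorphV -!rmorphM /=.
  rewrite natrM mulr1.
  have k0 : N%:R + 1 != 0 :> R by rewrite natr1 pnatr_eq0.
  by rewrite -natr1; field.
move=> xi; rewrite -FE normc_sqB !normc_cval !expr1n !RecD.
case: (cval x) (cval xi) F.[cval xi] => [a b] [c d] [e f] /=; ring.
Qed.
End fejer.

(** * Fejer means of integrable functions, of measures and of Lipschitz functions *)

Section fejer_means.
Variable R : realType.
Local Notation "z ^*" := (conjc z) : ring_scope.
Local Notation T := (circle R).
Local Notation m := (@circle_lebesgue R).
Implicit Types (z u : R[i]) (p q F : {poly R[i]}) (xi eta : T).
Local Notation Re := (@complex.Re R).
Local Notation Im := (@complex.Im R).

(** A Fourier coefficient of [g], taken by components because [g] will be a logarithm of the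
    density, integrable but outside the class [bmc]. *)
Definition moment (g : T -> R) j : R[i] :=
  (\int[m]_x (Re ((cval x)^* ^+ j) * g x)) +i* (\int[m]_x (Im ((cval x)^* ^+ j) * g x)).

Lemma bmc_expJ j : bmc (fun x : T => (cval x)^* ^+ j).
Proof. by apply: bmcX; apply: bmcJ; exact: bmc_cval. Qed.

Lemma Re_moment_poly (g : T -> R) F x : intg m g ->
  Re (\poly_(j < size F) (F`_j * moment g j)).[x] =
  \int[m]_eta (Re F.[x * (cval eta)^*] * g eta).
Proof.
move=> ig; rewrite horner_poly Re_sum.
pose h (j : 'I_(size F)) (eta : T) :=
  Re (F`_j * x ^+ j) * (Re ((cval eta)^* ^+ j) * g eta) -
  Im (F`_j * x ^+ j) * (Im ((cval eta)^* ^+ j) * g eta).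
have ir j : intg m (fun eta => Re ((cval eta)^* ^+ j) * g eta).
  by apply: intgM => //; case: (bmc_expJ j).
have ii j : intg m (fun eta => Im ((cval eta)^* ^+ j) * g eta).
  by apply: intgM => //; case: (bmc_expJ j).
have ih j : intg m (h j) by apply: intgB; apply: intgZ.
rewrite (@eq_RI _ _ _ _ _ (fun eta => \sum_(j < size F) h j eta)).
  rewrite (RI_sum _ ih).2; apply: eq_bigr => j _.
  rewrite RIB; try exact: intgZ.
  by rewrite !RIZ// mulrAC RecM.
move=> eta; rewrite horner_coef Re_sum mulr_suml; apply: eq_bigr => j _.
by rewrite exprMn mulrA RecM mulrBl /h !mulrA.
Qed.

(** Re F(xi conj(eta)) is a finite sum of products of a function of xi and a function of eta, so the
    exchange of integrals is mere linearity. *)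
Lemma RI_swap (mu : probability T R) (f : T -> R) F : bmf f ->
  bmf (fun xi => \int[mu]_eta Re F.[cval xi * (cval eta)^*]) /\
  bmf (fun eta => \int[m]_xi (f xi * Re F.[cval xi * (cval eta)^*])) /\
  \int[m]_xi (f xi * \int[mu]_eta Re F.[cval xi * (cval eta)^*]) =
  \int[mu]_eta \int[m]_xi (f xi * Re F.[cval xi * (cval eta)^*]).
Proof.
move=> bf.
pose a (j : 'I_(size F)) (xi : T) := F`_j * cval xi ^+ j.
pose b (j : 'I_(size F)) (eta : T) := (cval eta)^* ^+ j.
have ba j : bmc (a j) by apply: bmcM; [exact: bmc_cst|exact: bmcX (@bmc_cval R)].
have bb j : bmc (b j) by exact: bmc_expJ.
have FE xi eta : Re F.[cval xi * (cval eta)^*] =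
    \sum_(j < size F) (Re (a j xi) * Re (b j eta) - Im (a j xi) * Im (b j eta)).
  rewrite horner_coef Re_sum; apply: eq_bigr => j _.
  by rewrite exprMn mulrA RecM.
have ib j : bmf (fun eta => Re (b j eta)) by case: (bb j).
have ib' j : bmf (fun eta => Im (b j eta)) by case: (bb j).
have ia j : bmf (fun eta => Re (a j eta)) by case: (ba j).
have ia' j : bmf (fun eta => Im (a j eta)) by case: (ba j).
have E1 xi : \int[mu]_eta Re F.[cval xi * (cval eta)^*] =
    \sum_(j < size F) (Re (a j xi) * \int[mu]_x Re (b j x) - Im (a j xi) * \int[mu]_x Im (b j x)).
  under eq_RI do rewrite FE.
  rewrite (RI_sum _ _).2; last first.
    by move=> j; apply: intgB; apply: intgZ; exact: intg_bmf.
  apply: eq_bigr => j _; rewrite RIB ?RIZ//; try exact: intg_bmf.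
    by apply: intgZ; exact: intg_bmf.
  by apply: intgZ; exact: intg_bmf.
have bfa j : bmf (fun xi => f xi * Re (a j xi)) by exact: bmfM.
have bfa' j : bmf (fun xi => f xi * Im (a j xi)) by exact: bmfM.
have E2 eta : \int[m]_xi (f xi * Re F.[cval xi * (cval eta)^*]) =
    \sum_(j < size F) (Re (b j eta) * \int[m]_xi (f xi * Re (a j xi)) -
       Im (b j eta) * \int[m]_xi (f xi * Im (a j xi))).
  rewrite (@eq_RI _ _ _ _ _ (fun xi => \sum_(j < size F)
    (Re (b j eta) * (f xi * Re (a j xi)) - Im (b j eta) * (f xi * Im (a j xi))))); last first.
    by move=> xi; rewrite FE mulr_sumr; apply: eq_bigr => j _; ring.
  rewrite (RI_sum _ _).2; last first.
    by move=> j; apply: intgB; apply: intgZ; exact: intg_bmf.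
  apply: eq_bigr => j _; rewrite RIB ?RIZ//; try exact: intg_bmf.
    by apply: intgZ; exact: intg_bmf.
  by apply: intgZ; exact: intg_bmf.
split; last split.
- rewrite (funext E1); apply: bmf_sum => j.
  by apply: bmfB; apply: bmfM => //; exact: bmf_cst.
- rewrite (funext E2); apply: bmf_sum => j.
  by apply: bmfB; apply: bmfM => //; exact: bmf_cst.
under [LHS]eq_RI do rewrite E1.
under [RHS]eq_RI do rewrite E2.
rewrite (@eq_RI _ _ _ _ _ (fun xi => \sum_(j < size F)
    ((\int[mu]_x Re (b j x)) * (f xi * Re (a j xi)) - (\int[mu]_x Im (b j x)) * (f xi * Im (a j xi))))); last first.
  by move=> xi; rewrite mulr_sumr; apply: eq_bigr => j _; ring.
rewrite (RI_sum _ _).2; last first.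
  by move=> j; apply: intgB; apply: intgZ; exact: intg_bmf.
rewrite (@eq_RI _ _ _ mu _ (fun eta => \sum_(j < size F)
    ((\int[m]_xi (f xi * Re (a j xi))) * Re (b j eta) - (\int[m]_xi (f xi * Im (a j xi))) * Im (b j eta)))); last first.
  by move=> eta; apply: eq_bigr => j _; ring.
rewrite (RI_sum _ _).2; last first.
  by move=> j; apply: intgB; apply: intgZ; exact: intg_bmf.
apply: eq_bigr => j _.
rewrite !RIB ?RIZ//; try (by apply: intg_bmf); try (by apply: intgZ; exact: intg_bmf).
ring.
Qed.

(* Integrate the tangent line of [exp] at the mean of [g]. *)
Lemma jensen_exp (phi g : T -> R) : bmf phi -> (forall x, 0 <= phi x) ->
  \int[m]_x phi x = 1 -> intg m g -> intg m (fun x => expR (g x)) ->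
  expR (\int[m]_x (phi x * g x)) <= \int[m]_x (phi x * expR (g x)).
Proof.
move=> bphi phi0 phi1 ig ie; set c := \int[m]_x (phi x * g x).
have i1 : intg m (fun x => phi x * g x) by exact: intgM.
have i2 : intg m phi by exact: intg_bmf.
have -> : expR c = \int[m]_x (expR c * ((1 - c) * phi x + phi x * g x)).
  rewrite RIZ; last by apply: intgD => //; exact: intgZ.
  rewrite RID//; last exact: intgZ.
  by rewrite RIZ// phi1 -/c; ring.
apply: RI_le => [||x].
- by apply: intgZ; apply: intgD => //; exact: intgZ.
- exact: intgM.
have -> : (1 - c) * phi x + phi x * g x = phi x * (1 + (g x - c)) by ring.
rewrite mulrCA ler_wpM2l//.
have -> : expR (g x) = expR c * expR (g x - c) by rewrite -expRD addrC subrK.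
by rewrite ler_wpM2l ?expR_ge0// expR_ge1Dx.
Qed.

Lemma bounded_poly p : exists2 C, 0 <= C & forall xi, normc p.[cval xi] <= C.
Proof.
have [_ [C HC]] := bmf_poly p; exists `|C| => // xi.
apply: le_trans (ler_norm _) (le_trans (HC xi) _); exact: ler_norm.
Qed.

Lemma lipschitz_poly p : exists2 L, 0 <= L &
  forall xi eta, normc (p.[cval xi] - p.[cval eta]) <= L * normc (cval xi - cval eta).
Proof.
elim/poly_ind: p => [|q c [L L0 IH]].
  by exists 0 => // xi eta; rewrite !horner0 subrr normc_zero mul0r.
have [C C0 HC] := bounded_poly q.
exists (L + C) => [|xi eta]; first exact: addr_ge0.
rewrite !hornerMXaddC.
have -> : q.[cval xi] * cval xi + c - (q.[cval eta] * cval eta + c) =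
  (q.[cval xi] - q.[cval eta]) * cval xi + q.[cval eta] * (cval xi - cval eta) by ring.
apply: le_trans (normcD_le _ _) _; rewrite !normcM normc_cval mulr1 mulrDl.
by apply: lerD => //; rewrite ler_wpM2r// normc_ge0.
Qed.

Lemma lipschitz_sqpoly p : exists2 L, 0 <= L &
  forall xi eta, normc p.[cval xi] ^+ 2 - normc p.[cval eta] ^+ 2 <=
    L * normc (cval xi - cval eta).
Proof.
have [C C0 HC] := bounded_poly p; have [L L0 HL] := lipschitz_poly p.
exists (2 * C * L) => [|xi eta]; first by rewrite !mulr_ge0.
rewrite subr_sqr mulrC.
apply: (@le_trans _ _ ((2 * C) * `|normc p.[cval xi] - normc p.[cval eta]|)).
  apply: le_trans (ler_norm _) _; rewrite normrM ler_wpM2r//.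
  rewrite ger0_norm ?addr_ge0 ?normc_ge0//.
  by apply: le_trans (lerD (HC _) (HC _)) _; lra.
rewrite -[leRHS]mulrA ler_wpM2l ?mulr_ge0//; apply: le_trans (HL _ _).
rewrite ler_norml normcB_ge lerNl opprB andbT normcBC; exact: normcB_ge.
Qed.

(** The inequality L t <= e/2 + L^2 t^2/(2e) replaces the Lipschitz defect by the second moment of
    the kernel, which [RI_fejer_dist] evaluates as 2/(N + 1). *)
Lemma fejer_mean_le (f : T -> R) L : bmf f -> 0 <= L ->
  (forall xi eta, f xi - f eta <= L * normc (cval xi - cval eta)) ->
  forall e, 0 < e -> forall N, L ^+ 2 / e ^+ 2 * 2 <= N.+1%:R ->
  forall eta, \int[m]_xi (f xi * Re (fejer R N.+1).[cval xi * (cval eta)^*]) <= f eta + e.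
Proof.
move=> bf L0 HL e e0 N HN eta.
pose k xi := Re (fejer R N.+1).[cval xi * (cval eta)^*].
have bk : bmf k.
  have := @bmc_horner R (fejer R N.+1) (fun xi => cval xi * (cval eta)^*).
  by case=> //; apply: bmcM; [exact: bmc_cval|exact: bmc_cst].
have k0 xi : 0 <= k xi.
  by apply: fejer_ge0; rewrite normcM normcJr !normc_cval mulr1.
have bd : bmf (fun xi : T => normc (cval xi - cval eta) ^+ 2).
  apply: bmfX; apply: bmf_normc; apply: bmcB; [exact: bmc_cval|exact: bmc_cst].
have i1 : intg m (fun xi => normc (cval xi - cval eta) ^+ 2 * k xi).
  by apply: intg_bmf; exact: bmfM.
have i2 : intg m k by exact: intg_bmf.
have : \int[m]_xi (f xi * k xi) <= \int[m]_xi ((f eta + e / 2) * k xi +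
   (L ^+ 2 / (2 * e)) * (normc (cval xi - cval eta) ^+ 2 * k xi)).
  apply: RI_le => [||xi].
  - by apply: intg_bmf; exact: bmfM.
  - by apply: intgD; exact: intgZ.
  rewrite mulrA -mulrDl ler_wpM2r// -lerBlDl; apply: le_trans.
    apply: (_ : _ <= L * normc (cval xi - cval eta) - e / 2).
    by have := HL xi eta; lra.
  set t := normc _; rewrite -subr_ge0.
  have -> : L ^+ 2 / (2 * e) * t ^+ 2 - (L * t - e / 2) = (L * t - e) ^+ 2 / (2 * e).
    by field; exact: lt0r_neq0.
  by rewrite divr_ge0 ?sqr_ge0 ?mulr_ge0// ltW.
rewrite RID; try exact: intgZ.
rewrite !RIZ// RI_fejer RI_fejer_dist mulr1 => /le_trans; apply.
rewrite -addrA lerD2l.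
have N0 : 0 < N.+1%:R :> R by rewrite ltr0n.
suff : L ^+ 2 / (2 * e) * (2 / N.+1%:R) <= e / 2 by move=> h; rewrite [leRHS](splitr e) lerD2l.
have -> : L ^+ 2 / (2 * e) * (2 / N.+1%:R) = (e / 2) * (L ^+ 2 / e ^+ 2 * 2) / N.+1%:R.
  by field; rewrite !lt0r_neq0.
by rewrite ler_pdivrMr// ler_wpM2l// divr_ge0// ltW.
Qed.
End fejer_means.

(** * Polynomial substitutes for outer functions *)

Section outer_polynomial.
Variable R : realType.
Local Notation "z ^*" := (conjc z) : ring_scope.
Local Notation T := (circle R).
Local Notation m := (@circle_lebesgue R).
Implicit Types (z u : R[i]) (p q F : {poly R[i]}) (xi eta : T).
Local Notation Re := (@complex.Re R).
Local Notation Im := (@complex.Im R).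

(** A converse of 1 + y <= exp y with quadratic loss: for t = y - 2 y^2, exp t <= 1/(1 - t) and (1 +
    y)(1 - t) = 1 + y^2 (1 + 2y) >= 1. *)
Lemma expR_le_oneDx (y : R) : - (1 / 2) <= y -> expR (y - 2 * y ^+ 2) <= 1 + y.
Proof.
move=> y2; set t := y - 2 * y ^+ 2.
have t1 : 0 < 1 - t.
  have -> : 1 - t = 2 * (y - 1 / 4) ^+ 2 + 7 / 8 by rewrite /t; field.
  by rewrite ltr_wpDl// mulr_ge0// sqr_ge0.
have h : 1 - t <= expR (- t) by have := expR_ge1Dx (- t).
have : expR t <= (1 - t)^-1.
  by rewrite -[leLHS]invrK -expRN lef_pV2 ?posrE ?expR_gt0.
move=> /le_trans; apply; rewrite -[leLHS]mul1r ler_pdivrMr//.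
have -> : (1 + y) * (1 - t) = 1 + y ^+ 2 * (1 + 2 * y) by rewrite /t; ring.
by rewrite lerDl mulr_ge0 ?sqr_ge0//; lra.
Qed.

(* A polynomial approximation of [exp (q / 2)]: with [Re q] a Fejer mean of [log w], it replaces an outer function. *)
Definition exp_poly (q : {poly R[i]}) k : {poly R[i]} :=
  (1 + ((2 * k.+1%:R)^-1)%:C *: q) ^+ k.+1.

Lemma horner_exp_poly q k z :
  (exp_poly q k).[z] = (1 + ((2 * k.+1%:R)^-1)%:C * q.[z]) ^+ k.+1.
Proof. by rewrite /exp_poly horner_exp hornerD hornerZ hornerC. Qed.

Lemma normc_exp_poly_le q k z :
  normc (exp_poly q k).[z] ^+ 2 <=
  expR (Re q.[z] + normc q.[z] ^+ 2 / (4 * k.+1%:R)).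
Proof.
set a := k.+1%:R; have a0 : 0 < a :> R by rewrite ltr0n.
rewrite horner_exp_poly normcX -exprM mulnC exprM -/a.
have -> : normc (1 + ((2 * a)^-1)%:C * q.[z]) ^+ 2 =
   1 + (Re q.[z] + normc q.[z] ^+ 2 / (4 * a)) / a.
  rewrite normc_sq RecD RecZ ImcD ImcZ Rec1 normc_sq /= add0r.
  by field; exact: lt0r_neq0.
set y := (_ + _) / a.
have -> : Re q.[z] + normc q.[z] ^+ 2 / (4 * a) = y *+ k.+1.
  by rewrite -[RHS]mulr_natr /y divfK// lt0r_neq0.
rewrite -[y *+ _]mulr_natl mulrC expRM_natr lerXn2r ?nnegrE ?expR_ge0 ?expR_ge1Dx//.
have -> : 1 + y = normc (1 + ((2 * a)^-1)%:C * q.[z]) ^+ 2; last exact: sqr_ge0.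
rewrite normc_sq RecD RecZ ImcD ImcZ Rec1 /y normc_sq /= add0r.
by field; exact: lt0r_neq0.
Qed.

Lemma exp_poly_real q k z (x : R) : q.[z] = x%:C -> - k.+1%:R <= x ->
  exists2 tau, (exp_poly q k).[z] = tau%:C & expR (x / 2 - x ^+ 2 / (2 * k.+1%:R)) <= tau.
Proof.
move=> qz xk; set a := k.+1%:R; have a0 : 0 < a :> R by rewrite ltr0n.
set y := (2 * a)^-1 * x.
have y2 : - (1 / 2) <= y.
  rewrite /y [leRHS]mulrC ler_pdivlMr ?mulr_gt0//.
  by have -> : - (1 / 2) * (2 * a) = - a by field.
exists ((1 + y) ^+ k.+1).
  by rewrite horner_exp_poly qz -rmorphM -/a -/y rmorphXn rmorphD rmorph1.
have -> : x / 2 - x ^+ 2 / (2 * a) = a * (y - 2 * y ^+ 2).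
  by rewrite /y; field; exact: lt0r_neq0.
rewrite mulrC expRM_natr lerXn2r ?nnegrE ?expR_ge0//; last exact: expR_le_oneDx.
by have := expR_ge0 (y - 2 * y ^+ 2); move/le_trans; apply; exact: expR_le_oneDx.
Qed.

(** Here [v] stands for log w. The measure enters through [domW], that is w dm <= mu, which holds
    because the singular part is nonnegative. *)
Variables (mu : probability T R) (v : T -> R).
Hypothesis iv : intg m v.
Hypothesis ie : intg m (fun x => expR (v x)).
Hypothesis domW : forall f, bmf f -> (forall x, 0 <= f x) ->
  \int[m]_x (f x * expR (v x)) <= \int[mu]_x f x.

Definition pmass z := \int[mu]_x poisson z x.
Definition plog z := \int[m]_x (poisson z x * v x).

Lemma pmass_gt0 z : normc z < 1 -> 0 < pmass z.
Proof.
move=> z1.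
have c0 : 0 < (1 - normc z ^+ 2) / 4 by rewrite divr_gt0// normc_sq_lt1.
apply: lt_le_trans c0 _; rewrite -[leLHS](RI_cst mu).
apply: RI_le => [||x]; [exact: intg_cst|by apply: intg_bmf; exact: bmf_poisson|].
rewrite /poisson ler_wpM2l ?(ltW (normc_sq_lt1 z1))//.
have d0 : 0 < normc (1 - z * (cval x)^*) by rewrite normc_gt0 cauchy_den_neq0.
have d2 : normc (1 - z * (cval x)^*) <= 2.
  apply: le_trans (normcB_le _ _) _; rewrite normc1 normcM normcJr normc_cval mulr1.
  by rewrite (_ : 2 = 1 + 1)// lerD2l ltW.
have -> : 1 - Num.conj (cval x) * z = 1 - z * (cval x)^* by rewrite mulrC.
rewrite lef_pV2 ?posrE ?exprn_gt0//.
have -> : 4 = 2 ^+ 2 :> R by ring.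
by rewrite lerXn2r// nnegrE ltW.
Qed.

Lemma natr_above (x : R) : exists N : nat, x <= N.+1%:R.
Proof.
exists (Num.truncn `|x|); apply: le_trans (ler_norm _) _.
by rewrite ltW// truncnS_gt.
Qed.

(** [F] imitates the outer function with |F|^2 = w / M on the circle, M the Poisson mass at z, made
    positive at z. There |F|^2 is almost at most the exponential of a Fejer mean of log (w / M),
    hence by Jensen a Fejer mean of w / M, hence by [domW] one of mu / M. Moving the Fejer kernel
    onto the test function costs only [e2]. *)
Lemma outer_polynomial z p e : normc z < 1 -> 0 < e ->
  exists F : {poly R[i]}, exists tau : R,
  [/\ F.[z] = tau%:C,
      expR ((plog z - ln (pmass z)) / 2 - e) <= tau,
      \int[m]_x (normc p.[cval x] ^+ 2 * normc F.[cval x] ^+ 2) <=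
        expR e * ((\int[mu]_x normc p.[cval x] ^+ 2) / pmass z + e) &
      \int[m]_x (poisson z x * normc F.[cval x] ^+ 2) <= expR e * (1 + e)].
Proof.
move=> z1 e0; have M0 := pmass_gt0 z1; set M := pmass z in M0 *.
have [L L0 HL] := lipschitz_sqpoly p.
pose g x := v x - ln M.
have ig : intg m g by apply: intgB => //; exact: intg_cst.
have ieg : intg m (fun x => expR (g x)).
  have -> : (fun x => expR (g x)) = (fun x => M^-1 * expR (v x)).
    by apply/funext => x; rewrite /g expRD expRN lnK ?posrE// mulrC.
  exact: intgZ.
pose G := \int[m]_x `|g x|.
have G0 : 0 <= G by apply: RI_ge0.
pose K := 2 / (1 - normc z) ^+ 2.
have K0 : 0 <= K by rewrite divr_ge0// sqr_ge0.
pose e2 := e * M. have e20 : 0 < e2 by rewrite mulr_gt0.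
(* The three summands serve the Fejer means of |p|^2, the Fejer mean of log (w / M) at z, and the
   Fejer means of the Poisson kernel. *)
have [N HN] := natr_above (L ^+ 2 / e2 ^+ 2 * 2 + K * G / e + K / e2).
have N0 : 0 < N.+1%:R :> R by rewrite ltr0n.
have t1 : 0 <= L ^+ 2 / e2 ^+ 2 * 2 by apply: mulr_ge0 => //; apply: divr_ge0; exact: sqr_ge0.
have t2 : 0 <= K * G / e by apply: divr_ge0; [exact: mulr_ge0|exact: ltW].
have t3 : 0 <= K / e2 by rewrite divr_ge0// ltW.
have HN1 : L ^+ 2 / e2 ^+ 2 * 2 <= N.+1%:R.
  by apply: le_trans HN; rewrite -addrA lerDl addr_ge0.
have HN2 : K * G / N.+1%:R <= e.
  rewrite ler_pdivrMr// [leRHS]mulrC -ler_pdivrMr//; apply: le_trans HN.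
  by rewrite addrAC lerDr addr_ge0.
have HN3 : K / N.+1%:R <= e2.
  rewrite ler_pdivrMr// [leRHS]mulrC -ler_pdivrMr//; apply: le_trans HN.
  by rewrite lerDr addr_ge0.
pose F := fejer R N.+1.
pose q0 := \poly_(j < size F) (F`_j * moment g j).
have q0E x : Re q0.[x] = \int[m]_eta (Re F.[x * (cval eta)^*] * g eta).
  exact: Re_moment_poly.
(* An imaginary constant leaves Re q unchanged and makes q(z) real, hence also F(z). *)
pose q := q0 - ((Im q0.[z]) *i)%:P.
have Req x : Re q.[x] = Re q0.[x].
  by rewrite /q hornerD hornerN hornerC RecD RecN /= subr0.
have qz : q.[z] = (Re q0.[z])%:C.
  rewrite /q hornerD hornerN hornerC.
  by case: q0.[z] => a b; apply: complex_eq => /=; rewrite ?subr0 ?subrr.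
have bFz (x : R[i]) : bmf (fun eta : T => Re F.[x * (cval eta)^*]).
  have := @bmc_horner R F (fun eta => x * (cval eta)^*).
  by case=> //; apply: bmcM; [exact: bmc_cst|apply: bmcJ; exact: bmc_cval].
have q0z : plog z - ln M - e <= Re q0.[z].
  have -> : plog z - ln M = \int[m]_x (poisson z x * g x).
    rewrite (@eq_RI _ _ _ _ _ (fun x => poisson z x * v x - ln M * poisson z x)).
      have iP : intg m (poisson z) by apply: intg_bmf; exact: bmf_poisson.
      rewrite RIB; [|by apply: intgM => //; exact: bmf_poisson|exact: intgZ].
      by rewrite RIZ// RI_poisson// mulr1.
    by move=> x; rewrite /g; ring.
  rewrite q0E lerBlDl -lerBlDr -RIB; first last.
  - by apply: intgM.
  - by apply: intgM => //; exact: bmf_poisson.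
  apply: le_trans HN2; apply: le_trans (ler_norm _) _.
  apply: le_trans (RI_norm _) _.
    by apply: intgB; apply: intgM => //; exact: bmf_poisson.
  have -> : K * G / N.+1%:R = \int[m]_x ((K / N.+1%:R) * `|g x|).
    by rewrite RIZ; [exact: mulrAC|exact: intg_norm].
  apply: RI_le => [||x].
  - apply: intg_norm; by apply: intgB; apply: intgM => //; exact: bmf_poisson.
  - by apply: intgZ; exact: intg_norm.
  rewrite -mulrBl normrM ler_wpM2r// distrC.
  exact: fejer_poisson.
have [C C0 HC] := bounded_poly q.
pose x0 := Re q0.[z].
have [k Hk] := natr_above (C ^+ 2 / e + `|x0| + x0 ^+ 2 / e).
have k0 : 0 < k.+1%:R :> R by rewrite ltr0n.
have s1 : 0 <= C ^+ 2 / e by apply: divr_ge0; [exact: sqr_ge0|exact: ltW].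
have s2 : 0 <= x0 ^+ 2 / e by apply: divr_ge0; [exact: sqr_ge0|exact: ltW].
have Hk1 : C ^+ 2 / (4 * k.+1%:R) <= e.
  rewrite ler_pdivrMr ?mulr_gt0// [leRHS]mulrC -ler_pdivrMr//.
  apply: (@le_trans _ _ k.+1%:R); last by rewrite ler_peMl ?ler1n.
  by apply: le_trans Hk; rewrite -addrA lerDl addr_ge0.
have Hk2 : x0 ^+ 2 / (2 * k.+1%:R) <= e / 2.
  rewrite ler_pdivrMr ?mulr_gt0//.
  have -> : e / 2 * (2 * k.+1%:R) = k.+1%:R * e by field.
  by rewrite -ler_pdivrMr//; apply: le_trans Hk; rewrite lerDr addr_ge0.
have Hk3 : - k.+1%:R <= x0.
  rewrite lerNl; apply: le_trans (ler_norm _) _; rewrite normrN.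
  by apply: le_trans Hk; rewrite addrAC lerDr addr_ge0.
have [tau Fz Htau] := exp_poly_real qz Hk3.
have key (f : T -> R) : bmf f -> (forall x, 0 <= f x) ->
    (forall eta, \int[m]_xi (f xi * Re F.[cval xi * (cval eta)^*]) <= f eta + e2) ->
    \int[m]_x (f x * normc (exp_poly q k).[cval x] ^+ 2) <=
    expR e * ((\int[mu]_x f x) / M + e).
  move=> bf f0 Hf.
  have [bI [bJ swap]] := RI_swap mu F bf.
  have point xi : normc (exp_poly q k).[cval xi] ^+ 2 <=
      expR e / M * \int[mu]_eta Re F.[cval xi * (cval eta)^*].
    apply: le_trans (normc_exp_poly_le _ _ _) _.
    rewrite addrC expRD -mulrA; apply: ler_pM; rewrite ?expR_ge0//.
      rewrite ler_expR; apply: le_trans Hk1; rewrite ler_wpM2r ?invr_ge0 ?mulr_ge0//.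
      by rewrite lerXn2r ?nnegrE ?normc_ge0.
    have F0 eta : 0 <= Re F.[cval xi * (cval eta)^*].
      by apply: fejer_ge0; rewrite normcM normcJr !normc_cval mulr1.
    rewrite Req q0E; apply: le_trans (jensen_exp _ _ _ _ _) _ => //.
      rewrite -[RHS](RI_fejer N xi); apply: eq_RI => eta.
      rewrite -[RHS]RecJ -fejerJ; congr (complex.Re _.[_]).
      by rewrite conjcM conjcK mulrC.
    rewrite -(@ler_pM2l _ M)// mulrA mulfV ?lt0r_neq0// mul1r -RIZ; last exact: intgM.
    apply: le_trans (domW _ _) => //.
    rewrite le_eqVlt; apply/orP; left; apply/eqP; apply: eq_RI => eta.
    rewrite /g expRD expRN lnK ?posrE//; field; exact: lt0r_neq0.
  apply: le_trans (_ : _ <= \int[m]_x (expR e / M * (f x * \int[mu]_eta Re F.[cval x * (cval eta)^*]))) _.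
    apply: RI_le => [||x].
    - by apply: intg_bmf; apply: bmfM => //; apply: bmfX; exact: bmf_poly.
    - by apply: intgZ; apply: intg_bmf; exact: bmfM.
    by rewrite [leRHS]mulrCA ler_wpM2l.
  rewrite RIZ; last by apply: intg_bmf; exact: bmfM.
  rewrite swap -mulrA ler_wpM2l ?expR_ge0//.
  rewrite ler_pdivrMl// mulrDr mulrCA mulfV ?lt0r_neq0// mulr1 [M * e]mulrC -/e2.
  rewrite -[e2 in leRHS](RI_cst mu) -RID; [|exact: intg_bmf|exact: intg_cst].
  by apply: RI_le => //; [exact: intg_bmf|apply: intgD; [exact: intg_bmf|exact: intg_cst]].
exists (exp_poly q k), tau; split => //.
- apply: le_trans Htau; rewrite ler_expR -/x0.
  move: q0z Hk2; rewrite -/x0; set a := plog z - _; set b := x0 ^+ 2 / _.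
  by move: (x0) (a) (b) => x' a' b'; lra.
- apply: key => [||eta].
  + by apply: bmfX; exact: bmf_poly.
  + by move=> x; exact: sqr_ge0.
  + apply: (@fejer_mean_le _ _ L) => //.
    by apply: bmfX; exact: bmf_poly.
- rewrite [X in X + e](_ : 1 = pmass z / M); last by rewrite divff// lt0r_neq0.
  apply: key => [||eta].
  + exact: bmf_poisson.
  + by move=> x; rewrite ltW// poisson_gt0.
  rewrite (@eq_RI _ _ _ _ _ (fun xi => Re (F \Po ((cval eta)^* *: 'X)).[cval xi] * poisson z xi)); last first.
    by move=> xi; rewrite horner_comp [(_ *: 'X).[_]]hornerZ hornerX mulrC [_^* * _]mulrC.
  rewrite RI_poisson_Re// horner_comp [(_ *: 'X).[_]]hornerZ hornerX [_^* * _]mulrC.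
  rewrite -lerBlDl; apply: le_trans (ler_norm _) _.
  by apply: le_trans (fejer_poisson N eta z1) _.
Qed.
End outer_polynomial.

(** * Point evaluation of polynomials in L^2(mu) inside the disc *)

Section point_evaluation.
Variable R : realType.
Local Notation "z ^*" := (conjc z) : ring_scope.
Local Notation T := (circle R).
Local Notation m := (@circle_lebesgue R).
Local Notation CI := (cintegral m).
Implicit Types (z u : R[i]) (p q F : {poly R[i]}) (xi eta : T).
Local Notation Re := (@complex.Re R).

(** The polynomial x^N conj(p(1/conj(x))). It has the modulus of p on the circle, and so the same
    norms, while its value at z is tied to that of p at 1/conj(z): this carries estimates out of the
    disc. *)
Definition reflect_poly N p : {poly R[i]} := \poly_(i < N.+1) (p`_(N - i))^*.

Lemma size_reflect_poly N p : (size (reflect_poly N p) <= N.+1)%N.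
Proof. exact: size_poly. Qed.

Lemma horner_reflect_poly N p x : (size p <= N.+1)%N -> x != 0 ->
  (reflect_poly N p).[x] = x ^+ N * (p.[(x^*)^-1])^*.
Proof.
move=> sp x0; rewrite horner_poly (horner_coef_wide _ sp) conjc_sum mulr_sumr.
rewrite (reindex_inj rev_ord_inj) /=; apply: eq_bigr => i _.
rewrite subSS subKn; last by rewrite -ltnS.
rewrite conjcM conjcX conjc_inv conjcK mulrCA; congr (_ * _).
have iN : (i <= N)%N by rewrite -ltnS.
by rewrite -[X in _ = x ^+ X * _](subnK iN) exprD -mulrA exprVn mulfV ?mulr1// expf_neq0.
Qed.

Lemma reflect_poly_circle N p xi : (size p <= N.+1)%N ->
  (reflect_poly N p).[cval xi] = cval xi ^+ N * (p.[cval xi])^*.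
Proof.
move=> sp; rewrite horner_reflect_poly ?cval_neq0//.
by rewrite -cvalV invrK.
Qed.

Definition szego_poly n z : {poly R[i]} := \poly_(j < n) (z^*) ^+ j.

Lemma horner_szego_poly n z x : (szego_poly n z).[x] = \sum_(j < n) (z^*) ^+ j * x ^+ j.
Proof. by rewrite horner_poly. Qed.

Lemma size_szego_poly n z : (size (szego_poly n z) <= n)%N.
Proof. exact: size_poly. Qed.

Lemma szego_poly_reproducing n z p : (size p <= n)%N ->
  CI (fun x => p.[cval x] * ((szego_poly n z).[cval x])^*) = p.[z].
Proof.
move=> sp; rewrite (horner_coef_wide _ sp).
have bp j : bmc (fun x : T => p.[cval x] * (cval x ^+ j)^*).
  by apply: bmcM; [exact: bmc_poly|apply: bmcJ; exact: bmcX (@bmc_cval R)].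
rewrite (@eq_CI _ _ _ (fun x => \sum_(j < n) z ^+ j * (p.[cval x] * (cval x ^+ j)^*))).
  rewrite CI_sum; last by move=> j; apply: bmcM => //; exact: bmc_cst.
  by apply: eq_bigr => j _; rewrite CIZ// CI_polyJ mulrC.
move=> x; rewrite horner_szego_poly conjc_sum mulr_sumr; apply: eq_bigr => j _.
by rewrite conjcM [(z^* ^+ j)^*]conjcX conjcK mulrCA.
Qed.

Lemma szego_poly_diag n z : (szego_poly n z).[z] = (\sum_(j < n) normc z ^+ (2 * j))%:C.
Proof.
rewrite horner_szego_poly rmorph_sum; apply: eq_bigr => j _ /=.
by rewrite -exprMn [_ * z]mulrC mulcJ -rmorphXn exprM.
Qed.

Lemma RI_szego_poly n z :
  \int[m]_x (normc (szego_poly n z).[cval x] ^+ 2) = \sum_(j < n) normc z ^+ (2 * j).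
Proof.
have := szego_poly_reproducing z (size_szego_poly n z).
rewrite szego_poly_diag => /(congr1 Re) /= <-.
by apply: eq_RI => x; rewrite RecMJ_normc.
Qed.

Lemma szego_poly_cauchy n z xi : normc z < 1 ->
  (1 - z ^+ n * (cval xi)^* ^+ n) * cauchy_kernel z xi = ((szego_poly n z).[cval xi])^*.
Proof.
move=> z1; have d0 := cauchy_den_neq0 xi z1.
apply: (mulIf d0); rewrite -mulrA mulVf// mulr1 horner_szego_poly conjc_sum.
rewrite (eq_bigr (fun j : 'I_n => (z * (cval xi)^*) ^+ j)); last first.
  by move=> j _; rewrite conjcM !conjcX conjcK exprMn.
rewrite -exprMn; elim: n => [|n IH]; first by rewrite big_ord0 mul0r expr0 subrr.
by rewrite big_ord_recr /= mulrDl -IH exprS; ring.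
Qed.

(** The factor |f|^2 in front is the point: it becomes the weight |F|^2 after Cauchy-Schwarz. It is
    available because |conj(f) - f| <= 4 |f| |f - 1|, as either |f| >= 1/2 or |f - 1| >= 1/2. *)
Lemma phase_defect (b f : R[i]) :
  normc (f - b * f^*) ^+ 2 <= normc f ^+ 2 * (normc (1 - b) ^+ 2 + 8 * normc b * normc (f - 1)).
Proof.
have h : normc (f^* - f) <= 4 * (normc f * normc (f - 1)).
  have [f2|f2] := leP (1 / 2) (normc f).
    apply: (@le_trans _ _ (2 * normc (f - 1))).
      apply: le_trans (normc_triangle 1 _ _) _.
      rewrite [normc (1 - f)]normcBC -[in X in X + _]normcJr conjcB conjcK conjc_one.
      lra.
    by rewrite mulrA ler_wpM2r ?normc_ge0//; lra.
  apply: (@le_trans _ _ (2 * normc f)).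
    by apply: le_trans (normcB_le _ _) _; rewrite normcJr; lra.
  have : 1 / 2 <= normc (f - 1).
    rewrite normcBC; apply: le_trans (normcB_ge _ _); rewrite normc1; lra.
  move=> h2; have -> : 4 = 2 * 2 :> R by ring.
  rewrite -[leRHS]mulrA ler_wpM2l//.
  by rewrite mulrCA ler_peMr ?normc_ge0//; lra.
have -> : normc (f - b * f^*) ^+ 2 = normc f ^+ 2 * normc (1 - b) ^+ 2 +
    2 * Re (b^* * f * (f^* - f)).
  rewrite !normc_sqB normc1 conjc_one mul1r !normcM normcJr !exprMn.
  rewrite !normc_sq; case: f b {h} => [a c] [d e] /=; ring.
rewrite [leRHS]mulrDr lerD2l.
have -> : normc f ^+ 2 * (8 * normc b * normc (f - 1)) =
   2 * (normc b * normc f * (4 * (normc f * normc (f - 1)))) by ring.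
rewrite ler_wpM2l//; apply: le_trans (Re_le_normc _) _.
by rewrite !normcM normcJr ler_wpM2l// mulr_ge0 ?normc_ge0.
Qed.

Lemma le_at_right (a l : R) (g : R -> R) : g x @[x --> 0^'+] --> l ->
  (forall s, 0 < s -> s <= 1 -> a <= g s) -> a <= l.
Proof.
move=> gl H; rewrite -(cvg_lim _ gl)//; apply: limr_ge; first by apply/cvg_ex; exists l.
near=> s; apply: H; first by near: s; exact: nbhs_right_gt.
by near: s; apply: nbhs_right_le.
Unshelve. all: by end_near. Qed.

Lemma expR_le_1D2x (x : R) : 0 <= x -> x <= 1 / 2 -> expR x <= 1 + 2 * x.
Proof.
move=> x0 x1; have h := expR_ge1Dx (- x).
have : expR x <= (1 - x)^-1.
  by rewrite -[leLHS]invrK -expRN lef_pV2 ?posrE ?expR_gt0//; lra.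
move=> /le_trans; apply; rewrite -[leLHS]mul1r ler_pdivrMr; last by lra.
nra.
Qed.

Variables (mu : probability T R) (v : T -> R).
Hypothesis iv : intg m v.
Hypothesis ie : intg m (fun x => expR (v x)).
Hypothesis domW : forall f, bmf f -> (forall x, 0 <= f x) ->
  \int[m]_x (f x * expR (v x)) <= \int[mu]_x f x.

(** The mean of F against the Poisson kernel is F(z) = tau, so the hypothesis bounds the mean of |F
    - 1|^2 by t^2. Then |F - 1| <= t/2 + |F - 1|^2/(2t) replaces Cauchy-Schwarz. *)
Lemma outer_close z F tau t : normc z < 1 -> F.[z] = tau%:C -> 0 < t ->
  \int[m]_x (poisson z x * normc F.[cval x] ^+ 2) + 1 - 2 * tau <= t ^+ 2 ->
  \int[m]_x (poisson z x * normc (F.[cval x] - 1)) <= t.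
Proof.
move=> z1 Fz t0 H.
have bP := bmf_poisson z1; have bF := bmc_poly F; have nF := bmf_poly F.
have bF1 : bmf (fun x : T => normc (F.[cval x] - 1)).
  by apply: bmf_normc; apply: bmcB => //; exact: bmc_cst.
have bRe : bmf (fun x : T => Re F.[cval x]) by case: bF.
have iP := intg_bmf m bP.
have S : \int[m]_x (poisson z x * normc (F.[cval x] - 1) ^+ 2) <= t ^+ 2.
  rewrite (@eq_RI _ _ _ _ _ (fun x => poisson z x * normc F.[cval x] ^+ 2 + poisson z x -
     2 * (Re F.[cval x] * poisson z x))); last first.
    move=> x; rewrite normc_sqB normc1 mulr1 RecJ; ring.
  have i1 : intg m (fun x => poisson z x * normc F.[cval x] ^+ 2).
    by apply: intg_bmf; apply: bmfM => //; exact: bmfX.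
  have i2 : intg m (fun x => Re F.[cval x] * poisson z x).
    by apply: intg_bmf; exact: bmfM.
  rewrite RIB; [|exact: intgD|exact: intgZ].
  by rewrite RID// RIZ// RI_poisson// RI_poisson_Re// Fz.
have i3 : intg m (fun x => poisson z x * normc (F.[cval x] - 1) ^+ 2).
  by apply: intg_bmf; apply: bmfM => //; exact: bmfX.
apply: (@le_trans _ _ (\int[m]_x (t / 2 * poisson z x +
   (2 * t)^-1 * (poisson z x * normc (F.[cval x] - 1) ^+ 2)))).
  apply: RI_le => [||x].
  - by apply: intg_bmf; exact: bmfM.
  - by apply: intgD; exact: intgZ.
  have P0 := poisson_gt0 x z1; set y := normc _.
  rewrite -subr_ge0.
  have -> : t / 2 * poisson z x + (2 * t)^-1 * (poisson z x * y ^+ 2) - poisson z x * y =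
     poisson z x * ((t - y) ^+ 2 / (2 * t)) by field; exact: lt0r_neq0.
  rewrite mulr_ge0 ?(ltW P0)// divr_ge0 ?sqr_ge0// mulr_ge0// ltW//.
rewrite RID; [|exact: intgZ|exact: intgZ].
rewrite (RIZ _ iP) (RIZ _ i3) RI_poisson// mulr1.
apply: (@le_trans _ _ (t / 2 + (2 * t)^-1 * t ^+ 2)).
  by rewrite lerD2l ler_wpM2l// invr_ge0 mulr_ge0// ltW.
by rewrite le_eqVlt; apply/orP; left; apply/eqP; field; exact: lt0r_neq0.
Qed.

(* With [b = (z / xi) ^+ N.+1], [p b F^* ] is on the circle the conjugate of a polynomial vanishing at [0], so that
   [F(z) p(z)] is the Cauchy integral of [p (F - b F^* )]; [(1 - b) / (1 - z / xi)] is the conjugate of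
   the Szego sum. *)
Lemma point_evaluation_outer N z p F tau t : normc z < 1 -> (size p <= N.+1)%N ->
  F.[z] = tau%:C -> 0 <= tau ->
  \int[m]_x (poisson z x * normc (F.[cval x] - 1)) <= t ->
  normc p.[z] ^+ 2 * tau ^+ 2 <=
  \int[m]_x (normc p.[cval x] ^+ 2 * normc F.[cval x] ^+ 2) *
  (\sum_(j < N.+1) normc z ^+ (2 * j) + 8 * normc z ^+ N.+1 * t / (1 - normc z ^+ 2)).
Proof.
move=> z1 sp Fz tau0 Ht.
have bC := bmc_cauchy z1; have bp := bmc_poly p; have bF := bmc_poly F.
pose b (x : T) := z ^+ N.+1 * (cval x)^* ^+ N.+1.
have bb : bmc b.
  by apply: bmcM; [exact: bmc_cst|apply: bmcX; apply: bmcJ; exact: bmc_cval].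
have nb x : normc (b x) = normc z ^+ N.+1.
  by rewrite normcM !normcX normcJr normc_cval expr1n mulr1.
pose h (x : T) := normc (1 - b x) ^+ 2 + 8 * normc (b x) * normc (F.[cval x] - 1).
have h0 x : 0 <= h x by rewrite addr_ge0 ?sqr_ge0// !mulr_ge0 ?normc_ge0.
have bF1 : bmf (fun x : T => normc (F.[cval x] - 1)).
  by apply: bmf_normc; apply: bmcB => //; exact: bmc_cst.
have b1b : bmf (fun x => normc (1 - b x)).
  by apply: bmf_normc; apply: bmcB => //; exact: bmc_cst.
have bh : bmf h.
  apply: bmfD; first exact: bmfX.
  by apply: bmfM => //; apply: bmfM; [exact: bmf_cst|exact: bmf_normc].
have I1 : CI (fun x => p.[cval x] * (F.[cval x] - b x * (F.[cval x])^*) * cauchy_kernel z x)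
    = tau%:C * p.[z].
  rewrite (@eq_CI _ _ _ (fun x => (p * F).[cval x] * cauchy_kernel z x -
     z ^+ N.+1 * ((cval x * (reflect_poly N p * F).[cval x])^* * cauchy_kernel z x))).
    have b1 : bmc (fun x => (p * F).[cval x] * cauchy_kernel z x).
      by apply: bmcM => //; exact: bmc_poly.
    have b2 : bmc (fun x => (cval x * (reflect_poly N p * F).[cval x])^* * cauchy_kernel z x).
      apply: bmcM => //; apply: bmcJ; apply: bmcM; [exact: bmc_cval|exact: bmc_poly].
    rewrite CIB//; last by apply: bmcM => //; exact: bmc_cst.
    rewrite CIZ// CI_cauchy// CI_cauchy_anti// mulr0 subr0 hornerM Fz mulrC//.
  move=> x; rewrite !hornerM reflect_poly_circle// /b !conjcM conjcK conjcX !exprS.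
  by ring.
have b1 : bmf (fun x => normc p.[cval x] * normc F.[cval x]).
  by apply: bmfM; exact: bmf_normc.
have b2 : bmf (fun x => normc (cauchy_kernel z x) * Num.sqrt (h x)).
  by apply: bmfM; [exact: bmf_normc|exact: bmf_sqrt].
have : normc (tau%:C * p.[z]) <= \int[m]_x ((normc p.[cval x] * normc F.[cval x]) *
    (normc (cauchy_kernel z x) * Num.sqrt (h x))).
  rewrite -I1; apply: CI_norm_dom.
  - apply: bmcM => //; apply: bmcM => //; apply: bmcB => //.
    by apply: bmcM => //; exact: bmcJ.
  - by apply: intg_bmf; exact: bmfM.
  move=> x; rewrite !normcM.
  have -> : normc p.[cval x] * normc F.[cval x] * (normc (cauchy_kernel z x) * Num.sqrt (h x)) =
    normc p.[cval x] * (normc F.[cval x] * Num.sqrt (h x)) * normc (cauchy_kernel z x) by ring.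
  rewrite ler_wpM2r ?normc_ge0// ler_wpM2l ?normc_ge0//.
  rewrite -(@ler_pXn2r _ 2) ?nnegrE ?normc_ge0 ?mulr_ge0 ?sqrtr_ge0 ?normc_ge0//.
  by rewrite exprMn sqr_sqrtr// phase_defect.
rewrite normcZ// => H.
have := RI_cauchy_schwarz m b1 b2.
have H2 : (tau * normc p.[z]) ^+ 2 <= (\int[m]_x ((normc p.[cval x] * normc F.[cval x]) *
    (normc (cauchy_kernel z x) * Num.sqrt (h x)))) ^+ 2.
  by rewrite lerXn2r ?nnegrE ?mulr_ge0 ?normc_ge0//; apply: le_trans H; rewrite ?mulr_ge0 ?normc_ge0.
move=> /(le_trans H2); rewrite exprMn mulrC => /le_trans; apply.
rewrite (@eq_RI _ _ _ _ _ (fun x => normc p.[cval x] ^+ 2 * normc F.[cval x] ^+ 2)); last first.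
  by move=> x; rewrite exprMn.
apply: ler_wpM2l; first by apply: RI_ge0 => x; rewrite mulr_ge0 ?sqr_ge0.
rewrite (@eq_RI _ _ _ _ _ (fun x => normc (szego_poly N.+1 z).[cval x] ^+ 2 +
  (8 * normc z ^+ N.+1 / (1 - normc z ^+ 2)) * (poisson z x * normc (F.[cval x] - 1)))); last first.
  move=> x; rewrite exprMn sqr_sqrtr// /h nb poissonE -(normcJr (szego_poly _ _).[_]).
  rewrite -szego_poly_cauchy// -/(b x) normcM.
  by field; rewrite lt0r_neq0// normc_sq_lt1.
have i2 : intg m (fun x => poisson z x * normc (F.[cval x] - 1)).
  by apply: intg_bmf; apply: bmfM => //; exact: bmf_poisson.
rewrite RID; [|by apply: intg_bmf; apply: bmfX; exact: bmf_poly|exact: intgZ].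
rewrite RIZ// RI_szego_poly lerD2l -[leRHS]mulrAC ler_wpM2l//.
by rewrite divr_ge0 ?mulr_ge0 ?exprn_ge0 ?normc_ge0// ltW// normc_sq_lt1.
Qed.

(** [point_evaluation_outer] is applied with t = theta + s, and s -> 0+ at the end: this removes the
    approximation errors and admits theta = 0, although [outer_close] wants t > 0. *)
Lemma point_evaluation N z p theta : normc z < 1 -> (size p <= N.+1)%N ->
  0 <= theta -> ln (pmass mu z) - plog v z <= theta ^+ 2 ->
  normc p.[z] ^+ 2 <= expR (- plog v z) *
  (\sum_(j < N.+1) normc z ^+ (2 * j) + 8 * normc z ^+ N.+1 * theta / (1 - normc z ^+ 2)) *
  \int[mu]_x normc p.[cval x] ^+ 2.
Proof.
move=> z1 sp th0 Hk.
set k0 := \sum_(j < _) _; set c := 8 * normc z ^+ N.+1; set d := 1 - normc z ^+ 2.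
set I := \int[mu]_x _; set M := pmass mu z; set L := plog v z.
have M0 : 0 < M by exact: pmass_gt0.
have d0 : 0 < d by exact: normc_sq_lt1.
have c0 : 0 <= c by rewrite mulr_ge0// exprn_ge0// normc_ge0.
have k00 : 0 <= k0 by apply: sumr_ge0 => j _; rewrite exprn_ge0// normc_ge0.
pose g s := expR (ln M - L) * (expR (3 * (s ^+ 2 / 6))) * (I / M + s ^+ 2 / 6) * (k0 + c * (theta + s) / d).
apply: (@le_at_right _ _ g).
  have -> : expR (- L) * (k0 + c * theta / d) * I =
     expR (ln M - L) * (expR (3 * (0 ^+ 2 / 6))) * (I / M + 0 ^+ 2 / 6) * (k0 + c * (theta + 0) / d).
    rewrite expRD lnK ?posrE// expr0n /= mul0r mulr0 expR0 !addr0 mulr1.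
    by field; rewrite !lt0r_neq0.
  have hid : x @[x --> (0 : R)^'+] --> (0 : R).
    by apply: cvg_at_right_filter; exact: cvg_id.
  have hsq : (x ^+ 2 / 6) @[x --> (0 : R)^'+] --> ((0 : R) ^+ 2 / 6).
    apply: cvgM; last exact: cvg_cst.
    by rewrite expr2; under eq_fun do rewrite expr2; exact: cvgM.
  apply: cvgM; [apply: cvgM; [apply: cvgM|]|].
  - exact: cvg_cst.
  - apply: (@cvg_comp _ _ _ _ (@expR R)); last exact: continuous_expR.
    by apply: cvgM => //; exact: cvg_cst.
  - by apply: cvgD => //; exact: cvg_cst.
  - apply: cvgD; first exact: cvg_cst.
    apply: cvgM; last exact: cvg_cst.
    apply: cvgM; first exact: cvg_cst.
    by apply: cvgD => //; exact: cvg_cst.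
(* The 6: the quantity to be bounded by (theta + s)^2 is at most theta^2 + 5 e + 2 e^2 <= theta^2 +
   6 e, as e <= 1/2. *)
move=> s s0 s1; set e := s ^+ 2 / 6.
have s2 : s ^+ 2 <= 1 by rewrite exprn_ile1// ltW.
have e0 : 0 < e by rewrite divr_gt0// exprn_gt0.
have e1 : e <= 1 / 2 by rewrite /e; lra.
have [F [tau [Fz Htau HI HP]]] := outer_polynomial iv ie domW p z1 e0.
have tau0 : 0 < tau by apply: lt_le_trans Htau; exact: expR_gt0.
have se : s ^+ 2 = 6 * e by rewrite /e; field.
have ts : 0 < theta + s by rewrite ltr_wpDl.
have Hc : \int[m]_x (poisson z x * normc (F.[cval x] - 1)) <= theta + s.
  apply: (outer_close z1 Fz) => //.
  have h1 : 1 - (ln M - L) / 2 - e <= tau.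
    by apply: le_trans Htau; apply: le_trans (expR_ge1Dx _); rewrite -/L -/M; lra.
  have h2 := expR_le_1D2x (ltW e0) e1.
  have h3 : expR e * (1 + e) <= (1 + 2 * e) * (1 + e) by rewrite ler_wpM2r//; lra.
  have h4 : 0 <= theta * s by rewrite mulr_ge0// ltW.
  have h5 : e ^+ 2 <= e / 2 by rewrite expr2; nra.
  have h6 : (1 + 2 * e) * (1 + e) = 1 + 3 * e + 2 * e ^+ 2 by ring.
  have -> : (theta + s) ^+ 2 = theta ^+ 2 + 2 * (theta * s) + 6 * e by rewrite -se; ring.
  by rewrite -/L -/M in Hk; lra.
have := point_evaluation_outer z1 sp Fz (ltW tau0) Hc.
rewrite -/k0 -/c -/d => H.
have K0 : 0 <= k0 + c * (theta + s) / d.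
  by apply: addr_ge0 => //; apply: divr_ge0; [apply: mulr_ge0 => //|]; exact: ltW.
have H1 := le_trans H (ler_wpM2r K0 HI).
have ht : expR (L - ln M - 2 * e) <= tau ^+ 2.
  have -> : expR (L - ln M - 2 * e) = expR ((L - ln M) / 2 - e) ^+ 2.
    by rewrite expr2 -expRD; congr expR; field.
  by rewrite lerXn2r ?nnegrE ?expR_ge0 ?(ltW tau0).
have H2 := le_trans (ler_wpM2l (sqr_ge0 (normc p.[z])) ht) H1.
have E : expR (L - ln M - 2 * e) * expR (ln M - L + 2 * e) = 1.
  by rewrite -expRD (_ : _ + _ = 0) ?expR0//; ring.
have := ler_wpM2r (expR_ge0 (ln M - L + 2 * e)) H2.
have -> : normc p.[z] ^+ 2 * expR (L - ln M - 2 * e) * expR (ln M - L + 2 * e) = normc p.[z] ^+ 2.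
  by rewrite -mulrA E mulr1.
move=> /le_trans; apply.
rewrite /g -/e -/I -/M.
have -> : expR (ln M - L + 2 * e) = expR (ln M - L) * expR (2 * e) by rewrite expRD.
have -> : expR (3 * e) = expR e * expR (2 * e) by rewrite -expRD; congr expR; ring.
by rewrite le_eqVlt; apply/orP; left; apply/eqP; ring.
Qed.
End point_evaluation.

(** * Measures of small entropy *)

Section entropy_comparison.
Variable R : realType.
Local Notation T := (circle R).
Local Notation m := (@circle_lebesgue R).
Implicit Types (z u : R[i]) (p q F : {poly R[i]}) (xi eta : T).

Variables (mu : probability T R) (v : T -> R).
Hypothesis iv : intg m v.
Hypothesis ie : intg m (fun x => expR (v x)).
Hypothesis domW : forall f, bmf f -> (forall x, 0 <= f x) ->
  \int[m]_x (f x * expR (v x)) <= \int[mu]_x f x.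
Local Notation M := (pmass mu).
Local Notation L := (plog v).

Lemma expR_tangent (a y : R) : 0 < a -> a * (1 + (y - ln a)) <= expR y.
Proof.
move=> a0; have -> : expR y = a * expR (y - ln a).
  by rewrite expRD expRN lnK ?posrE// mulrCA mulfV ?mulr1// lt0r_neq0.
by rewrite ler_wpM2l ?(ltW a0)// expR_ge1Dx.
Qed.

(** Put a = M z0. From t - 1 - log t >= 0 the measure mu/a - (1 + log (w/a)) m is nonnegative. The
    left side is its Poisson integral at z, and the entropy at z0 is its Poisson integral at z0;
    domination of the kernels finishes. *)
Lemma entropy_dom z0 z B : normc z0 < 1 -> normc z < 1 ->
  (forall x, poisson z x <= B * poisson z0 x) ->
  M z / M z0 - 1 - L z + ln (M z0) <= B * (ln (M z0) - L z0).
Proof.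
move=> z01 z1 HB; have a0 := pmass_gt0 mu z01; set a := M z0 in a0 *.
have bP0 := bmf_poisson z01; have bP := bmf_poisson z1.
pose f x := B * poisson z0 x - poisson z x.
have bf : bmf f by apply: bmfB => //; exact: bmfZ.
have f0 x : 0 <= f x by rewrite subr_ge0.
have := domW bf f0.
have -> : \int[mu]_x f x = B * a - M z.
  rewrite /f RIB; [|by apply: intgZ; exact: intg_bmf|exact: intg_bmf].
  by rewrite RIZ//; exact: intg_bmf.
have h1 : \int[m]_x (a * ((1 - ln a) * f x + f x * v x)) <= \int[m]_x (f x * expR (v x)).
  apply: RI_le => [||x].
  - apply: intgZ; apply: intgD; last exact: intgM.
    by apply: intgZ; exact: intg_bmf.
  - exact: intgM.
  have -> : a * ((1 - ln a) * f x + f x * v x) = f x * (a * (1 + (v x - ln a))) by ring.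
  by rewrite ler_wpM2l// expR_tangent.
move=> /(le_trans h1).
have i1 : intg m (fun x => f x * v x) by exact: intgM.
have i2 : intg m f by exact: intg_bmf.
rewrite RIZ; last by apply: intgD => //; exact: intgZ.
rewrite RID//; last exact: intgZ.
rewrite (RIZ _ i2).
have -> : \int[m]_x f x = B - 1.
  rewrite /f RIB; [|by apply: intgZ; exact: intg_bmf|exact: intg_bmf].
  by rewrite RIZ ?RI_poisson ?mulr1//; exact: intg_bmf.
have -> : \int[m]_x (f x * v x) = B * L z0 - L z.
  rewrite (@eq_RI _ _ _ _ _ (fun x => B * (poisson z0 x * v x) - poisson z x * v x)).
    rewrite RIB; [|by apply: intgZ; exact: intgM|exact: intgM].
    by rewrite RIZ//; exact: intgM.
  by move=> x; rewrite /f; ring.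
rewrite -ler_pdivlMl// => H.
have -> : M z / a = B - a^-1 * (B * a - M z) by field; exact: lt0r_neq0.
move: H; set X := a^-1 * _ => H.
have -> : B * (ln a - L z0) = B * ln a - B * L z0 by ring.
have E : (1 - ln a) * (B - 1) = B - 1 - B * ln a + ln a by ring.
by rewrite E in H; lra.
Qed.

(** A Harnack inequality for the entropy, although it is not a Poisson integral: log t <= t - 1 at t
    = M z / M z0 bounds it by the left side of [entropy_dom]. *)
Lemma entropy_le z0 z B : normc z0 < 1 -> normc z < 1 ->
  (forall x, poisson z x <= B * poisson z0 x) ->
  ln (M z) - L z <= B * (ln (M z0) - L z0).
Proof.
move=> z01 z1 HB; apply: le_trans (entropy_dom z01 z1 HB).
have a0 := pmass_gt0 mu z01; have b0 := pmass_gt0 mu z1.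
have := expR_tangent (ln (M z)) a0; rewrite lnK ?posrE//.
rewrite -ler_pdivlMl// mulrC; lra.
Qed.

Variables (z0 : R[i]) (s : R).
Hypothesis z01 : normc z0 < 1.
Hypothesis s0 : 0 < s.
Hypothesis s1 : s <= 1 / 2.
Hypothesis Hs : ln (M z0) - L z0 <= s ^+ 2.

(* Test [mu] with [P - (s / B) f >= 0], [P] the Poisson kernel at [z0], and bound [w] from below by
   the tangent line of [exp] at [log a], [a] the Poisson mass of [mu]. *)
Lemma mean_le f B : bmf f -> 0 < B -> (forall x, `|f x| <= B * poisson z0 x) ->
  (\int[mu]_x f x) / M z0 - \int[m]_x f x <= 3 * B * s.
Proof.
move=> bf B0 HB; have a0 := pmass_gt0 mu z01; set a := M z0 in a0 *.
have bP := bmf_poisson z01; have iP := intg_bmf m bP.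
have if_ := intg_bmf m bf.
pose f' x := poisson z0 x - (s / B) * f x.
have bf' : bmf f' by apply: bmfB => //; exact: bmfZ.
have xle x : `|(s / B) * f x| <= s * poisson z0 x.
  have sB : 0 < s / B by exact: divr_gt0.
  rewrite normrM (gtr0_norm sB); apply: le_trans (ler_wpM2l (ltW sB) (HB x)) _.
  by rewrite mulrA divfK// lt0r_neq0.
have f'0 x : 0 <= f' x.
  have := xle x; rewrite ler_norml => /andP[_ h]; have P0 := poisson_gt0 x z01.
  rewrite subr_ge0; apply: le_trans h _; rewrite -[leRHS]mul1r; apply: ler_wpM2r; first exact: ltW.
  by move: s1; lra.
have := domW bf' f'0.
have -> : \int[mu]_x f' x = a - (s / B) * \int[mu]_x f x.
  rewrite /f' RIB; [|exact: intg_bmf|by apply: intgZ; exact: intg_bmf].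
  by rewrite RIZ//; exact: intg_bmf.
have h1 : \int[m]_x (a * (((1 - ln a - 2 * s ^+ 2) * poisson z0 x + poisson z0 x * v x) - (s / B) * f x))
    <= \int[m]_x (f' x * expR (v x)).
  apply: RI_le => [||x].
  - by apply: intgZ; apply: intgB; [apply: intgD; [exact: intgZ|exact: intgM]|exact: intgZ].
  - exact: intgM.
  have P0 := poisson_gt0 x z01.
  pose y := - ((s / B) * f x / poisson z0 x).
  have y1 : `|y| <= s by rewrite normrN normrM normfV (gtr0_norm P0) ler_pdivrMr.
  have c0 : expR (y - 2 * y ^+ 2) <= 1 + y.
    by apply: expR_le_oneDx; move: y1; rewrite ler_norml => /andP[h _]; move: s1; lra.
  have y2 : y ^+ 2 <= s ^+ 2.
    by rewrite -real_normK ?num_real// lerXn2r ?nnegrE ?(ltW s0).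
  have -> : f' x = poisson z0 x * (1 + y).
    by rewrite /f' /y; field; rewrite !lt0r_neq0.
  apply: (@le_trans _ _ (poisson z0 x * (expR (y - 2 * y ^+ 2) * expR (v x)))); last first.
    by rewrite mulrA ler_wpM2r ?expR_ge0// ler_wpM2l// ltW.
  rewrite -expRD.
  have := expR_tangent (y - 2 * y ^+ 2 + v x) a0 => /(ler_wpM2l (ltW P0)); apply: le_trans.
  have -> : a * (((1 - ln a - 2 * s ^+ 2) * poisson z0 x + poisson z0 x * v x) - (s / B) * f x) =
     poisson z0 x * (a * (1 + (y - 2 * s ^+ 2 + v x - ln a))).
    by rewrite /y; field; rewrite !lt0r_neq0.
  rewrite ler_wpM2l ?(ltW P0)// ler_wpM2l ?(ltW a0)//; lra.
move=> /(le_trans h1).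
have i1 : intg m (fun x => poisson z0 x * v x) by exact: intgM.
rewrite RIZ; last by apply: intgB; [apply: intgD => //; exact: intgZ|exact: intgZ].
rewrite RIB; [|by apply: intgD => //; exact: intgZ|exact: intgZ].
rewrite RID; [|exact: intgZ|by []].
rewrite (RIZ _ iP) RI_poisson// mulr1 (RIZ _ if_) -ler_pdivlMl//.
rewrite -/(plog v z0).
have -> : a^-1 * (a - s / B * \int[mu]_x f x) = 1 - (s / B) * ((\int[mu]_x f x) / a).
  by field; rewrite !lt0r_neq0.
set X := _ / a; set Y := \int[m]_x f x => H.
have : (s / B) * (X - Y) <= 3 * s ^+ 2.
  rewrite mulrBr; move: H; set X' := s / B * X; set Y' := s / B * Y.
  by move: Hs; rewrite -/a; set k := plog v z0; lra.
have -> : 3 * s ^+ 2 = (s / B) * (3 * B * s) by field; exact: lt0r_neq0.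
by rewrite ler_pM2l// divr_gt0.
Qed.

Lemma mean_close f B : bmf f -> 0 < B -> (forall x, `|f x| <= B * poisson z0 x) ->
  `|(\int[mu]_x f x) / M z0 - \int[m]_x f x| <= 3 * B * s.
Proof.
move=> bf B0 HB; rewrite ler_norml mean_le// andbT lerNl.
have := @mean_le (fun x => - f x) B (bmfN bf) B0.
have -> : \int[mu]_x - f x = - \int[mu]_x f x.
  by under eq_RI do rewrite -mulN1r; rewrite RIZ ?mulN1r//; exact: intg_bmf.
have -> : \int[m]_x - f x = - \int[m]_x f x.
  by under eq_RI do rewrite -mulN1r; rewrite RIZ ?mulN1r//; exact: intg_bmf.
rewrite mulNr -opprD; apply => x; by rewrite normrN.
Qed.

Lemma cmean_close f B : bmc f -> 0 < B -> (forall x, normc (f x) <= B * poisson z0 x) ->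
  normc ((M z0)^-1%:C * cintegral mu f - cintegral m f) <= 6 * B * s.
Proof.
move=> [b1 b2] B0 HB; apply: le_trans (normc_le_ReIm _) _.
rewrite RecD ImcD RecN ImcN RecZ ImcZ /=.
have -> : 6 * B * s = 3 * B * s + 3 * B * s by ring.
rewrite ![(M z0)^-1 * _]mulrC.
apply: lerD; apply: mean_close => // x; apply: le_trans (HB x).
  exact: normRe_le.
exact: normIm_le.
Qed.

(** [entropy_dom] gives ln (M z0) - L z <= B s^2 + 1 - M z / M z0, and [mean_close] bounds the last
    difference by 3 B s. The comparison of the two masses is what makes the loss linear in s. *)
Lemma neg_plog_le z B : normc z < 1 -> 1 <= B ->
  (forall x, poisson z x <= B * poisson z0 x) ->
  M z0 * expR (- L z) <= expR (4 * B * s).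
Proof.
move=> z1 B1 HB; have a0 := pmass_gt0 mu z01.
have B0 : 0 < B by lra.
rewrite -[M z0 in leLHS]lnK ?posrE// -expRD ler_expR.
have h1 := entropy_dom z01 z1 HB.
have : `|M z / M z0 - 1| <= 3 * B * s.
  have h : forall x, `|poisson z x| <= B * poisson z0 x.
    by move=> x; rewrite gtr0_norm ?poisson_gt0.
  by have := mean_close (bmf_poisson z1) B0 h; rewrite RI_poisson.
rewrite ler_norml => /andP[h2 _].
have h3 : B * (ln (M z0) - L z0) <= B * s.
  rewrite ler_pM2l//; apply: le_trans Hs _.
  by rewrite expr2 ler_piMl ?(ltW s0)//; move: s1; lra.
lra.
Qed.
End entropy_comparison.

(** * Reproducing kernels *)

Section kernel_error.
Variable R : realType.
Local Notation "z ^*" := (conjc z) : ring_scope.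
Local Notation T := (circle R).
Local Notation m := (@circle_lebesgue R).
Implicit Types (z u : R[i]) (p q F : {poly R[i]}) (xi eta : T).
Local Notation Re := (@complex.Re R).

Variables (mu : probability T R) (N : nat) (k : R[i] -> {poly R[i]}) (a : R).
Hypothesis Hk : forall z, reproducing_kernel mu N.+1 z (k z).
Hypothesis a0 : 0 < a.
Local Notation k0 := (szego_poly N.+1).

(** The inner product of L^2(mu/a), for which a k_z is the reproducing kernel. With [a] the Poisson
    mass of mu at z0, the measures mu/a and m give the Poisson kernel of z0 the same integral 1. *)
Definition ip p q := a^-1%:C * cintegral mu (fun x => p.[cval x] * (q.[cval x])^*).
Definition sqnorm p := a^-1 * \int[mu]_x normc p.[cval x] ^+ 2.
Definition kernel_err z := a%:C *: k z - k0 z.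
Definition ip_defect p q :=
  ip p q - cintegral m (fun x => p.[cval x] * (q.[cval x])^*).

Lemma bmc_polyM p q : bmc (fun x : T => p.[cval x] * (q.[cval x])^*).
Proof. by apply: bmcM; [exact: bmc_poly|apply: bmcJ; exact: bmc_poly]. Qed.

Lemma ipBr p q1 q2 : ip p (q1 - q2) = ip p q1 - ip p q2.
Proof.
rewrite /ip -mulrBr -CIB; try exact: bmc_polyM.
congr (_ * _); apply: eq_CI => x.
by rewrite hornerD hornerN conjcB mulrBr.
Qed.

Lemma ipBl p1 p2 q : ip (p1 - p2) q = ip p1 q - ip p2 q.
Proof.
rewrite /ip -mulrBr -CIB; try exact: bmc_polyM.
congr (_ * _); apply: eq_CI => x.
by rewrite hornerD hornerN mulrBl.
Qed.

Lemma ipJ p q : (ip p q)^* = ip q p.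
Proof.
rewrite /ip conjcM conjc_real -CIJ; last exact: bmc_polyM.
congr (_ * _); apply: eq_CI => x.
by rewrite conjcM conjcK mulrC.
Qed.

Lemma size_k z : (size (k z) <= N.+1)%N. Proof. by case: (Hk z). Qed.

Lemma ip_k p z : (size p <= N.+1)%N -> ip p (a%:C *: k z) = p.[z].
Proof.
move=> sp; have [_ H] := Hk z; rewrite -(H p sp) /ip /inner_prod.
have -> : cintegral mu (fun x => p.[cval x] * ((a%:C *: k z).[cval x])^*) =
    a%:C * cintegral mu (fun x => p.[cval x] * ((k z).[cval x])^*).
  rewrite -CIZ; last exact: bmc_polyM.
  by apply: eq_CI => x; rewrite hornerZ conjcM conjc_real mulrCA.
by rewrite mulrA -rmorphM mulVf ?lt0r_neq0// mul1r.
Qed.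

Lemma size_scale_k z : (size (a%:C *: k z) <= N.+1)%N.
Proof. exact: leq_trans (size_scale_leq _ _) (size_k z). Qed.

Lemma size_kernel_err z : (size (kernel_err z) <= N.+1)%N.
Proof.
rewrite /kernel_err; apply: leq_trans (size_polyD _ _) _.
by rewrite size_polyN geq_max size_scale_k size_szego_poly.
Qed.

Lemma kernel_sym x z : (k z).[x] = ((k x).[z])^*.
Proof.
have [_ Hx] := Hk x; have [_ Hz] := Hk z.
rewrite -(Hx _ (size_k z)) -(Hz _ (size_k x)) /inner_prod.
rewrite -[RHS]CIJ; last exact: bmc_polyM.
by apply: eq_CI => y; rewrite [RHS]conjcM conjcK mulrC.
Qed.

Lemma szego_sym x z : (k0 z).[x] = ((k0 x).[z])^*.
Proof.
rewrite !horner_szego_poly conjc_sum; apply: eq_bigr => j _.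
by rewrite conjcM !conjcX conjcK mulrC.
Qed.

Lemma kernel_err_sym x z : (kernel_err z).[x] = ((kernel_err x).[z])^*.
Proof.
rewrite /kernel_err !hornerD !hornerN !hornerZ conjcB conjcM conjc_real.
by rewrite -kernel_sym -szego_sym.
Qed.

(** In the expansion of <E_z, E_x> with E = a k - k0, every term with a factor a k is a point
    evaluation. What remains splits E into a part for Cauchy-Schwarz and a part for
    [near_lebesgue]. *)
Lemma kernel_errE x z : (kernel_err z).[x] = ip (kernel_err z) (kernel_err x) - ip_defect (k0 z) (k0 x).
Proof.
have sz := size_kernel_err z.
rewrite /ip_defect szego_poly_reproducing ?size_szego_poly//.
have -> : ip (kernel_err z) (kernel_err x) = (kernel_err z).[x] - ip (kernel_err z) (k0 x).
  by rewrite [in X in ip _ X]/kernel_err ipBr ip_k.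
have -> : ip (kernel_err z) (k0 x) = (k0 z).[x] - ip (k0 z) (k0 x).
  rewrite [in ip (kernel_err z)]/kernel_err ipBl; congr (_ - _).
  by rewrite -ipJ ip_k ?size_szego_poly// -szego_sym.
ring.
Qed.

Lemma ip_diag p : ip p p = (sqnorm p)%:C.
Proof.
rewrite /ip /sqnorm rmorphM /= -CI_real; congr (_ * _).
by apply: eq_CI => x; rewrite mulcJ.
Qed.

Lemma sqnorm_ge0 p : 0 <= sqnorm p.
Proof.
by rewrite mulr_ge0 ?invr_ge0 ?(ltW a0)//; apply: RI_ge0 => x; exact: sqr_ge0.
Qed.

Lemma ip_cauchy_schwarz p q : normc (ip p q) ^+ 2 <= sqnorm p * sqnorm q.
Proof.
have bp := bmf_poly p; have bq := bmf_poly q.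
have H := RI_cauchy_schwarz mu bp bq.
have ai : 0 <= a^-1 by rewrite invr_ge0 ltW.
rewrite /ip normcZ// exprMn /sqnorm [leRHS]mulrACA -[a^-1 * a^-1]expr2 ler_wpM2l ?sqr_ge0//.
apply: le_trans H; rewrite lerXn2r ?nnegrE ?normc_ge0//.
  by apply: RI_ge0 => x; rewrite mulr_ge0 ?normc_ge0.
apply: CI_norm_dom; [exact: bmc_polyM|by apply: intg_bmf; exact: bmfM|].
by move=> x; rewrite normcM normcJr.
Qed.

(** The extremal property of the kernel: k(z, z) is the squared norm I of k_z, and p = k_z in the
    hypothesis gives I^2 <= G I. *)
Lemma kernel_diag_le z G : 0 <= G ->
  (forall p, (size p <= N.+1)%N ->
     normc p.[z] ^+ 2 <= G * \int[mu]_x normc p.[cval x] ^+ 2) ->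
  (k z).[z] = (Re (k z).[z])%:C /\ 0 <= Re (k z).[z] <= G.
Proof.
move=> G0 H; have [sz Hz] := Hk z.
set I := \int[mu]_x normc (k z).[cval x] ^+ 2.
have E : (k z).[z] = I%:C.
  rewrite -(Hz _ sz) /inner_prod -CI_real; apply: eq_CI => x.
  exact: mulcJ.
have I0 : 0 <= I by apply: RI_ge0 => x; exact: sqr_ge0.
have := H _ sz; rewrite E normc_real (ger0_norm I0) /= I0 -/I => h; split=> //.
have [->//|I1] := eqVneq I 0.
by rewrite -(@ler_pM2r _ I) -?expr2// lt_neqAle eq_sym I1.
Qed.

Variables (z0 : R[i]) (s : R).
Hypothesis s0 : 0 < s.
Hypothesis near_lebesgue : forall (f : T -> R[i]) B, bmc f -> 0 < B ->
  (forall x, normc (f x) <= B * poisson z0 x) ->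
  normc (a^-1%:C * cintegral mu f - cintegral m f) <= 6 * B * s.

Lemma sqnorm_kernel_err_le x G B : 0 <= G -> 0 < B ->
  (forall p, (size p <= N.+1)%N ->
     normc p.[x] ^+ 2 <= G * \int[mu]_y normc p.[cval y] ^+ 2) ->
  (forall xi, normc (k0 x).[cval xi] ^+ 2 <= B * poisson z0 xi) ->
  sqnorm (kernel_err x) <= a * G - \sum_(j < N.+1) normc x ^+ (2 * j) + 6 * B * s.
Proof.
move=> G0 B0 HG HB.
have [kx /andP[kx0 kxG]] := kernel_diag_le G0 HG.
have : Re (kernel_err x).[x] = sqnorm (kernel_err x) - Re (ip_defect (k0 x) (k0 x)).
  by rewrite kernel_errE ip_diag RecD RecN.
rewrite /kernel_err hornerD hornerN hornerZ szego_poly_diag RecD RecN RecZ /= => /eqP.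
rewrite eq_sym subr_eq => /eqP ->.
have h : Re (ip_defect (k0 x) (k0 x)) <= 6 * B * s.
  apply: le_trans (Re_le_normc _) _; apply: near_lebesgue => //.
    exact: bmc_polyM.
  by move=> xi; rewrite normcM normcJr -expr2.
by apply: lerD => //; apply: lerB => //; rewrite ler_pM2l.
Qed.

Lemma kernel_err_le x z bx bz c d : 0 < bx -> 0 < bz -> 0 < c -> 0 <= d ->
  (forall xi, normc (k0 x).[cval xi] ^+ 2 <= c * bx ^+ 2 * poisson z0 xi) ->
  (forall xi, normc (k0 z).[cval xi] ^+ 2 <= c * bz ^+ 2 * poisson z0 xi) ->
  sqnorm (kernel_err x) <= d * bx ^+ 2 -> sqnorm (kernel_err z) <= d * bz ^+ 2 ->
  normc z0 < 1 ->
  normc (kernel_err z).[x] <= (d + 6 * c * s) * (bx * bz).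
Proof.
move=> bx0 bz0 c0 d0 Hx Hz Dx Dz z01.
rewrite kernel_errE; apply: le_trans (normcB_le _ _) _; rewrite mulrDl; apply: lerD.
  have db : 0 <= d * (bx * bz) by rewrite mulr_ge0// mulr_ge0// ltW.
  rewrite -(@ler_pXn2r _ 2) ?nnegrE ?normc_ge0//.
  apply: le_trans (ip_cauchy_schwarz _ _) _.
  have -> : (d * (bx * bz)) ^+ 2 = (d * bz ^+ 2) * (d * bx ^+ 2) by ring.
  by apply: ler_pM => //; exact: sqnorm_ge0.
have -> : 6 * c * s * (bx * bz) = 6 * (c * (bx * bz)) * s by ring.
apply: near_lebesgue.
- exact: bmc_polyM.
- by rewrite !mulr_gt0.
move=> xi; have P0 := poisson_gt0 xi z01.
have cP : 0 <= c * (bx * bz) * poisson z0 xi.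
  by apply/ltW; do 3 (apply: mulr_gt0 => //).
rewrite normcM normcJr -(@ler_pXn2r _ 2) ?nnegrE ?cP ?mulr_ge0 ?normc_ge0//.
rewrite exprMn.
have -> : (c * (bx * bz) * poisson z0 xi) ^+ 2 =
  (c * bz ^+ 2 * poisson z0 xi) * (c * bx ^+ 2 * poisson z0 xi) by ring.
by apply: ler_pM; rewrite ?sqr_ge0.
Qed.
End kernel_error.

(** * The kernel error on the circles of radii 1 - u and 1/(1 - u) *)

Section circles.
Variable R : realType.
Local Notation "z ^*" := (conjc z) : ring_scope.
Local Notation T := (circle R).
Local Notation m := (@circle_lebesgue R).
Implicit Types (z u : R[i]) (p q F : {poly R[i]}) (xi eta : T).

(** |1 - z0 conj(xi)| <= |1 - z conj(xi)| + |z - z0|, and |1 - z conj(xi)| >= 1 - |z| absorbs the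
    last term up to the factor Y. *)
Lemma poisson_dom (z z0 : R[i]) Y xi : normc z < 1 -> normc z0 < 1 -> 0 <= Y ->
  normc (z - z0) <= Y * (1 - normc z) ->
  poisson z xi <= (1 - normc z ^+ 2) / (1 - normc z0 ^+ 2) * (1 + Y) ^+ 2 * poisson z0 xi.
Proof.
move=> z1 z01 Y0 HY; rewrite !poissonE.
have d1 := normc_sq_lt1 z1; have d2 := normc_sq_lt1 z01.
have -> : (1 - normc z ^+ 2) / (1 - normc z0 ^+ 2) * (1 + Y) ^+ 2 *
   ((1 - normc z0 ^+ 2) * normc (cauchy_kernel z0 xi) ^+ 2) =
   (1 - normc z ^+ 2) * ((1 + Y) * normc (cauchy_kernel z0 xi)) ^+ 2.
  by field; exact: lt0r_neq0.
rewrite ler_wpM2l ?(ltW d1)// lerXn2r ?nnegrE ?normc_ge0 ?mulr_ge0 ?normc_ge0 ?addr_ge0//.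
have n1 : 0 < normc (1 - z * (cval xi)^*) by rewrite normc_gt0 cauchy_den_neq0.
have n2 : 0 < normc (1 - z0 * (cval xi)^*) by rewrite normc_gt0 cauchy_den_neq0.
rewrite /cauchy_kernel !normcV ler_pdivlMr// mulrC ler_pdivrMr//.
have h := normc_triangle (1 - z * (cval xi)^*) (1 - z0 * (cval xi)^*) 0.
rewrite !subr0 in h; apply: le_trans h _.
have -> : 1 - z0 * (cval xi)^* - (1 - z * (cval xi)^*) = (z - z0) * (cval xi)^* by ring.
rewrite normcM normcJr normc_cval mulr1 mulrDl mul1r addrC lerD2l.
by apply: le_trans HY _; rewrite ler_wpM2l// cauchy_den_ge.
Qed.

Lemma szego_poly_le n z xi : normc z < 1 ->
  normc (szego_poly n z).[cval xi] ^+ 2 <= 4 / (1 - normc z ^+ 2) * poisson z xi.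
Proof.
move=> z1; have d1 := normc_sq_lt1 z1.
rewrite poissonE -[normc _.[_]]normcJr -szego_poly_cauchy// normcM exprMn [leRHS]mulrA divfK ?lt0r_neq0//.
rewrite ler_wpM2r ?sqr_ge0//; have -> : 4 = 2 ^+ 2 :> R by ring.
rewrite lerXn2r ?nnegrE ?normc_ge0//; apply: le_trans (normcB_le _ _) _.
rewrite normc1 normcM !normcX normcJr normc_cval expr1n mulr1.
rewrite (_ : 2 = 1 + 1)// lerD2l exprn_ile1// ?normc_ge0//; exact: ltW.
Qed.

Lemma szego_poly_outer N z xi : z != 0 ->
  normc (szego_poly N.+1 ((z^*)^-1)).[cval xi] =
  normc z ^- N * normc (szego_poly N.+1 z).[cval xi].
Proof.
move=> z0.
have -> : (szego_poly N.+1 ((z^*)^-1)).[cval xi] =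
    z ^- N * (cval xi ^+ N * ((szego_poly N.+1 z).[cval xi])^*).
  rewrite !horner_szego_poly conjc_sum mulr_sumr mulr_sumr.
  rewrite [RHS](reindex_inj rev_ord_inj) /=; apply: eq_bigr => j _.
  rewrite subSS conjcM !conjcX conjc_inv !conjcK.
  have jN : (j <= N)%N by rewrite -ltnS.
  rewrite -[X in z ^- X](subnK jN) -[X in cval xi ^+ X * _](subnK jN) !exprD invfM.
  have zk : z ^+ (N - j) != 0 by rewrite expf_neq0.
  have zj : z ^+ j != 0 by rewrite expf_neq0.
  have xx : cval xi ^+ (N - j) * (cval xi)^* ^+ (N - j) = 1.
    by rewrite -exprMn cvalJ expr1n.
  rewrite exprVn.
  have -> : (z ^+ (N - j))^-1 / z ^+ j * (cval xi ^+ (N - j) * cval xi ^+ j *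
    (z ^+ (N - j) * (cval xi)^* ^+ (N - j))) = (z ^+ j)^-1 * cval xi ^+ j *
    (cval xi ^+ (N - j) * (cval xi)^* ^+ (N - j)) by field; rewrite zk zj.
  by rewrite xx mulr1.
by rewrite !normcM normcV !normcX normc_cval expr1n mul1r normcJr.
Qed.

Lemma sum_outer N (r : R) : r != 0 ->
  \sum_(j < N.+1) r^-1 ^+ (2 * j) = r ^- (2 * N) * \sum_(j < N.+1) r ^+ (2 * j).
Proof.
move=> r0; rewrite mulr_sumr [RHS](reindex_inj rev_ord_inj) /=; apply: eq_bigr => j _.
have jN : (j <= N)%N by rewrite -ltnS.
rewrite subSS exprVn -[X in r ^- (2 * X)](subnK jN) mulnDr exprD invfM.
by rewrite mulrC mulrA mulfV ?mul1r// expf_neq0.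
Qed.

Variables (mu : probability T R) (v : T -> R).
Hypothesis iv : intg m v.
Hypothesis ie : intg m (fun x => expR (v x)).
Hypothesis domW : forall f, bmf f -> (forall x, 0 <= f x) ->
  \int[m]_x (f x * expR (v x)) <= \int[mu]_x f x.
Variables (N : nat) (k : R[i] -> {poly R[i]}).
Hypothesis Hk : forall z, reproducing_kernel mu N.+1 z (k z).
Variables (u : R) (zeta : T) (s : R).
Hypothesis u0 : 0 < u.
Hypothesis u1 : u <= 10^-1.
Hypothesis un : 1 <= u * N.+1%:R.
Hypothesis s0 : 0 < s.
Hypothesis s1 : s <= 1 / 2.
Local Notation r := (1 - u).
Local Notation n := (N.+1%:R : R).
Definition zbase : R[i] := (1 - u)%:C * cval zeta.
Local Notation a := (pmass mu zbase).
Hypothesis Hs : ln a - plog v zbase <= s ^+ 2.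

(* The points of modulus [1 - u], and (for [o = true]) their reflections in the unit circle. *)
Definition circle_point (o : bool) eta : R[i] :=
  if o then (((1 - u)%:C * cval eta)^*)^-1 else (1 - u)%:C * cval eta.
Definition wdist eta : R := normc (cval eta - cval zeta) / u.
(** With X = [wdist eta] and B = (1 + X)^2, passing from [zbase] to the inner point over eta costs a
    factor B in the Poisson kernel and exp(4 B s) in [neg_plog_le]. The square of the weight is B
    exp(4 B s), times (1 - u)^(-2N) after reflection. *)
Definition weight (o : bool) eta : R :=
  (if o then (1 - u) ^- N else 1) *
  ((1 + wdist eta) * expR (2 * (1 + wdist eta) ^+ 2 * s)).

Lemma r_gt0 : 0 < r. Proof. by move: u1; lra. Qed.
Lemma r_lt1 : r < 1. Proof. by move: u0; lra. Qed.

Lemma normc_inner eta : normc (r%:C * cval eta) = r.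
Proof. by rewrite normcZ ?normc_cval ?mulr1// ltW// r_gt0. Qed.

Lemma wdist_ge0 eta : 0 <= wdist eta.
Proof. by rewrite divr_ge0 ?normc_ge0// ltW. Qed.

Lemma poisson_inner eta xi :
  poisson (r%:C * cval eta) xi <= (1 + wdist eta) ^+ 2 * poisson zbase xi.
Proof.
have nz := normc_inner eta; have nz0 : normc zbase = r by exact: normc_inner.
have r1 := r_lt1.
have := @poisson_dom (r%:C * cval eta) zbase (wdist eta) xi.
rewrite nz nz0 divff ?mul1r; last first.
  by rewrite -nz0 lt0r_neq0// normc_sq_lt1// nz0.
apply => //; first exact: wdist_ge0.
rewrite /zbase -mulrBr normcZ ?(ltW r_gt0)// opprB addrCA subrr addr0.
rewrite /wdist divfK ?lt0r_neq0//.
by rewrite -[leRHS]mul1r ler_wpM2r ?normc_ge0// ltW.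
Qed.

(** [G] is the constant of [point_evaluation] with theta = (1 + X) s, allowed by [entropy_le]. The
    36 is 4 + 8 + 24: the excess of exp(4 B s) over 1 on the Szego sum, the phase term W, and the
    defect of k0. Each is of order n because 1 - r^2 >= u >= 1/n. *)
Lemma inner_bounds eta : let z := r%:C * cval eta in let B := (1 + wdist eta) ^+ 2 in
  exists G : R, [/\ 0 <= G,
   forall p, (size p <= N.+1)%N ->
     normc p.[z] ^+ 2 <= G * \int[mu]_y normc p.[cval y] ^+ 2,
   forall xi, normc (szego_poly N.+1 z).[cval xi] ^+ 2 <= 4 * n * B * poisson zbase xi &
   a * G - \sum_(j < N.+1) normc z ^+ (2 * j) + 6 * (4 * n * B) * s <=
     36 * n * s * (B * expR (4 * B * s))].
Proof.
move=> z B; have nz : normc z = r by exact: normc_inner.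
have r0 := r_gt0; have r1 := r_lt1.
have z1 : normc z < 1 by rewrite nz.
have z01 : normc zbase < 1 by rewrite normc_inner.
have X0 := wdist_ge0 eta.
have B1 : 1 <= B by rewrite /B expr_ge1//; lra.
have PB xi : poisson z xi <= B * poisson zbase xi by exact: poisson_inner.
have n0 : 0 < n by rewrite ltr0n.
have dr : n^-1 <= 1 - r ^+ 2.
  apply: (@le_trans _ _ u).
    by rewrite -[leLHS]mul1r ler_pdivrMr.
  have -> : 1 - r ^+ 2 = u + u * r by ring.
  by rewrite lerDl mulr_ge0// ltW.
have drp : 0 < 1 - r ^+ 2 by apply: lt_le_trans dr; rewrite invr_gt0.
have drV : (1 - r ^+ 2)^-1 <= n.
  by rewrite -[leRHS]invrK lef_pV2 ?posrE ?invr_gt0.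
pose th := (1 + wdist eta) * s.
have th0 : 0 <= th by rewrite mulr_ge0 ?addr_ge0// ltW.
have kth : ln (pmass mu z) - plog v z <= th ^+ 2.
  apply: le_trans (entropy_le iv ie domW z01 z1 PB) _.
  by rewrite /th exprMn ler_wpM2l ?sqr_ge0.
pose S := \sum_(j < N.+1) normc z ^+ (2 * j).
have S0 : 0 <= S by apply: sumr_ge0 => j _; rewrite exprn_ge0 ?normc_ge0.
have Sn : S <= n.
  apply: (@le_trans _ _ (\sum_(j < N.+1) 1)).
    by apply: ler_sum => j _; rewrite exprn_ile1 ?normc_ge0// ltW.
  by rewrite sumr_const card_ord.
pose W := 8 * normc z ^+ N.+1 * th / (1 - normc z ^+ 2).
have W0 : 0 <= W.
  rewrite /W nz; apply: divr_ge0; last exact: ltW.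
  by apply: mulr_ge0 => //; rewrite mulr_ge0 ?exprn_ge0// ltW.
have Wn : W <= 8 * n * (B * s).
  rewrite /W nz; have -> : 8 * n * (B * s) = 8 * (B * s) * n by ring.
  apply: ler_pM => //.
  - by apply: mulr_ge0 => //; rewrite mulr_ge0 ?exprn_ge0// ltW.
  - by rewrite invr_ge0 ltW.
  rewrite -mulrA ler_wpM2l// /th mulrA ler_wpM2r ?(ltW s0)//.
  rewrite /B expr2; apply: ler_wpM2r; first exact: addr_ge0.
  apply: (@le_trans _ _ 1); last by rewrite lerDl.
  by rewrite exprn_ile1// ltW.
exists (expR (- plog v z) * (S + W)); split.
- by rewrite mulr_ge0 ?expR_ge0 ?addr_ge0.
- by move=> p sp; exact: (point_evaluation iv ie domW z1 sp th0 kth).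
- move=> xi; apply: le_trans (szego_poly_le _ _ z1) _.
  rewrite nz -[leRHS]mulrA; apply: ler_pM.
  + by rewrite divr_ge0// ltW.
  + exact/ltW/poisson_gt0.
  + by rewrite ler_wpM2l.
  + exact: PB.
have h1 := neg_plog_le iv ie domW z01 s0 s1 Hs z1 B1 PB.
set e := expR (4 * B * s) in h1 *.
have y0 : 0 <= B * s by rewrite mulr_ge0 ?(ltW s0)//; lra.
have e1 : 1 <= e by rewrite /e -[leLHS]expR0 ler_expR -mulrA mulr_ge0.
have e2 : e - 1 <= 4 * (B * s) * e.
  have := expR_ge1Dx (- (4 * B * s)); rewrite expRN -/e => h.
  have := ler_wpM2r (ltW (expR_gt0 (4 * B * s))) h; rewrite -/e mulVf ?lt0r_neq0 ?expR_gt0//.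
  by rewrite -mulrA; set t := B * s; move: (e) (t) => e' t'; nra.
have h2 : a * (expR (- plog v z) * (S + W)) <= e * (S + W).
  by rewrite mulrA ler_wpM2r ?addr_ge0.
have h3 : e * S - S <= 4 * (B * s) * e * n.
  have -> : e * S - S = (e - 1) * S by ring.
  apply: ler_pM => //; lra.
have h4 : e * W <= e * (8 * n * (B * s)) by rewrite ler_wpM2l//; lra.
have h5 : 24 * n * (B * s) <= 24 * n * (B * s) * e.
  by rewrite ler_peMr//; apply: mulr_ge0.
rewrite -/S.
have -> : 36 * n * s * (B * e) = 4 * (B * s) * e * n + e * (8 * n * (B * s)) + 24 * n * (B * s) * e by ring.
have -> : 6 * (4 * n * B) * s = 24 * n * (B * s) by ring.
rewrite mulrDr in h2.
move: h2 h3 h4 h5; lra.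
Qed.

(** The inner case is [inner_bounds]. Reflection preserves the norm of a polynomial, and it
    multiplies the evaluation constant, |k0|^2 on the circle and the diagonal Szego sum by the same
    factor r^(-2N), so the outer case is the inner one scaled. *)
Lemma point_bounds o eta : let x := circle_point o eta in
  [/\ 0 < weight o eta,
   forall xi, normc (szego_poly N.+1 x).[cval xi] ^+ 2 <= 4 * n * weight o eta ^+ 2 * poisson zbase xi &
   sqnorm mu a (kernel_err N k a x) <= 36 * n * s * weight o eta ^+ 2].
Proof.
have [G [G0 HG Hz Hd]] := inner_bounds eta.
set z := r%:C * cval eta in HG Hz Hd *; set B := (1 + wdist eta) ^+ 2 in Hz Hd *.
have nz : normc z = r by exact: normc_inner.
have r0 := r_gt0; have r1 := r_lt1.
have X0 := wdist_ge0 eta; have z01 : normc zbase < 1 by rewrite normc_inner.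
have a0 : 0 < a by exact: pmass_gt0.
have n0 : 0 < n by rewrite ltr0n.
have B0 : 0 < B by rewrite /B exprn_gt0// ltr_pwDl.
pose e := expR (4 * B * s).
have e1 : 1 <= e.
  by rewrite /e -[leLHS]expR0 ler_expR; apply: mulr_ge0; [apply: mulr_ge0 => //|]; exact: ltW.
have wtE : ((1 + wdist eta) * expR (2 * (1 + wdist eta) ^+ 2 * s)) ^+ 2 = B * e.
  by rewrite exprMn -/B; congr (_ * _); rewrite expr2 -expRD /e; congr expR; ring.
have near f B' : bmc f -> 0 < B' -> (forall x, normc (f x) <= B' * poisson zbase x) ->
    normc (a^-1%:C * cintegral mu f - cintegral m f) <= 6 * B' * s.
  exact: (cmean_close iv ie domW z01 s0 s1 Hs).
have BB : 0 < 4 * n * B by apply: mulr_gt0 => //; exact: mulr_gt0.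
have BeB : B <= B * e by rewrite ler_peMr// ltW.
case: o; rewrite /circle_point /weight -/z /=; last first.
  split.
  - by rewrite mul1r mulr_gt0 ?expR_gt0// ltr_pwDl.
  - move=> xi; apply: le_trans (Hz xi) _; rewrite mul1r wtE.
    rewrite ler_wpM2r ?(ltW (poisson_gt0 _ z01))//.
    by apply: ler_wpM2l => //; apply: mulr_ge0 => //; exact: ltW.
  - apply: le_trans (sqnorm_kernel_err_le Hk a0 near G0 BB HG Hz) _.
    by rewrite mul1r wtE.
have z0 : z != 0 by rewrite -normc_gt0 nz.
have rN0 : 0 < r ^- N by rewrite invr_gt0 exprn_gt0.
have sq : (r ^- N) ^+ 2 = r ^- (2 * N) by rewrite -exprVn -exprM mulnC exprVn.
split.
- by rewrite mulr_gt0// mulr_gt0 ?expR_gt0// ltr_pwDl.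
- move=> xi; rewrite szego_poly_outer// nz [leLHS]exprMn [X in _ <= 4 * n * X * _]exprMn wtE.
  have -> : 4 * n * ((r ^- N) ^+ 2 * (B * e)) * poisson zbase xi =
     (r ^- N) ^+ 2 * (4 * n * (B * e) * poisson zbase xi) by ring.
  rewrite ler_wpM2l ?sqr_ge0//; apply: le_trans (Hz xi) _.
  rewrite ler_wpM2r ?(ltW (poisson_gt0 _ z01))//.
  by apply: ler_wpM2l => //; apply: mulr_ge0 => //; exact: ltW.
have G0' : 0 <= r ^- (2 * N) * G by rewrite mulr_ge0// -sq sqr_ge0.
have BB' : 0 < r ^- (2 * N) * (4 * n * B) by rewrite mulr_gt0// -sq exprn_gt0.
have HG' p : (size p <= N.+1)%N ->
   normc p.[(z^*)^-1] ^+ 2 <= r ^- (2 * N) * G * \int[mu]_y normc p.[cval y] ^+ 2.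
  move=> sp; have := HG _ (size_reflect_poly N p).
  rewrite horner_reflect_poly// normcM normcX normcJr nz exprMn.
  rewrite (@eq_RI _ _ _ _ _ (fun y => normc p.[cval y] ^+ 2)); last first.
    by move=> y; rewrite reflect_poly_circle// normcM normcX normc_cval expr1n mul1r normcJr.
  by rewrite -exprM mulnC -[r ^- _ * _ * _]mulrA ler_pdivlMl// exprn_gt0.
have Hz' xi : normc (szego_poly N.+1 ((z^*)^-1)).[cval xi] ^+ 2 <=
   r ^- (2 * N) * (4 * n * B) * poisson zbase xi.
  by rewrite szego_poly_outer// nz exprMn sq -mulrA ler_wpM2l// -sq sqr_ge0.
apply: le_trans (sqnorm_kernel_err_le Hk a0 near G0' BB' HG' Hz') _.
rewrite normcV normcJr nz sum_outer ?lt0r_neq0// exprMn wtE sq.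
set c := r ^- _; have c0 : 0 <= c by rewrite /c -sq sqr_ge0.
have -> : a * (c * G) - c * (\sum_(j < N.+1) r ^+ (2 * j)) + 6 * (c * (4 * n * B)) * s =
  c * (a * G - (\sum_(j < N.+1) r ^+ (2 * j)) + 6 * (4 * n * B) * s) by ring.
have -> : 36 * n * s * (c * (B * e)) = c * (36 * n * s * (B * e)) by ring.
by rewrite ler_wpM2l//; rewrite nz in Hd.
Qed.

Lemma kernel_err_circles o1 eta1 o2 eta2 :
  normc (kernel_err N k a (circle_point o2 eta2)).[circle_point o1 eta1] <=
  60 * n * s * (weight o1 eta1 * weight o2 eta2).
Proof.
have [w1 H1 D1] := point_bounds o1 eta1; have [w2 H2 D2] := point_bounds o2 eta2.
have z01 : normc zbase < 1 by rewrite normc_inner r_lt1.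
have a0 : 0 < a by exact: pmass_gt0.
have near f B' : bmc f -> 0 < B' -> (forall x, normc (f x) <= B' * poisson zbase x) ->
    normc (a^-1%:C * cintegral mu f - cintegral m f) <= 6 * B' * s.
  exact: (cmean_close iv ie domW z01 s0 s1 Hs).
have n0 : 0 < n by rewrite ltr0n.
(* The 36 is the squared norm of the error; 6 * 4 is [near_lebesgue] applied to the product of two
   Szego sums. *)
have -> : 60 * n * s = 36 * n * s + 6 * (4 * n) * s by ring.
apply: (kernel_err_le Hk a0 near w1 w2 _ _ H1 H2 D1 D2 z01).
- by rewrite mulr_gt0.
- by rewrite !mulr_ge0// ltW.
Qed.
End circles.

(** * Maximum principles for polynomials *)

Section maximum_principle.
Variable R : realType.
Local Notation T := (circle R).
Local Notation m := (@circle_lebesgue R).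
Implicit Types (x z c : R[i]) (G H : {poly R[i]}) (xi eta : T).

Lemma bernoulli_inequality (d : R) k : 0 <= d -> 1 + k%:R * d <= (1 + d) ^+ k.
Proof.
move=> d0; elim: k => [|k IH]; first by rewrite mul0r addr0 expr0.
have d1 : 0 <= 1 + d by rewrite addr_ge0.
rewrite exprS; apply: le_trans (ler_wpM2l d1 IH).
have kd : 0 <= k%:R * d * d by rewrite !mulr_ge0.
have -> : (1 + d) * (1 + k%:R * d) = 1 + (k%:R + 1) * d + k%:R * d * d by ring.
by rewrite natr1 lerDl.
Qed.

(* By Bernoulli, a polynomial factor in [k] does not survive [k]-th roots. *)
Lemma le_of_powers (a b : R) D : 0 <= b ->
  (forall k, a ^+ k <= (k * D).+1%:R * b ^+ k) -> a <= b.
Proof.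
move=> b0 H; rewrite leNgt; apply/negP => ba.
have a0 : 0 < a by exact: le_lt_trans ba.
have [b00|b1] := eqVneq b 0.
  by have := H 1%N; rewrite b00 !expr1 mulr0 leNgt a0.
have bp : 0 < b by rewrite lt_neqAle eq_sym b1.
pose d := a / b - 1.
have d0 : 0 < d by rewrite subr_gt0 ltr_pdivlMr// mul1r.
have ab : a / b = 1 + d by rewrite /d addrC subrK.
have [k Hk] := natr_above (2 * D%:R / d ^+ 2).
set K := k.+1 in Hk.
have := H (2 * K)%N.
rewrite -ler_pdivrMr ?exprn_gt0// -expr_div_n ab mulnC exprM => h.
have B := bernoulli_inequality K (ltW d0).
have B2 : (1 + K%:R * d) ^+ 2 <= ((1 + d) ^+ K) ^+ 2.
  have d0' := ltW d0; apply: lerXn2r => //; rewrite nnegrE.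
    by rewrite addr_ge0 ?mulr_ge0.
  by apply: exprn_ge0; apply: addr_ge0.
have := le_trans B2 h; apply/negP; rewrite -ltNge.
rewrite ler_pdivrMr ?exprn_gt0// in Hk.
have K0 : 0 < K%:R :> R by rewrite ltr0n.
have e : (K * 2 * D).+1%:R = 1 + K%:R * (2 * D%:R) :> R.
  by rewrite -natr1 !natrM addrC mulrA.
rewrite e.
have -> : (1 + K%:R * d) ^+ 2 = 1 + K%:R * (K%:R * d ^+ 2) + 2 * (K%:R * d) by ring.
have h3 := ler_wpM2l (ltW K0) Hk.
have h4 : 0 < K%:R * d by rewrite mulr_gt0.
lra.
Qed.

(* Cauchy estimates for all powers [G ^+ k] give the maximum principle without loss in the degree. *)
Lemma horner_le_of_powers G x b : 0 <= b ->
  (forall k j, normc (G ^+ k)`_j * normc x ^+ j <= b ^+ k) -> normc G.[x] <= b.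
Proof.
move=> b0 H; apply: (@le_of_powers _ _ (size G).-1) => // k.
rewrite -normcX -horner_exp.
have sz : (size (G ^+ k) <= (k * (size G).-1).+1)%N.
  by rewrite mulnC; exact: size_poly_exp_leq.
rewrite (horner_coef_wide _ sz); apply: le_trans (normc_sum _ _ _) _.
apply: (@le_trans _ _ (\sum_(i < (k * (size G).-1).+1) b ^+ k)).
  by apply: ler_sum => i _; rewrite normcM normcX.
by rewrite sumr_const card_ord mulr_natl.
Qed.

Lemma coef_circle_le G (r M : R) : 0 <= r ->
  (forall xi, normc G.[r%:C * cval xi] <= M) -> forall j, normc G`_j * r ^+ j <= M.
Proof.
move=> r0 HG j; pose F := G \Po (r%:C *: 'X).
have FE xi : F.[cval xi] = G.[r%:C * cval xi].
  by rewrite horner_comp hornerZ hornerX.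
have Fj : F`_j = G`_j * r%:C ^+ j.
  rewrite /F comp_polyE coef_sum.
  rewrite (eq_bigr (fun i : 'I_(size G) => G`_i * (r%:C ^+ i * (i == j :> nat)%:R))); last first.
    by move=> i _; rewrite coefZ exprZn coefZ coefXn eq_sym.
  have [sj|sj] := ltnP j (size G).
    rewrite (bigD1 (Ordinal sj))//= eqxx mulr1 big1 ?addr0// => i ij.
    by rewrite (_ : (i : nat) == j = false) ?mulr0 ?mulr0//; apply/negbTE.
  rewrite nth_default// mul0r big1// => i _.
  by rewrite (_ : (i : nat) == j = false) ?mulr0 ?mulr0// ltn_eqF// (leq_trans (ltn_ord i)).
have -> : normc G`_j * r ^+ j = normc F`_j.
  by rewrite Fj normcM normcX normc_real ger0_norm.
rewrite -CI_polyJ -[leRHS](RI_cst m); apply: CI_norm_dom.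
- by apply: bmcM; [exact: bmc_poly|apply: bmcJ; exact: bmcX (@bmc_cval R)].
- exact: intg_cst.
by move=> xi; rewrite normcM normcJr normcX normc_cval expr1n mulr1 FE.
Qed.

Lemma max_disc G (r M : R) x : 0 <= M -> 0 <= r ->
  (forall xi, normc G.[r%:C * cval xi] <= M) -> normc x <= r -> normc G.[x] <= M.
Proof.
move=> M0 r0 HG xr; apply: horner_le_of_powers => // k j.
apply: (@le_trans _ _ (normc (G ^+ k)`_j * r ^+ j)).
  by rewrite ler_wpM2l ?normc_ge0// lerXn2r ?nnegrE ?normc_ge0.
apply: coef_circle_le => // xi.
by rewrite horner_exp normcX lerXn2r ?nnegrE ?normc_ge0.
Qed.

(** The k-th power of G / x^J has Laurent coefficients of index j - J k; Cauchy's estimate is taken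
    on the inner circle when the index is at most 0 and on the outer circle otherwise. *)
Lemma max_annulus G (r1 r2 M : R) J x : 0 <= M -> 0 < r1 -> r1 <= normc x -> normc x <= r2 ->
  (forall xi, normc G.[r1%:C * cval xi] <= M * r1 ^+ J) ->
  (forall xi, normc G.[r2%:C * cval xi] <= M * r2 ^+ J) ->
  normc G.[x] <= M * normc x ^+ J.
Proof.
move=> M0 r10 x1 x2 H1 H2.
have x0 : 0 < normc x by exact: lt_le_trans x1.
have r20 : 0 < r2 by exact: lt_le_trans x2.
apply: horner_le_of_powers => [|k j]; first by rewrite mulr_ge0 ?exprn_ge0 ?normc_ge0.
have pw (r : R) : 0 < r -> (forall xi, normc G.[r%:C * cval xi] <= M * r ^+ J) ->
    normc (G ^+ k)`_j * r ^+ j <= M ^+ k * r ^+ (J * k).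
  move=> r0 H; apply: coef_circle_le; first exact: ltW.
  move=> xi; rewrite horner_exp normcX exprM -exprMn lerXn2r ?nnegrE ?normc_ge0//.
  by rewrite mulr_ge0// exprn_ge0// ltW.
rewrite exprMn -exprM.
have c0 := normc_ge0 (G ^+ k)`_j.
have [jJ|Jj] := leqP j (J * k).
  have sp (y : R) : y ^+ (J * k) = y ^+ (J * k - j) * y ^+ j.
    by rewrite -exprD subnK.
  have h' : normc (G ^+ k)`_j <= M ^+ k * r1 ^+ (J * k - j).
    move: (pw _ r10 H1); rewrite (sp r1) [leRHS]mulrA.
    by rewrite ler_pM2r ?exprn_gt0.
  rewrite (sp (normc x)) [leRHS]mulrA ler_pM2r ?exprn_gt0//.
  apply: le_trans h' _.
  by rewrite ler_wpM2l ?exprn_ge0// lerXn2r ?nnegrE ?(ltW r10) ?(ltW x0).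
have sp (y : R) : y ^+ j = y ^+ (j - J * k) * y ^+ (J * k).
  by rewrite -exprD subnK// ltnW.
have h' : normc (G ^+ k)`_j * r2 ^+ (j - J * k) <= M ^+ k.
  by move: (pw _ r20 H2); rewrite (sp r2) mulrA ler_pM2r ?exprn_gt0.
rewrite (sp (normc x)) mulrA ler_pM2r ?exprn_gt0//.
apply: le_trans h'; rewrite ler_wpM2l//.
by rewrite lerXn2r ?nnegrE ?(ltW r20) ?(ltW x0).
Qed.

Lemma schwarz_poly G c (r Q : R) x : 0 < r -> 0 <= Q -> G.[c] = 0 ->
  (forall xi, normc G.[c + r%:C * cval xi] <= Q) -> normc (x - c) <= r ->
  normc G.[x] <= Q * (normc (x - c) / r).
Proof.
move=> r0 Q0 Gc HG xr; have [H GH] := horner_sub_root G c.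
pose F := H \Po (c%:P + 'X).
have FE y : F.[y] = H.[c + y] by rewrite horner_comp hornerD hornerC hornerX.
have HF xi : normc F.[r%:C * cval xi] <= Q / r.
  rewrite ler_pdivlMr//; apply: le_trans (HG xi).
  rewrite GH Gc add0r addrAC subrr add0r -FE [leRHS]normcM normcZ ?(ltW r0)//.
  by rewrite normc_cval mulr1 mulrC.
have h : normc F.[x - c] <= Q / r.
  by apply: max_disc HF xr => //; [rewrite divr_ge0// ltW|exact: ltW].
rewrite GH Gc add0r normcM; move: h; rewrite FE addrCA subrr addr0 => h.
have -> : Q * (normc (x - c) / r) = normc (x - c) * (Q / r) by rewrite mulrCA.
by rewrite ler_wpM2l ?normc_ge0.
Qed.
End maximum_principle.

(** * From the circles to the ball *)

Section ball.
Variable R : realType.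
Local Notation "z ^*" := (conjc z) : ring_scope.
Local Notation T := (circle R).
Local Notation m := (@circle_lebesgue R).
Implicit Types (z c : R[i]) (p q F : {poly R[i]}) (xi eta : T).
Local Notation Re := (@complex.Re R).

Variables (u : R) (zeta : T).
Hypothesis u0 : 0 < u.
Hypothesis u1 : u <= 10^-1.
Local Notation r := (1 - u).

(* The modulus of [((1 + z zeta^* ) ^+ 2 / (4 z zeta^* )) ^+ J]: with [J] of order [u ^- 2] it decays like a
   Gaussian of width [u] along the circles of radii [1 - u] and [(1 - u)^-1], and is bounded below near [zeta]. *)
Definition multiplier J z : R := (normc (1 + z * (cval zeta)^*) ^+ 2 / (4 * normc z)) ^+ J.

Lemma normc_scale (rho : R) eta : 0 < rho -> normc (rho%:C * cval eta) = rho.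
Proof. by move=> r0; rewrite normcZ ?normc_cval ?mulr1// ltW. Qed.

Lemma multiplier_circle J (rho : R) eta : 0 < rho ->
  multiplier J (rho%:C * cval eta) =
  (1 + (1 - rho) ^+ 2 / (4 * rho) - normc (cval eta - cval zeta) ^+ 2 / 4) ^+ J.
Proof.
move=> r0; rewrite /multiplier normc_scale//; congr (_ ^+ J).
have h1 : normc (cval eta) ^+ 2 = 1 by rewrite normc_cval expr1n.
have h2 : normc (cval zeta) ^+ 2 = 1 by rewrite normc_cval expr1n.
have -> : normc (1 + rho%:C * cval eta * (cval zeta)^*) ^+ 2 =
   1 + rho ^+ 2 + 2 * rho * Re (cval eta * (cval zeta)^*).
  have sq1 (y : R[i]) : normc (1 + y) ^+ 2 = 1 + 2 * Re y + normc y ^+ 2.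
    rewrite !normc_sq RecD ImcD Rec1 /=; ring.
  rewrite -mulrA sq1 RecZ normcZ ?(ltW r0)// normcM normcJr !normc_cval; ring.
rewrite normc_sqB h1 h2.
have -> : Re ((cval eta)^* * cval zeta) = Re (cval eta * (cval zeta)^*).
  by rewrite -RecJ conjcM conjcK.
by field; exact: lt0r_neq0.
Qed.

(** (1 - rho)^2 / rho is invariant under rho -> 1/rho, so both circles give the same value. J u^2 >=
    4 yields the Gaussian exp(- X^2), while J u^2 <= 5 and u <= 1/10 keep J u^2/(4r) below 3/2. *)
Lemma multiplier_inner_outer J eta (rho : R) : rho = r \/ rho = r^-1 -> (J%:R * u ^+ 2 <= 5) -> 4 <= J%:R * u ^+ 2 ->
  multiplier J (rho%:C * cval eta) <= expR (3 / 2 - (normc (cval eta - cval zeta) / u) ^+ 2).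
Proof.
have r0 : 0 < r by move: u1; lra.
move=> rhoE J5 J4.
have rho0 : 0 < rho by case: rhoE => ->; rewrite ?invr_gt0.
have -> : multiplier J (rho%:C * cval eta) = (1 + u ^+ 2 / (4 * r) - normc (cval eta - cval zeta) ^+ 2 / 4) ^+ J.
  rewrite multiplier_circle//; congr ((1 + _ - _) ^+ J); case: rhoE => ->.
    by congr (_ / _); ring.
  by field; exact: lt0r_neq0.
set X := normc _ / u.
have -> : normc (cval eta - cval zeta) ^+ 2 = u ^+ 2 * X ^+ 2.
  by rewrite -exprMn /X mulrC divfK// lt0r_neq0.
set y := u ^+ 2 / (4 * r) - u ^+ 2 * X ^+ 2 / 4.
have -> : 1 + u ^+ 2 / (4 * r) - u ^+ 2 * X ^+ 2 / 4 = 1 + y by rewrite /y; ring.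
have b0 : 0 <= 1 + y.
  have -> : 1 + y = normc (1 + rho%:C * cval eta * (cval zeta)^*) ^+ 2 / (4 * normc (rho%:C * cval eta)).
    have := @multiplier_circle 1 rho eta rho0; rewrite /multiplier !expr1 => ->.
    rewrite /y /X addrA; congr (1 + _ - _).
      by case: rhoE => ->; [congr (_ / _); ring|field; exact: lt0r_neq0].
    by rewrite exprMn; field; exact: lt0r_neq0.
  by rewrite divr_ge0 ?sqr_ge0 ?mulr_ge0 ?normc_ge0.
apply: (@le_trans _ _ (expR y ^+ J)).
  by rewrite lerXn2r ?nnegrE ?expR_ge0 ?expR_ge1Dx.
rewrite -expRM_natr ler_expR.
have -> : y * J%:R = (J%:R * u ^+ 2) / (4 * r) - (J%:R * u ^+ 2) * X ^+ 2 / 4.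
  by rewrite /y; field; exact: lt0r_neq0.
apply: lerB.
  rewrite ler_pdivrMr ?mulr_gt0//; apply: le_trans J5 _; move: u1; lra.
have X20 : 0 <= X ^+ 2 by exact: sqr_ge0.
rewrite ler_pdivlMr// mulrC; exact: ler_wpM2r.
Qed.

(** From (1 + w)^2 = 4 w + (w - 1)^2 and |w - 1| <= u, the base of the power is at least 1 -
    u^2/(4r). Its J-th power loses at most exp(- J u^2/(2r)), and 5/(2 * 0.9) < 3. *)
Lemma multiplier_ball J (x : R[i]) : normc (x - cval zeta) <= u -> J%:R * u ^+ 2 <= 5 ->
  expR (- 3) <= multiplier J x.
Proof.
move=> xu J5; pose w := x * (cval zeta)^*.
have wx : normc (w - 1) <= u.
  have -> : w - 1 = (x - cval zeta) * (cval zeta)^* by rewrite mulrBl cvalJ.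
  by rewrite normcM normcJr normc_cval mulr1.
have nw : normc w = normc x by rewrite normcM normcJr normc_cval mulr1.
have w1 : 1 - u <= normc w.
  have := normcB_ge 1 w; rewrite normc1 normcBC; move: wx; lra.
have w0 : 0 < normc w by move: u1 w1; lra.
have h : 4 * normc w - u ^+ 2 <= normc (1 + w) ^+ 2.
  have e : (1 + w) ^+ 2 = 4%:R * w - - (w - 1) ^+ 2 by ring.
  rewrite -normcX e; apply: le_trans (normcB_ge _ _).
  have n4 : normc (4%:R * w) = 4 * normc w by rewrite natC normcZ.
  rewrite n4 normcNr normcX lerD2l lerN2.
  by rewrite lerXn2r ?nnegrE ?normc_ge0 ?(ltW u0).
pose y := u ^+ 2 / (4 * r).
have r0 : 0 < r by move: u1; lra.
have y0 : 0 <= y by rewrite divr_ge0 ?sqr_ge0// mulr_ge0// ltW.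
have y12 : y <= 1 / 2.
  rewrite ler_pdivrMr ?mulr_gt0// expr2; move: u0 u1; nra.
have y1 : 1 - y <= normc (1 + w) ^+ 2 / (4 * normc w).
  rewrite ler_pdivlMr ?mulr_gt0//; apply: le_trans h.
  have -> : (1 - y) * (4 * normc w) = 4 * normc w - y * (4 * normc w) by ring.
  rewrite lerD2l lerN2 /y mulrAC ler_pdivlMr ?mulr_gt0//.
  by rewrite ler_wpM2l ?sqr_ge0// ler_wpM2l.
have ey : expR (- (2 * y)) <= 1 - y.
  apply: le_trans (@expR_le_oneDx R (- y) _); last by lra.
  by rewrite ler_expR sqrrN expr2; move: y0 y12; nra.
rewrite /multiplier -nw.
apply: (@le_trans _ _ (expR (- (2 * y)) ^+ J)); last first.
  rewrite lerXn2r ?nnegrE ?expR_ge0 ?divr_ge0 ?sqr_ge0 ?mulr_ge0 ?normc_ge0//.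
  exact: le_trans ey y1.
rewrite -expRM_natr ler_expR.
have -> : - (2 * y) * J%:R = - ((J%:R * u ^+ 2) / (2 * r)).
  by rewrite /y; field; exact: lt0r_neq0.
rewrite lerN2 ler_pdivrMr ?mulr_gt0//; apply: le_trans J5 _; move: u1; lra.
Qed.

Lemma multiplier_center J : multiplier J (cval zeta) = 1.
Proof.
have := @multiplier_circle J 1 zeta ltr01; rewrite rmorph1 mul1r => ->.
by rewrite !subrr normc_zero expr0n /= !mul0r addr0 subr0 expr1n.
Qed.

Lemma exists_multiplier_exponent : exists J : nat, 4 <= J%:R * u ^+ 2 /\ J%:R * u ^+ 2 <= 5.
Proof.
have u2 : 0 < u ^+ 2 by rewrite exprn_gt0.
have u21 : u ^+ 2 <= 1.
  by rewrite exprn_ile1// ?(ltW u0)//; move: u1; lra.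
exists (Num.truncn (4 / u ^+ 2)).+1; split.
  by rewrite -ler_pdivrMr// ltW// truncnS_gt.
rewrite -natr1 mulrDl mul1r.
have h : (Num.truncn (4 / u ^+ 2))%:R * u ^+ 2 <= 4.
  by rewrite -ler_pdivlMr// truncn_le// divr_ge0// ltW.
lra.
Qed.

Variables (mu : probability T R) (v : T -> R).
Hypothesis iv : intg m v.
Hypothesis ie : intg m (fun x => expR (v x)).
Hypothesis domW : forall f, bmf f -> (forall x, 0 <= f x) ->
  \int[m]_x (f x * expR (v x)) <= \int[mu]_x f x.
Variables (N : nat) (k : R[i] -> {poly R[i]}).
Hypothesis Hk : forall z, reproducing_kernel mu N.+1 z (k z).
Hypothesis un : 1 <= u * N.+1%:R.
Variable s : R.
Hypothesis s0 : 0 < s.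
Hypothesis s8 : s <= 1 / 8.
Local Notation n := (N.+1%:R : R).
Local Notation zb := (zbase u zeta).
Local Notation a := (pmass mu zb).
Hypothesis Hs : ln a - plog v zb <= s ^+ 2.

Local Notation h := (N.+1./2).

Lemma circle_pointE o eta : circle_point u o eta = (if o then r^-1 else r)%:C * cval eta.
Proof.
have r0 : 0 < r by move: u1; lra.
case: o => //=; rewrite /circle_point conjcM conjc_real invfM -cvalV invrK.
by rewrite fmorphV.
Qed.

(** With s <= 1/8 the weight grows at most like exp(X + (1 + X)^2/4) <= exp(1 + X^2), the last step
    being (X - 1)^2 >= 0, and the Gaussian cancels X^2. The factor r^(-h) |x|^h is 1 on the inner
    circle and r^(-2h) >= r^(-N) on the outer one; near the unit circle it is about the square root
    of the latter. *)
Lemma weight_multiplier J o eta : J%:R * u ^+ 2 <= 5 -> 4 <= J%:R * u ^+ 2 ->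
  weight N u zeta s o eta * multiplier J (circle_point u o eta) <=
  expR 3 * r ^- h * normc (circle_point u o eta) ^+ h.
Proof.
move=> J5 J4; have r0 : 0 < r by move: u1; lra.
have X0 := wdist_ge0 zeta u0 eta.
set X := wdist u zeta eta in X0.
have hm : multiplier J (circle_point u o eta) <= expR (3 / 2 - X ^+ 2).
  by rewrite circle_pointE; apply: multiplier_inner_outer => //; case: o; [right|left].
have m0 : 0 <= multiplier J (circle_point u o eta).
  by rewrite exprn_ge0// divr_ge0 ?sqr_ge0 ?mulr_ge0 ?normc_ge0.
have hw : (1 + X) * expR (2 * (1 + X) ^+ 2 * s) <= expR (1 + X ^+ 2).
  apply: (@le_trans _ _ (expR X * expR (2 * (1 + X) ^+ 2 * s))).
    by rewrite ler_wpM2r ?expR_ge0 ?expR_ge1Dx.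
  rewrite -expRD ler_expR.
  have h1 : 2 * (1 + X) ^+ 2 * s <= 2 * (1 + X) ^+ 2 * (1 / 8).
    by rewrite ler_wpM2l// mulr_ge0// sqr_ge0.
  have h2 : 0 <= (X - 1) ^+ 2 by exact: sqr_ge0.
  move: h1 h2; rewrite !sqrrD sqrrN expr1n; lra.
have key : (1 + X) * expR (2 * (1 + X) ^+ 2 * s) * multiplier J (circle_point u o eta) <= expR 3.
  apply: (@le_trans _ _ (expR (1 + X ^+ 2) * expR (3 / 2 - X ^+ 2))).
    by apply: ler_pM => //; rewrite mulr_ge0 ?expR_ge0 ?addr_ge0.
  by rewrite -expRD ler_expR; lra.
rewrite /weight -/X; set W := (1 + X) * _ in key *.
have W0 : 0 <= W by rewrite mulr_ge0 ?expR_ge0 ?addr_ge0.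
rewrite -[leLHS]mulrA -[leRHS]mulrA [leRHS]mulrC; apply: ler_pM => //.
- by case: o {hm m0 key} => //=; rewrite invr_ge0 exprn_ge0// ltW.
- exact: mulr_ge0.
have r1 : r <= 1 by move: u0; lra.
rewrite circle_pointE; case: o {hm m0 key} => /=.
  rewrite normc_scale ?invr_gt0// exprVn -invfM -exprD lef_pV2 ?posrE ?exprn_gt0//.
  apply: ler_wiXn2l => //; first exact: ltW.
  have e := odd_double_half N.+1; rewrite addnn -ltnS -[leqLHS]e -[leqRHS]add1n leq_add2r.
  exact: leq_b1.
by rewrite normc_scale// mulVf// expf_neq0// lt0r_neq0.
Qed.

Lemma kernel_err_annulus_aux J z M : J%:R * u ^+ 2 <= 5 -> 4 <= J%:R * u ^+ 2 -> 0 <= M ->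
  (forall o eta, normc (kernel_err N k a z).[circle_point u o eta] <= M * weight N u zeta s o eta) ->
  forall x, r <= normc x -> normc x <= r^-1 ->
  normc (kernel_err N k a z).[x] * multiplier J x <= M * (expR 3 * r ^- h) * normc x ^+ h.
Proof.
move=> J5 J4 M0 H x x1 x2; have r0 : 0 < r by move: u1; lra.
have xp : 0 < normc x by exact: lt_le_trans x1.
(* Only the numerator of the multiplier is the modulus of a polynomial. Its denominator 4^J |x|^J
   goes to the other side, whence the exponent J + h in [max_annulus]. *)
pose G := kernel_err N k a z * (1 + (cval zeta)^* *: 'X) ^+ (2 * J).
have GE (y : R[i]) : 0 < normc y ->
   normc G.[y] = normc (kernel_err N k a z).[y] * multiplier J y * (4 ^+ J * normc y ^+ J).
  move=> yp; rewrite /G hornerM horner_exp [(1 + _).[_]]hornerD hornerC [(_ *: 'X).[_]]hornerZ hornerX.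
  rewrite normcM normcX exprM /multiplier -mulrA; congr (_ * _).
  rewrite -!exprMn; congr (_ ^+ J); rewrite [(cval zeta)^* * y]mulrC divfK//.
  by rewrite mulf_neq0// lt0r_neq0.
have b0 : 0 <= M * (expR 3 * r ^- h) * 4 ^+ J.
  by rewrite mulr_ge0 ?exprn_ge0// mulr_ge0// mulr_ge0 ?expR_ge0// invr_ge0 exprn_ge0// ltW.
have HG o xi : normc G.[(if o then r^-1 else r)%:C * cval xi] <=
    M * (expR 3 * r ^- h) * 4 ^+ J * (if o then r^-1 else r) ^+ (J + h).
  have rp : 0 < (if o then r^-1 else r) by case: o; rewrite ?invr_gt0.
  rewrite GE normc_scale// -circle_pointE.
  have m0 : 0 <= multiplier J (circle_point u o xi).
    by rewrite exprn_ge0// divr_ge0 ?sqr_ge0 ?mulr_ge0 ?normc_ge0.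
  have h1 := ler_wpM2r m0 (H o xi); rewrite -mulrA in h1.
  have h2 := ler_wpM2l M0 (weight_multiplier o xi J5 J4).
  have := le_trans h1 h2; rewrite [X in normc X ^+ _]circle_pointE normc_scale// => h3.
  set q := (if o then _ else _) in h3 *.
  have -> : M * (expR 3 * r ^- h) * 4 ^+ J * q ^+ (J + h) =
     M * (expR 3 * r ^- h * q ^+ h) * (4 ^+ J * q ^+ J) by rewrite exprD; ring.
  by rewrite ler_wpM2r// mulr_ge0 ?exprn_ge0// ltW.
have := max_annulus b0 r0 x1 x2 (HG false) (HG true).
rewrite GE// exprD.
have -> : M * (expR 3 * r ^- h) * 4 ^+ J * (normc x ^+ J * normc x ^+ h) =
   M * (expR 3 * r ^- h) * normc x ^+ h * (4 ^+ J * normc x ^+ J) by ring.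
by rewrite ler_pM2r// mulr_gt0 ?exprn_gt0.
Qed.

(** One variable at a time: x moves into the annulus while z stays on a circle; Hermitian symmetry
    of E then exchanges the roles, and z moves with x fixed. *)
Lemma kernel_err_annulus J : J%:R * u ^+ 2 <= 5 -> 4 <= J%:R * u ^+ 2 ->
  forall x z, r <= normc x -> normc x <= r^-1 -> r <= normc z -> normc z <= r^-1 ->
  0 < multiplier J x -> 0 < multiplier J z ->
  normc (kernel_err N k a z).[x] * (multiplier J x * multiplier J z) <=
  60 * n * s * (expR 6 * r ^- (2 * h)) * (normc x ^+ h * normc z ^+ h).
Proof.
move=> J5 J4 x z x1 x2 z1 z2 mx mz; have r0 : 0 < r by move: u1; lra.
have s12 : s <= 1 / 2 by move: s8; lra.
have C0 : 0 <= 60 * n * s by rewrite !mulr_ge0// ltW.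
have e0 : 0 <= expR 3 * r ^- h by rewrite mulr_ge0 ?expR_ge0// invr_ge0 exprn_ge0// ltW.
have w0 o eta : 0 <= weight N u zeta s o eta.
  by have [/ltW] := point_bounds iv ie domW Hk u0 u1 un s0 s12 Hs o eta.
have step1 o eta : normc (kernel_err N k a (circle_point u o eta)).[x] * multiplier J x <=
   60 * n * s * weight N u zeta s o eta * (expR 3 * r ^- h) * normc x ^+ h.
  apply: kernel_err_annulus_aux => //; first exact: mulr_ge0.
  move=> o' eta'; have -> : 60 * n * s * weight N u zeta s o eta * weight N u zeta s o' eta' =
    60 * n * s * (weight N u zeta s o' eta' * weight N u zeta s o eta) by ring.
  exact: (kernel_err_circles iv ie domW Hk u0 u1 un s0 s12 Hs).
pose M := 60 * n * s * (expR 3 * r ^- h) * normc x ^+ h / multiplier J x.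
have M0 : 0 <= M.
  by rewrite divr_ge0 ?(ltW mx)// mulr_ge0 ?exprn_ge0 ?normc_ge0// mulr_ge0.
have step2 o eta : normc (kernel_err N k a x).[circle_point u o eta] <= M * weight N u zeta s o eta.
  rewrite (kernel_err_sym a Hk) normcJr /M mulrAC ler_pdivlMr//.
  by apply: le_trans (step1 o eta) _; rewrite le_eqVlt; apply/orP; left; apply/eqP; ring.
have := kernel_err_annulus_aux J5 J4 M0 step2 z1 z2.
rewrite (kernel_err_sym a Hk) normcJr => H.
rewrite [multiplier J x * _]mulrC [leLHS]mulrA.
apply: le_trans (ler_wpM2r (ltW mx) H) _.
have -> : expR 6 = expR 3 * expR 3 :> R by rewrite -expRD; congr expR; ring.
have -> : r ^- (2 * h) = r ^- h * r ^- h by rewrite mulnC exprM expr2 invfM.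
rewrite le_eqVlt; apply/orP; left; apply/eqP; rewrite /M; field.
by rewrite expf_neq0 ?lt0r_neq0.
Qed.
End ball.

(** * The logarithm of the density *)

Section density.
Context d (T : measurableType d) (R : realType).
Local Open Scope ereal_scope.
Import HBNNSimple.

(** The hypothesis is the case of indicators; simple functions follow by linearity, and [f] by
    monotone convergence. *)
Lemma integral_density_le (nu mu : {measure set T -> \bar R}) (g : T -> R) (f : T -> R) :
  measurable_fun setT g -> (forall x, (0 <= g x)%R) ->
  measurable_fun setT f -> (forall x, (0 <= f x)%R) ->
  (forall E, measurable E -> \int[nu]_(x in E) (g x)%:E <= mu E) ->
  \int[nu]_x (f x * g x)%:E <= \int[mu]_x (f x)%:E.
Proof.
move=> mg g0 mf f0 H.
have mEf : measurable_fun setT (EFin \o f) by exact/measurable_EFinP.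
have mEg : measurable_fun setT (EFin \o g) by exact/measurable_EFinP.
pose h := nnsfun_approx measurableT mEf.
have hf n x : (h n x)%:E <= (f x)%:E.
  by rewrite /h nnsfun_approxE; apply: le_approx => //= y _; rewrite lee_fin.
have hcvg x : (EFin \o h n) x @[n --> \oo] --> (f x)%:E.
  by apply: (@cvg_nnsfun_approx _ _ _ _ measurableT _ mEf) => //= y _; rewrite lee_fin.
have mhg n : measurable_fun setT (fun x => (h n x)%:E * (g x)%:E).
  apply: emeasurable_funM => //; apply/measurable_EFinP.
  exact: measurable_funP.
have -> : \int[nu]_x (f x * g x)%:E =
    lim (\int[nu]_x ((h n x)%:E * (g x)%:E) @[n --> \oo]).
  rewrite -monotone_convergence//.
  - apply: eq_integral => x _; apply/esym/cvg_lim => //.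
    by rewrite EFinM; apply: cvgeZr => //; exact: hcvg.
  - by move=> n x _; rewrite -EFinM lee_fin mulr_ge0.
  - move=> x _ i j ij; rewrite -!EFinM lee_fin ler_wpM2r//.
    exact/lefP/nd_nnsfun_approx.
apply: lime_le.
  apply: ereal_nondecreasing_is_cvgn => i j ij; apply: ge0_le_integral => //.
  - by move=> x _; rewrite -EFinM lee_fin mulr_ge0.
  - move=> x _; rewrite -!EFinM lee_fin ler_wpM2r//.
    exact/lefP/nd_nnsfun_approx.
near=> n.
apply: (@le_trans _ _ (\int[mu]_x (h n x)%:E)); last first.
  apply: ge0_le_integral => //.
  - by move=> x _; rewrite lee_fin.
  - by apply/measurable_EFinP; exact: measurable_funP.
rewrite integralT_nnsfun sintegralE.
have nn y x : 0 <= (y * \1_(h n @^-1` [set y]) x)%:E.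
  by rewrite EFinM; exact: nnfun_muleindic_ge0.
have mi r : measurable_fun setT (fun x => (r * \1_(h n @^-1` [set r]) x)%:E).
  by apply: (measurable_comp measurableT) => //; exact: measurable_funM.
rewrite (eq_integral (fun x => \sum_(y \in range (h n)) ((y * \1_(h n @^-1` [set y]) x)%:E * (g x)%:E))); last first.
  move=> x _; rewrite -ge0_mule_fsuml => [|y]; last exact: nn.
  by rewrite fsumEFin // -(fimfunE _ x).
rewrite ge0_integral_fsum//; last 2 first.
  - by move=> y; exact: emeasurable_funM.
  - by move=> y x _; apply: mule_ge0; [exact: nn|rewrite lee_fin].
apply: lee_fsum => // r [t _ <-].
set y := h n t; have y0 : (0 <= y)%R by [].
under eq_integral do rewrite EFinM -muleA.
rewrite ge0_integralZl//; first last.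
- by move=> x _; rewrite mule_ge0 ?lee_fin.
- apply: emeasurable_funM => //; apply/measurable_EFinP; exact: measurable_indic.
apply: lee_wpmul2l => //.
under eq_integral do rewrite muleC.
rewrite (eq_integral ((EFin \o g) \_ (h n @^-1` [set y]))); last first.
  by move=> x xE; rewrite epatch_indic.
by rewrite -integral_mkcond; exact: H.
Unshelve. all: by end_near. Qed.
End density.

Section log_density.
Variable R : realType.
Local Notation T := (circle R).
Local Notation m := (@circle_lebesgue R).

Lemma measurable_lne (w : T -> R) : measurable_fun setT w ->
  measurable_fun setT (fun x => lne (w x)%:E).
Proof.
move=> mw.
have -> : (fun x => lne (w x)%:E) = (fun x => if w x <= 0 then -oo%E else (ln (w x))%:E) by [].
apply: measurable_fun_ifT.
- by apply: measurable_fun_ler.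
- exact: measurable_cst.
- by apply/measurable_EFinP; apply: measurableT_comp.
Qed.

(** The positive part of log w is at most w, and the Szego condition bounds the negative part, so
    log w is integrable and w > 0 almost everywhere. The convention ln 0 = 0, which makes exp (ln 0)
    equal to 1, thus acts only on a null set. *)
Lemma szego_log_density (mu : probability T R) (w : T -> R) :
  szego mu -> ac_density mu w ->
  let v x := ln (w x) in
  [/\ intg m v, intg m (fun x => expR (v x)),
   (forall f, bmf f -> (forall x, 0 <= f x) ->
     \int[m]_x (f x * expR (v x)) <= \int[mu]_x f x) &
   forall z, normc z < 1 -> entropy mu w z = ln (pmass mu z) - plog v z].
Proof.
move=> szw acw; have := szw _ acw; case: acw => mw w0 [mu_s _ Hmu] szego_w v.
have mEw : measurable_fun setT (EFin \o w) by exact/measurable_EFinP.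
have dens E : measurable E -> (\int[m]_(x in E) (w x)%:E <= mu E)%E.
  by move=> mE; rewrite Hmu// leeDl.
have w_fin : (\int[m]_x (w x)%:E < +oo)%E.
  apply: le_lt_trans (dens _ measurableT) _.
  exact: (le_lt_trans (probability_le1 mu measurableT) (ltry 1)).
have iw : intg m w.
  apply/integrableP; split => //.
  under eq_integral do rewrite /= ger0_norm//.
  exact: w_fin.
have mL := measurable_lne mw.
have iL : m.-integrable setT (fun x => lne (w x)%:E).
  apply/integrableP; split => //.
  have posfin : (\int[m]_x (fun y => lne (w y)%:E)^\+ x < +oo)%E.
    apply: le_lt_trans w_fin; apply: ge0_le_integral => //.
    - exact: measurable_funepos.
    - move=> x _; rewrite funeposE; have [wx|wx] := leP (w x) 0.
        by rewrite le0_lneNy ?lee_fin// maxNye lee_fin.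
      rewrite ge_max lee_fin w0 andbT lne_EFin// lee_fin.
      exact/ltW/ln_sublinear.
  have negfin : (\int[m]_x (fun y => lne (w y)%:E)^\- x < +oo)%E.
    rewrite ltey; apply/negP => /eqP E; move: szego_w; rewrite integralE E.
    by rewrite addeNy.
  rewrite (eq_integral (fun x => (fun y => lne (w y)%:E)^\+ x + (fun y => lne (w y)%:E)^\- x)%E).
    rewrite ge0_integralD//; last first.
    - exact: measurable_funeneg.
    - exact: measurable_funepos.
    by rewrite lte_add_pinfty.
  by move=> x _; have := congr1 (fun g => g x) (fune_abse (fun y => lne (w y)%:E)).
have aew : {ae m, forall x, 0 < w x}.
  have := integrable_ae measurableT iL; apply: filterS => x /(_ Logic.I).
  by have [wx|//] := leP (w x) 0; rewrite le0_lneNy ?lee_fin.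
have mv : measurable_fun setT v by apply: measurableT_comp.
have iv : intg m v.
  apply: (le_integrable _ _ _ iL) => //; first exact/measurable_EFinP.
  move=> x _; rewrite /v /=; case: ifPn => // wx.
  by rewrite leey.
have ie : intg m (fun x => expR (v x)).
  apply: (@intg_dom _ _ _ _ _ (fun x => w x + 1)).
  - by apply: measurableT_comp.
  - by apply: intgD => //; exact: intg_cst.
  move=> x; rewrite ger0_norm ?expR_ge0// /v; have [wx|wx] := leP (w x) 0.
    by rewrite ln0// expR0 lerDr.
  by rewrite lnK ?posrE// lerDl.
split => //.
  move=> f bf f0; have [mf _] := bf.
  rewrite -lee_fin -!RI_EFin; [|exact: intg_bmf|exact: intgM].
  apply: le_trans (integral_density_le mw w0 mf f0 dens).
  rewrite le_eqVlt; apply/orP; left; apply/eqP; apply: ae_eq_integral => //.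
  - by apply/measurable_EFinP; apply: measurable_funM => //; apply: measurableT_comp.
  - by apply/measurable_EFinP; apply: measurable_funM.
  apply: filterS aew => x wx _.
  by rewrite /v lnK.
move=> z z1; rewrite /entropy /pmass /plog; congr (_ - _).
have [mP _] := bmf_poisson z1.
congr fine; apply: ae_eq_integral => //.
- by apply: emeasurable_funM => //; exact/measurable_EFinP.
- by apply/measurable_EFinP; apply: measurable_funM.
apply: filterS aew => x wx _.
by rewrite lne_EFin// -EFinM mulrC.
Qed.
End log_density.

(** * The normalized kernel *)

Section kernel_ratio.
Variable R : realType.
Local Notation "z ^*" := (conjc z) : ring_scope.
Local Notation T := (circle R).
Local Notation m := (@circle_lebesgue R).

(** The 60 is that of [kernel_err_circles]; of the exponent 12, each variable contributes 3 from
    [weight_multiplier] and 3 from the lower bound in [multiplier_ball]. *)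
Definition kconst : R := 60 * expR 12.

Lemma kconst_gt0 : 0 < kconst.
Proof. by rewrite mulr_gt0// expR_gt0. Qed.

Variables (mu : probability T R) (v : T -> R).
Hypothesis iv : intg m v.
Hypothesis ie : intg m (fun x => expR (v x)).
Hypothesis domW : forall f, bmf f -> (forall x, 0 <= f x) ->
  \int[m]_x (f x * expR (v x)) <= \int[mu]_x f x.
Variables (N : nat) (k : R[i] -> {poly R[i]}).
Hypothesis Hk : forall z, reproducing_kernel mu N.+1 z (k z).
Variables (u : R) (zeta : T).
Hypothesis u0 : 0 < u.
Hypothesis u1 : u <= 10^-1.
Local Notation n := (N.+1%:R : R).
Hypothesis un : 1 <= u * n.
Local Notation A := (u * n).
Local Notation zb := (zbase u zeta).
Local Notation a := (pmass mu zb).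
Local Notation r := (1 - u).
Local Notation h := (N.+1./2).
Local Notation E z x := (kernel_err N k a z).[x].

Section fixed_s.
Variable s : R.
Hypothesis s0 : 0 < s.
Hypothesis s8 : s <= 1 / 8.
Hypothesis Hs : ln a - plog v zb <= s ^+ 2.

Lemma half_le : (2 * h)%:R <= n.
Proof. by rewrite ler_nat mul2n -[leqRHS]odd_double_half leq_addl. Qed.

(** u <= 1/10, that is n >= 10 A, gives 1 - u >= exp(- u - 2 u^2) >= exp(- 1.2 u). *)
Lemma radius_pow : r ^- (2 * h) <= expR (12 / 10 * A).
Proof.
have r0 : 0 < r by move: u1; lra.
have h1 : expR (- (12 / 10 * u)) <= r.
  apply: le_trans (@expR_le_oneDx R (- u) _); last by move: u1; lra.
  by rewrite ler_expR sqrrN expr2; move: u0 u1; nra.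
have h2 : r^-1 <= expR (12 / 10 * u).
  by rewrite -[leRHS]invrK -expRN lef_pV2 ?posrE ?expR_gt0.
rewrite -exprVn; apply: (@le_trans _ _ (expR (12 / 10 * u) ^+ (2 * h))).
  by rewrite lerXn2r ?nnegrE ?expR_ge0 ?invr_ge0 ?(ltW r0).
rewrite -expRM_natr ler_expR.
have -> : 12 / 10 * A = 12 / 10 * u * n by ring.
by apply: ler_wpM2l; [apply: mulr_ge0 => //; exact: ltW|exact: half_le].
Qed.

Lemma ball_pow (x : R[i]) : normc (x - cval zeta) <= u -> normc x ^+ h <= expR (A / 2).
Proof.
move=> xu; have x1 : normc x <= 1 + u.
  have := normcB_ge x (cval zeta); rewrite normc_cval; move: xu; lra.
apply: (@le_trans _ _ (expR u ^+ h)).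
  rewrite lerXn2r ?nnegrE ?expR_ge0 ?normc_ge0//.
  exact: le_trans x1 (expR_ge1Dx u).
rewrite -expRM_natr ler_expR.
have -> : A / 2 = u * (n / 2) by ring.
apply: ler_wpM2l; first exact: ltW.
by have := half_le; rewrite natrM; lra.
Qed.

Lemma ball_annulus (x : R[i]) : normc (x - cval zeta) <= u ->
  r <= normc x /\ normc x <= r^-1.
Proof.
have r0 : 0 < r by move: u1; lra.
move=> xu; split.
  have := normcB_ge (cval zeta) x; rewrite normc_cval normcBC; move: xu; lra.
apply: (@le_trans _ _ (1 + u)).
  have := normcB_ge x (cval zeta); rewrite normc_cval; move: xu; lra.
by rewrite -[leRHS]mul1r ler_pdivlMr//; move: u0; nra.
Qed.

Lemma kernel_err_ball (x z : R[i]) : normc (x - cval zeta) <= u -> normc (z - cval zeta) <= u ->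
  normc (E z x) <= kconst * n * s * expR (22 / 10 * A).
Proof.
move=> xu zu; have [J [J4 J5]] := exists_multiplier_exponent u0 u1.
have mx := multiplier_ball u0 u1 xu J5; have mz := multiplier_ball u0 u1 zu J5.
have [x1 x2] := ball_annulus xu; have [z1 z2] := ball_annulus zu.
have mx0 : 0 < multiplier zeta J x by apply: lt_le_trans mx; exact: expR_gt0.
have mz0 : 0 < multiplier zeta J z by apply: lt_le_trans mz; exact: expR_gt0.
have H := kernel_err_annulus u0 u1 iv ie domW Hk un s0 s8 Hs J5 J4 x1 x2 z1 z2 mx0 mz0.
have ns : 0 <= 60 * n * s by rewrite !mulr_ge0// ltW.
have c0 : 0 <= normc (E z x) by exact: normc_ge0.
have h1 : normc (E z x) * (expR (-3) * expR (-3)) <=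
   60 * n * s * (expR 6 * expR (12 / 10 * A)) * (expR (A / 2) * expR (A / 2)).
  apply: (@le_trans _ _ (normc (E z x) * (multiplier zeta J x * multiplier zeta J z))).
    by rewrite ler_wpM2l// ler_pM ?expR_ge0.
  apply: le_trans H _; apply: ler_pM.
  - rewrite mulr_ge0// mulr_ge0 ?expR_ge0// invr_ge0 exprn_ge0//.
    by move: u1; lra.
  - by rewrite mulr_ge0// exprn_ge0 ?normc_ge0.
  - by rewrite ler_wpM2l// ler_wpM2l ?expR_ge0 ?radius_pow.
  - by apply: ler_pM; rewrite ?exprn_ge0 ?normc_ge0 ?ball_pow.
rewrite -expRD -ler_pdivlMr ?expR_gt0// -expRN in h1.
apply: le_trans h1 _; rewrite /kconst.
have -> : 60 * n * s * (expR 6 * expR (12 / 10 * A)) * (expR (A / 2) * expR (A / 2)) * expR (- (-3 + -3)) =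
   60 * n * s * expR (12 + 22 / 10 * A).
  have -> : 12 + 22 / 10 * A = 6 + 12 / 10 * A + (A / 2 + A / 2) + - (-3 + -3) by field.
  by rewrite !expRD; ring.
by rewrite expRD le_eqVlt; apply/orP; left; apply/eqP; ring.
Qed.

(** At the centre the multiplier and |zeta| are both 1, so the exponent drops from 2.2 A to 1.2 A.
    This matters in [ratio_ball], where this error is multiplied by a Szego sum of size n exp(2
    A). *)
Lemma kernel_err_center : normc (E (cval zeta) (cval zeta)) <= kconst * n * s * expR (12 / 10 * A).
Proof.
have [J [J4 J5]] := exists_multiplier_exponent u0 u1.
have zu : normc (cval zeta - cval zeta) <= u by rewrite subrr normc_zero ltW.
have [z1 z2] := ball_annulus zu.
have mz0 : 0 < multiplier zeta J (cval zeta) by rewrite multiplier_center.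
have := kernel_err_annulus u0 u1 iv ie domW Hk un s0 s8 Hs J5 J4 z1 z2 z1 z2 mz0 mz0.
rewrite multiplier_center normc_cval !expr1n !mulr1 => H; apply: le_trans H _.
have ns : 0 <= 60 * n * s by rewrite !mulr_ge0// ltW.
have -> : kconst * n * s * expR (12 / 10 * A) = 60 * n * s * (expR 12 * expR (12 / 10 * A)).
  by rewrite /kconst; ring.
rewrite ler_wpM2l// ler_pM ?expR_ge0 ?radius_pow//.
- by rewrite invr_ge0 exprn_ge0//; move: u1; lra.
- by rewrite ler_expR; lra.
Qed.

(** Keeps |E(zeta, zeta)| at most n/2, and thereby the denominator of the ratio away from 0. This
    condition makes eps0 depend on A. *)
Hypothesis sA : kconst * s * expR (12 / 10 * A) <= 1 / 2.

Definition ratio_poly z2 : {poly R[i]} :=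
  ((k (cval zeta)).[cval zeta])^-1 *: k z2 - (N.+1%:R)^-1 *: szego_poly N.+1 z2.

Lemma horner_ratio_poly (z1 z2 : R[i]) : (ratio_poly z2).[z1] =
  (k z2).[z1] / (k (cval zeta)).[cval zeta] - (szego_poly N.+1 z2).[z1] / N.+1%:R.
Proof.
by rewrite /ratio_poly hornerD hornerN !hornerZ [_^-1 * (k z2).[z1]]mulrC [_^-1 * (szego_poly _ _).[_]]mulrC.
Qed.

Lemma szego_center : (szego_poly N.+1 (cval zeta)).[cval zeta] = N.+1%:R.
Proof.
rewrite szego_poly_diag natC; congr (_%:C).
rewrite (eq_bigr (fun=> 1)); first by rewrite sumr_const card_ord.
by move=> j _; rewrite normc_cval expr1n.
Qed.

Lemma kernel_center_real : ((k (cval zeta)).[cval zeta])^* = (k (cval zeta)).[cval zeta].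
Proof. by rewrite [RHS](kernel_sym Hk). Qed.

Lemma ratio_sym (z : R[i]) : (ratio_poly z).[cval zeta] = ((ratio_poly (cval zeta)).[z])^*.
Proof.
rewrite !horner_ratio_poly conjcB !conjcM !conjc_inv kernel_center_real.
rewrite -(kernel_sym Hk) -(szego_sym N).
by rewrite natC conjc_real.
Qed.

Lemma den_ge : n / 2 <= normc (N.+1%:R + E (cval zeta) (cval zeta)).
Proof.
have n0 : 0 < n by rewrite ltr0n.
have h1 : normc (E (cval zeta) (cval zeta)) <= n / 2.
  apply: le_trans kernel_err_center _.
  have -> : kconst * n * s * expR (12 / 10 * A) = n * (kconst * s * expR (12 / 10 * A)) by ring.
  by rewrite -[X in _ <= n * X]mul1r ler_wpM2l// ltW.
have := normcB_ge (N.+1%:R : R[i]) (- E (cval zeta) (cval zeta)).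
rewrite opprK normcNr normc_nat; move: h1; lra.
Qed.

Lemma kernel_center_neq0 : (k (cval zeta)).[cval zeta] != 0.
Proof.
have n0 : 0 < n by rewrite ltr0n.
have a0 : 0 < a by apply: pmass_gt0; rewrite normc_inner//; move: u0; lra.
apply/eqP => k00; have := den_ge; rewrite /kernel_err hornerD hornerN hornerZ k00 mulr0 sub0r.
rewrite szego_center subrr normc_zero.
by apply/negP; rewrite -ltNge divr_gt0.
Qed.

Lemma szego_ball (x z : R[i]) : normc (x - cval zeta) <= u -> normc (z - cval zeta) <= u ->
  normc (szego_poly N.+1 z).[x] <= n * expR (2 * A).
Proof.
move=> xu zu.
have bnd (y : R[i]) : normc (y - cval zeta) <= u -> normc y <= expR u.
  move=> yu; apply: le_trans (expR_ge1Dx u).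
  have := normcB_ge y (cval zeta); rewrite normc_cval; move: yu; lra.
rewrite horner_szego_poly; apply: le_trans (normc_sum _ _ _) _.
apply: (@le_trans _ _ (\sum_(j < N.+1) expR (2 * A))).
  apply: ler_sum => j _; rewrite normcM !normcX normcJr -exprMn.
  apply: (@le_trans _ _ ((expR u * expR u) ^+ j)).
    rewrite lerXn2r ?nnegrE ?mulr_ge0 ?normc_ge0 ?expR_ge0//.
    by apply: ler_pM; rewrite ?normc_ge0// bnd.
  rewrite -expRD -expRM_natr ler_expR.
  have -> : 2 * A = (u + u) * n by ring.
  rewrite ler_wpM2l ?addr_ge0 ?(ltW u0)// ler_nat ltnW//.
by rewrite sumr_const card_ord [leRHS]mulr_natl.
Qed.

(** The mass [a] cancels in the ratio, and the difference is (n E(z1, z2) - k0 Ec)/(n (n + Ec)).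
    Both products in the numerator are at most kconst s exp(4 A) n^2, and the denominator is at
    least n^2/2, hence the 4. *)
Lemma ratio_ball (z1 z2 : R[i]) : normc (z1 - cval zeta) <= u -> normc (z2 - cval zeta) <= u ->
  normc (ratio_poly z2).[z1] <= 4 * kconst * s * expR (4 * A).
Proof.
move=> z1u z2u; have n0 : 0 < n by rewrite ltr0n.
have a0 : 0 < a by apply: pmass_gt0; rewrite normc_inner//; move: u0; lra.
have aC0 : a%:C != 0 :> R[i] by rewrite eq_complex /= eqxx andbT lt0r_neq0.
have nC0 : N.+1%:R != 0 :> R[i] by rewrite pnatr_eq0.
have dg := den_ge.
set Ec := E (cval zeta) (cval zeta) in dg *.
have den0 : N.+1%:R + Ec != 0.
  by rewrite -normc_gt0; apply: lt_le_trans dg; rewrite divr_gt0.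
have kE (z x : R[i]) : a%:C * (k z).[x] = E z x + (szego_poly N.+1 z).[x].
  by rewrite /kernel_err hornerD hornerN hornerZ subrK.
set k0 := (szego_poly N.+1 z2).[z1].
have -> : (ratio_poly z2).[z1] =
    (N.+1%:R * E z2 z1 - k0 * Ec) / (N.+1%:R * (N.+1%:R + Ec)).
  rewrite horner_ratio_poly.
  have e1 : (k z2).[z1] = (a%:C)^-1 * (E z2 z1 + k0) by rewrite -kE mulKf.
  have e2 : (k (cval zeta)).[cval zeta] = (a%:C)^-1 * (N.+1%:R + Ec).
    by rewrite addrC -szego_center -kE mulKf.
  rewrite e1 e2 -/k0; move: (N.+1%:R : R[i]) nC0 den0 aC0 => nn nC0 den0 aC0.
  by field; rewrite nC0 den0 aC0.
rewrite normcM normcV normcM normc_nat.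
have dn : n * (n / 2) <= n * normc (N.+1%:R + Ec) by rewrite ler_wpM2l// ltW.
have dn0 : 0 < n * (n / 2) by rewrite mulr_gt0// divr_gt0.
rewrite ler_pdivrMr; last exact: lt_le_trans dn.
have A1 : 1 <= A by exact: un.
have e1 := kernel_err_ball z1u z2u; have e2 := kernel_err_center; rewrite -/Ec in e2.
have e3 := szego_ball z1u z2u; rewrite -/k0 in e3.
have ks : 0 <= kconst * s by rewrite mulr_ge0 ?(ltW kconst_gt0) ?(ltW s0).
have x1 : expR (22 / 10 * A) <= expR (4 * A) by rewrite ler_expR; lra.
have x2 : expR (2 * A) * expR (12 / 10 * A) <= expR (4 * A).
  by rewrite -expRD ler_expR; lra.
apply: (@le_trans _ _ (4 * kconst * s * expR (4 * A) * (n * (n / 2)))); last first.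
  have -> : 4 * kconst * s * expR (4 * A) = 4 * (kconst * s * expR (4 * A)) by ring.
  apply: ler_wpM2l => //; apply: mulr_ge0 => //.
  by apply: mulr_ge0 => //; exact: expR_ge0.
apply: le_trans (normcB_le _ _) _; rewrite !normcM normc_nat.
have y1 : n * normc (E z2 z1) <= kconst * s * expR (4 * A) * (n * n).
  have -> : kconst * s * expR (4 * A) * (n * n) = n * (kconst * n * s * expR (4 * A)) by ring.
  rewrite ler_wpM2l ?(ltW n0)//; apply: le_trans e1 _.
  have -> : kconst * n * s = n * (kconst * s) by ring.
  by rewrite ler_wpM2l// mulr_ge0// ltW.
have y2 : normc k0 * normc Ec <= kconst * s * expR (4 * A) * (n * n).
  apply: le_trans (ler_pM (normc_ge0 _) (normc_ge0 _) e3 e2) _.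
  have -> : n * expR (2 * A) * (kconst * n * s * expR (12 / 10 * A)) =
     (n * n) * (kconst * s) * (expR (2 * A) * expR (12 / 10 * A)) by ring.
  have -> : kconst * s * expR (4 * A) * (n * n) = (n * n) * (kconst * s) * expR (4 * A) by ring.
  by rewrite ler_wpM2l// !mulr_ge0// ltW.
have -> : 4 * kconst * s * expR (4 * A) * (n * (n / 2)) =
  kconst * s * expR (4 * A) * (n * n) + kconst * s * expR (4 * A) * (n * n) by field.
exact: lerD.
Qed.

Lemma on_circle_ball xi : normc (cval zeta + u%:C * cval xi - cval zeta) <= u.
Proof.
by rewrite addrAC subrr add0r normcZ ?(ltW u0)// normc_cval mulr1.
Qed.

(** Write D(z1, z2) = [D(z1, z2) - D(zeta, z2)] + D(zeta, z2). The bracket vanishes at z1 = zeta and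
    is bounded by 2 Q; the last term is conj(D(z2, zeta)), which vanishes at z2 = zeta and is
    bounded by Q. So 12 = 4 (2 + 1). *)
Lemma ratio_schwarz (z1 z2 : R[i]) : normc (z1 - cval zeta) <= u -> normc (z2 - cval zeta) <= u ->
  normc (ratio_poly z2).[z1] <= 12 * kconst * s * expR (4 * A) *
   (Num.max (normc (z1 - cval zeta)) (normc (z2 - cval zeta)) / u).
Proof.
move=> z1u z2u; set dl := Num.max _ _.
pose Q := 4 * kconst * s * expR (4 * A).
have Q0 : 0 <= Q.
  by rewrite /Q mulr_ge0 ?expR_ge0// mulr_ge0 ?(ltW s0)// mulr_ge0 ?(ltW kconst_gt0).
have zu : normc (cval zeta - cval zeta) <= u by rewrite subrr normc_zero ltW.
have b (z : R[i]) xi : normc (z - cval zeta) <= u ->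
    normc (ratio_poly z).[cval zeta + u%:C * cval xi] <= Q.
  by move=> zu'; apply: ratio_ball => //; exact: on_circle_ball.
have center0 : (ratio_poly (cval zeta)).[cval zeta] = 0.
  rewrite horner_ratio_poly divff ?kernel_center_neq0// szego_center.
  by rewrite divff ?pnatr_eq0// subrr.
have h2 : normc (ratio_poly z2).[cval zeta] <= Q * (dl / u).
  rewrite ratio_sym normcJr.
  apply: le_trans (schwarz_poly u0 Q0 center0 (fun xi => b _ xi zu) z2u) _.
  by rewrite ler_wpM2l// ler_wpM2r ?invr_ge0 ?(ltW u0)// le_max lexx orbT.
pose P := ratio_poly z2 - ((ratio_poly z2).[cval zeta])%:P.
have PE (x : R[i]) : P.[x] = (ratio_poly z2).[x] - (ratio_poly z2).[cval zeta].
  by rewrite /P hornerD hornerN hornerC.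
have h1 : normc P.[z1] <= (2 * Q) * (dl / u).
  have P0 : P.[cval zeta] = 0 by rewrite PE subrr.
  have PQ xi : normc P.[cval zeta + u%:C * cval xi] <= 2 * Q.
    rewrite PE; apply: le_trans (normcB_le _ _) _.
    have := b z2 xi z2u; have := ratio_ball zu z2u; rewrite -/Q; lra.
  have Q20 : 0 <= 2 * Q by rewrite mulr_ge0.
  apply: le_trans (schwarz_poly u0 Q20 P0 PQ z1u) _.
  by rewrite ler_wpM2l// ler_wpM2r ?invr_ge0 ?(ltW u0)// le_max lexx.
have -> : (ratio_poly z2).[z1] = P.[z1] + (ratio_poly z2).[cval zeta] by rewrite PE subrK.
apply: le_trans (normcD_le _ _) _.
have -> : 12 * kconst * s * expR (4 * A) * (dl / u) = 2 * Q * (dl / u) + Q * (dl / u).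
  by rewrite /Q; ring.
exact: lerD.
Qed.
End fixed_s.
End kernel_ratio.

(** * Passage to the square root of the entropy, and transport to depth delta *)

Section kernel_asymptotics.
Variable R : realType.
Local Notation T := (circle R).
Local Notation m := (@circle_lebesgue R).

Variables (mu : probability T R) (v : T -> R).
Hypothesis iv : intg m v.
Hypothesis ie : intg m (fun x => expR (v x)).
Hypothesis domW : forall f, bmf f -> (forall x, 0 <= f x) ->
  \int[m]_x (f x * expR (v x)) <= \int[mu]_x f x.
Variables (u : R) (zeta : T).
Hypothesis u0 : 0 < u.
Hypothesis u1 : u <= 10^-1.
Local Notation K z := (ln (pmass mu z) - plog v z).

(** [ratio_schwarz] asks for s > 0, whereas the root of the entropy may vanish; it is used with s =
    q + t sM/2, and t -> 0+. A negative entropy, whose root is 0 by convention, needs no separate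
    estimate. *)
Lemma ratio_sqrt (N : nat) (k : R[i] -> {poly R[i]}) (sM : R) (z1 z2 : R[i]) :
  (forall z, reproducing_kernel mu N.+1 z (k z)) ->
  1 <= u * N.+1%:R -> 0 < sM -> sM <= 1 / 8 ->
  kconst R * sM * expR (12 / 10 * (u * N.+1%:R)) <= 1 / 2 ->
  Num.sqrt (K (zbase u zeta)) <= sM / 2 ->
  normc (z1 - cval zeta) <= u -> normc (z2 - cval zeta) <= u ->
  normc (ratio_poly N k zeta z2).[z1] <=
  12 * kconst R * Num.sqrt (K (zbase u zeta)) * expR (4 * (u * N.+1%:R)) *
  (Num.max (normc (z1 - cval zeta)) (normc (z2 - cval zeta)) / u).
Proof.
move=> Hk un s0 s8 sA; set q := Num.sqrt _ => qs z1u z2u.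
set dl := Num.max _ _; set e := expR (4 * _).
pose g t := 12 * kconst R * (q + t * (sM / 2)) * e * (dl / u).
have q0 : 0 <= q by exact: sqrtr_ge0.
apply: (@le_at_right _ _ _ g).
  have -> : 12 * kconst R * q * e * (dl / u) =
     12 * kconst R * (q + 0 * (sM / 2)) * e * (dl / u) by rewrite mul0r addr0.
  have hid : x @[x --> (0 : R)^'+] --> (0 : R).
    by apply: cvg_at_right_filter; exact: cvg_id.
  apply: cvgM; last exact: cvg_cst.
  apply: cvgM; last exact: cvg_cst.
  apply: cvgM; first exact: cvg_cst.
  apply: cvgD; first exact: cvg_cst.
  by apply: cvgM => //; exact: cvg_cst.
move=> t t0 t1; set s := q + t * (sM / 2).
have tp : 0 < t * (sM / 2) by rewrite mulr_gt0// divr_gt0.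
have tl : t * (sM / 2) <= sM / 2 by rewrite ler_piMl// ltW// divr_gt0.
have sp : 0 < s by rewrite /s; move: q0 tp; lra.
have ssM : s <= sM by rewrite /s; move: qs tl; lra.
apply: (ratio_schwarz iv ie domW Hk u0 u1 un sp _ _ _ z1u z2u).
- exact: le_trans s8.
- apply: (@le_trans _ _ (q ^+ 2)); last first.
    by rewrite lerXn2r ?nnegrE ?(ltW sp)// lerDl ltW.
  have [k0|k0] := leP 0 (K (zbase u zeta)); first by rewrite sqr_sqrtr.
  by apply: (le_trans (ltW k0)); exact: sqr_ge0.
- apply: le_trans sA; rewrite ler_wpM2r ?expR_ge0// ler_wpM2l//.
  exact/ltW/kconst_gt0.
Qed.

(* Harnack: the Poisson kernel at [(1 - u) zeta] is at most [8 (u / d)] times the one at [(1 - d) zeta];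
   and [sqrt 8 <= 3]. *)
Lemma sqrt_entropy_le (d : R) : 0 < d -> d <= u ->
  Num.sqrt (K (zbase u zeta)) * (d / u) <= 3 * Num.sqrt (K ((1 - d)%:C * cval zeta)).
Proof.
move=> d0 du; have d1 : d <= 10^-1 := le_trans du u1.
have nu : normc (zbase u zeta) = 1 - u by rewrite normc_inner.
have nd : normc ((1 - d)%:C * cval zeta) = 1 - d by rewrite normc_inner.
have lu : normc (zbase u zeta) < 1 by rewrite nu; move: u0; lra.
have ld : normc ((1 - d)%:C * cval zeta) < 1 by rewrite nd; lra.
have dom x : poisson (zbase u zeta) x <= (8 * (u / d)) * poisson ((1 - d)%:C * cval zeta) x.
  have h : normc (zbase u zeta - (1 - d)%:C * cval zeta) <= 1 * (1 - normc (zbase u zeta)).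
    rewrite nu /zbase -mulrBl -rmorphB normcM normc_cval mulr1 normc_real.
    by rewrite ler_norml; move: d0 du; lra.
  apply: le_trans (poisson_dom x lu ld ler01 h) _.
  apply: ler_wpM2r; first exact/ltW/poisson_gt0.
  have p0 : 0 < 1 - (1 - d) ^+ 2 by rewrite sqrrB expr1n expr2; move: d0 d1; nra.
  rewrite nu nd mulrAC ler_pdivrMr// mulrA [leRHS]mulrAC ler_pdivlMr//.
  rewrite !expr2; move: u0 d0 du u1; nra.
have e8 : 0 <= 8 * (u / d) by rewrite mulr_ge0// divr_ge0// ltW.
have := entropy_le iv ie domW ld lu dom => /ler_wsqrtr; rewrite sqrtrM// => h.
have du0 : 0 <= d / u by rewrite divr_ge0// ltW.
apply: le_trans (ler_wpM2r du0 h) _; rewrite mulrAC ler_wpM2r ?sqrtr_ge0//.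
rewrite -[X in _ * X](ger0_norm du0) -sqrtr_sqr -sqrtrM//.
rewrite -[leRHS](@ger0_norm R 3)// -sqrtr_sqr ler_wsqrtr//.
have -> : 8 * (u / d) * (d / u) ^+ 2 = 8 * (d / u) by field; rewrite !lt0r_neq0.
have : d / u <= 1 by rewrite ler_pdivrMr// mul1r.
lra.
Qed.
End kernel_asymptotics.
Theorem theorem1 (R : realType) :
  exists2 c : R, 0 < c &
  forall A : R, 1 <= A ->
  exists2 eps0 : R, 0 < eps0 &
  forall (mu : probability (circle R) R) (w : circle R -> R) (n : nat)
    (k : R[i] -> {poly R[i]}) (zeta : circle R) (z1 z2 : R[i]),
  szego mu -> ac_density mu w ->
  10 * A <= n%:R ->
  (forall z, reproducing_kernel mu n z (k z)) ->
  normc (z1 - cval zeta) <= A / n%:R ->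
  normc (z2 - cval zeta) <= A / n%:R ->
  (forall rho : R, 1 - A / n%:R <= rho < 1 ->
    entropy mu w (rho%:C * cval zeta) <= eps0) ->
  let delta := Num.max (normc (z1 - cval zeta)) (normc (z2 - cval zeta)) in
  normc ((k z2).[z1] / (k (cval zeta)).[cval zeta]
         - (\sum_(j < n) z2^* ^+ j * z1 ^+ j) / n%:R)
  <= c * expR (4 * A) *
     sup [set Num.sqrt (entropy mu w (rho%:C * cval zeta))
         | rho in `[1 - delta, 1[ ].
Proof.
have kc := kconst_gt0 R; have c0 : 0 < 36 * kconst R by rewrite mulr_gt0.
exists (36 * kconst R) => // A A1.
pose sM : R := 1 / (8 * kconst R * expR (12 / 10 * A)).
have eA := expR_gt0 (12 / 10 * A).
have dM : 0 < 8 * kconst R * expR (12 / 10 * A) by rewrite !mulr_gt0.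
have sM0 : 0 < sM by rewrite divr_gt0.
have sMA : kconst R * sM * expR (12 / 10 * A) <= 1 / 2.
  have -> : kconst R * sM * expR (12 / 10 * A) = 1 / 8 by rewrite /sM; field; rewrite !lt0r_neq0.
  lra.
have sM8 : sM <= 1 / 8.
  have h1 : 1 <= kconst R by have := expR_ge1Dx (12 : R); rewrite /kconst; lra.
  have h2 : 1 <= expR (12 / 10 * A) by have := expR_ge1Dx (12 / 10 * A); move: A1; lra.
  rewrite /sM !mul1r lef_pV2 ?posrE// -mulrA.
  by have := ler_pM ler01 ler01 h1 h2; lra.
(* The root of the entropy takes one half of [sM]; the other half is the slack t sM/2 of
   [ratio_sqrt]. *)
exists ((sM / 2) ^+ 2); first by rewrite exprn_gt0// divr_gt0.
move=> mu w [|N] k zeta z1 z2 szw acw nA Hk z1u z2u small /=; set delta := Num.max _ _.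
  by move: nA A1; lra.
have n0 : 0 < N.+1%:R :> R by rewrite ltr0n.
set u := A / N.+1%:R in z1u z2u small.
have u0 : 0 < u by rewrite divr_gt0//; move: A1; lra.
have u1 : u <= 10^-1 by rewrite ler_pdivrMr// ler_pdivlMl.
have uA : u * N.+1%:R = A by rewrite divfK// lt0r_neq0.
have [iv ie domW entE] := szego_log_density szw acw.
set v := fun x => ln (w x) in iv ie domW entE.
have nrm (d : R) : d <= u -> normc ((1 - d)%:C * cval zeta) = 1 - d.
  by move=> du; apply: normc_inner; exact: le_trans u1.
have inner (d : R) : 0 < d -> d <= u -> normc ((1 - d)%:C * cval zeta) < 1.
  by move=> d0 du; rewrite nrm//; lra.
have sqsM : Num.sqrt ((sM / 2) ^+ 2) = sM / 2.
  by rewrite sqrtr_sqr ger0_norm// divr_ge0// ltW.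
have ent_small (rho : R) : 1 - u <= rho < 1 ->
    Num.sqrt (entropy mu w (rho%:C * cval zeta)) <= sM / 2.
  by move=> h; rewrite -sqsM ler_wsqrtr// small.
have zbE : Num.sqrt (ln (pmass mu (zbase u zeta)) - plog v (zbase u zeta)) <= sM / 2.
  rewrite -entE; last exact: inner.
  by apply: ent_small; apply/andP; split => //; move: u0; lra.
have un : 1 <= u * N.+1%:R by rewrite uA.
have sMA' : kconst R * sM * expR (12 / 10 * (u * N.+1%:R)) <= 1 / 2 by rewrite uA.
have H := ratio_sqrt iv ie domW u0 u1 Hk un sM0 sM8 sMA' zbE z1u z2u.
rewrite uA -/delta in H.
have -> : (k z2).[z1] / (k (cval zeta)).[cval zeta] -
   (\sum_(j < N.+1) z2^* ^+ j * z1 ^+ j) / N.+1%:R = (ratio_poly N k zeta z2).[z1].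
  by rewrite horner_ratio_poly horner_szego_poly.
apply: le_trans H _; set q := Num.sqrt _; set S := [set _ | _ in _].
have e0 : 0 <= expR (4 * A) by exact: expR_ge0.
have -> : 12 * kconst R * q * expR (4 * A) * (delta / u) =
   12 * kconst R * expR (4 * A) * (q * (delta / u)) by ring.
(* 36 = 12 * 3: the 12 of [ratio_schwarz] and the 3 of [sqrt_entropy_le]. *)
have -> : 36 * kconst R * expR (4 * A) * sup S =
   12 * kconst R * expR (4 * A) * (3 * sup S) by ring.
apply: ler_wpM2l; first by apply: mulr_ge0 => //; apply: mulr_ge0 => //; exact: ltW.
have delta0 : 0 <= delta by rewrite le_max normc_ge0.
have deltau : delta <= u by rewrite ge_max z1u z2u.
move: delta0; rewrite le_eqVlt => /predU1P[d0|d0].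
  (* For delta = 0 the supremum over the empty interval is 0, and the factor delta / u won by
     Schwarz' lemma vanishes as well. *)
  have -> : S = set0.
    rewrite /S -d0 subr0 -subset0 => y [rho] /=; rewrite in_itv /= => /andP[h1 h2] _; exfalso.
    by move: h1 h2; lra.
  by rewrite sup0 -d0 mul0r !mulr0.
apply: le_trans (sqrt_entropy_le iv ie domW zeta u0 u1 d0 deltau) _.
rewrite ler_wpM2l//; apply: ub_le_sup.
  (* The smallness hypothesis on all of [1 - A/n, 1) bounds the set, so that its supremum dominates
     the value at rho = 1 - delta. *)
  exists (sM / 2) => y [rho] /=; rewrite in_itv /= => /andP[h1 h2] <-.
  by apply: ent_small; rewrite h2 andbT; move: deltau h1; lra.
exists (1 - delta); first by rewrite /= in_itv /= lexx /=; move: d0; lra.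
by rewrite entE//; exact: inner.
Qed.
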